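(* Let $\pi$ be a smooth irreducible representation of $G=\mathrm{GL}_2(F)$ over $\overline{\mathbb F}_p$ with central character. The following three conditions are equivalent: (i) $D_1(\pi)$ is finite-dimensional over $\overline{\mathbb F}_p$; (ii) $\pi$ admits a finite presentation; (iii) $\pi$ admits a standard presentation. If one of these conditions is satisfied, then (iv) $\pi$ is admissible; (v) the space $I^+(\pi)^{\begin{pmatrix}1&\mathcal O\\0&1\end{pmatrix}}$ of vectors of $I^+(\pi)$ fixed by $\begin{pmatrix}1&\mathcal O\\0&1\end{pmatrix}$ is finite-dimensional.
   Context: Let $p$ be a prime, $F$ a field complete for a discrete valuation with finite residue field of characteristic $p$, $\mathcal O$ its ring of integers, $\varpi$ a fixed uniformizer. $\overline{\mathbb F}_p$ is a fixed algebraically closed field of characteristic $p$; all representations are on $\overline{\mathbb F}_p$-vector spaces; smooth means that every vector is fixed by an open subgroup; a smooth representation is admissible if its space of invariants under each open subgroup is finite-dimensional. $G=\mathrm{GL}_2(F)$, $K=\mathrm{GL}_2(\mathcal O)$, $Z$ is the centre of $G$, $\Pi=\begin{pmatrix}0&1\\ \varpi&0\end{pmatrix}$, and $P^+=\begin{pmatrix}\mathcal O-\{0\}&\mathcal O\\0&1\end{pmatrix}$ (a submonoid of $G$). Definition of $D_1(\pi)$: choose any irreducible $KZ$-subrepresentation $\sigma\subset\pi$; put $I^+(\pi)=\langle P^+\cdot\sigma\rangle$ (linear span of all $gx$, $g\in P^+$, $x\in\sigma$), $I^-(\pi)=\Pi\cdot I^+(\pi)$ (these do not depend on $\sigma$),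 and $D_1(\pi)=I^+(\pi)\cap I^-(\pi)$. Compact induction: for a smooth representation $W$ of $KZ$, $\mathrm{c}\text{-}\mathrm{Ind}_{KZ}^GW$ is the space of locally constant functions $f:G\to W$ with compact support modulo $KZ$ and $f(hg)=h\cdot f(g)$ for $h\in KZ$, with $(g'f)(g)=f(gg')$; $[g,v]$ is the element with support $KZg^{-1}$ and value $v$ at $g^{-1}$. Presentations: let $\mathcal W(\pi)$ be the set of finite-dimensional $KZ$-stable subspaces of $\pi$ generating $\pi$ as an $\overline{\mathbb F}_p[G]$-module. For $W\in\mathcal W(\pi)$, let $R(W,\pi)$ be the kernel of the surjection $\mathrm{c}\text{-}\mathrm{Ind}_{KZ}^GW\to\pi$, $[g,w]\mapsto gw$. This surjection is a finite presentation of $\pi$ if $R(W,\pi)$ is finitely generated as an $\overline{\mathbb F}_p[G]$-module. It is a standard presentation if $R(W,\pi)$ is generated as an $\overline{\mathbb F}_p[G]$-module by the elements $\left[\begin{pmatrix}\varpi&0\\0&1\end{pmatrix},x\right]-\left[\mathrm{Id},\begin{pmatrix}\varpi&0\\0&1\end{pmatrix}x\right]$ with $x\in W\cap\begin{pmatrix}\varpi^{-1}&0\\0&1\end{pmatrix}W$. One says $\pi$ admits a finite (resp. standard) presentation if this holds for some $W\in\mathcal W(\pi)$. *)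

(* Defs.v *)
From HB Require Import structures.
From mathcomp Require Import all_boot all_order all_algebra.
From mathcomp Require Import all_classical.
From mathcomp Require Import topology_structure compact.

Set Implicit Arguments.
Unset Strict Implicit.
Unset Printing Implicit Defensive.

Import Order.TTheory GRing.Theory Num.Theory.
Local Open Scope classical_set_scope.
Local Open Scope ring_scope.

(* A field complete for a normalized discrete valuation [valn], with finite
   residue field of characteristic p (for p prime).  The value of [valn] at 0
   is irrelevant: [valge n x] stands for "v(x) >= n" with v(0) = +oo, so that
   [valge n] is the fractional ideal of elements of valuation at least n. *)
Structure localField (p : nat) := LocalField {
  lf_field :> fieldType;
  valn : lf_field -> int;
  valge := fun (n : int) (x : lf_field) => (x == 0) || (n <= valn x);
  valnM : forall x y, x != 0 -> y != 0 -> valn (x * y) = valn x + valn y;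
  valgeD : forall n x y, valge n x -> valge n y -> valge n (x + y);
  valn_onto : exists2 x, x != 0 & valn x = 1;
  lf_complete : forall u : nat -> lf_field,
    (forall n : int, exists N : nat, forall i j : nat,
      (N <= i)%N -> (N <= j)%N -> valge n (u i - u j)) ->
    exists l, forall n : int, exists N : nat, forall i : nat,
      (N <= i)%N -> valge n (u i - l);
  residue_finite : exists s : seq lf_field, forall x, valge 0 x ->
    exists2 y, y \in s & valge 1 (x - y);
  residue_pchar : valge 1 p%:R
}.

Section Valuation.
Context {p : nat} {F : localField p}.
Implicit Types x y : F.

Definition integral_elt x : bool := valge 0 x.

Definition uniformizer x : bool := (x != 0) && (valn x == 1).

Lemma valge0 n : valge n (0 : F).
Proof. by rewrite /valge eqxx. Qed.

Lemma valn1 : valn (1 : F) = 0.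
Proof.
have := @valnM _ F 1 1 (oner_neq0 _) (oner_neq0 _).
by rewrite mulr1 => v11; apply: (addrI (valn (1 : F))); rewrite addr0 -v11.
Qed.

Lemma valge_le m n x : m <= n -> valge n x -> valge m x.
Proof.
rewrite /valge => le_mn /orP[->//|le_nx].
by rewrite (le_trans le_mn le_nx) orbT.
Qed.

Lemma integral_elt0 : integral_elt 0. Proof. exact: valge0. Qed.

Lemma integral_elt1 : integral_elt 1.
Proof. by rewrite /integral_elt /valge valn1 lexx orbT. Qed.

Lemma integral_eltM x y :
  integral_elt x -> integral_elt y -> integral_elt (x * y).
Proof.
rewrite /integral_elt; have [->|x0] := eqVneq x 0.
  by rewrite mul0r valge0.
have [->|y0] := eqVneq y 0; first by rewrite mulr0 valge0.
rewrite /valge mulf_eq0 (negPf x0) (negPf y0) /= valnM //.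
exact: addr_ge0.
Qed.

Lemma integral_elt_sum (I : finType) (f : I -> F) :
  (forall i, integral_elt (f i)) -> integral_elt (\sum_i f i).
Proof.
move=> Of; elim/big_ind: _ => //; [exact: valge0 | exact: valgeD].
Qed.

End Valuation.


Record GL2 (p : nat) (F : localField p) :=
  MkGL2 { GL2mx :> 'M[F]_2; GL2mx_unit : GL2mx \in unitmx }.

Section GL2.
Context {p : nat} {F : localField p}.
Local Notation G := (GL2 F).

HB.instance Definition _ := [isSub for @GL2mx p F].
HB.instance Definition _ := [Choice of G by <:].

Definition GL2_one : G := MkGL2 (unitmx1 F 2).

Lemma GL2_mul_subproof (g h : G) : g *m h \in unitmx.
Proof. by rewrite unitmx_mul (GL2mx_unit g) (GL2mx_unit h). Qed.
Definition GL2_mul (g h : G) : G := MkGL2 (GL2_mul_subproof g h).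

Lemma GL2_inv_subproof (g : G) : invmx g \in unitmx.
Proof. by rewrite unitmx_inv (GL2mx_unit g). Qed.
Definition GL2_inv (g : G) : G := MkGL2 (GL2_inv_subproof g).

Lemma GL2_mulA : associative GL2_mul.
Proof. by move=> g h l; apply: val_inj; rewrite /= mulmxA. Qed.
Lemma GL2_mul1 : left_id GL2_one GL2_mul.
Proof. by move=> g; apply: val_inj; rewrite /= mul1mx. Qed.
Lemma GL2_mulr1 : right_id GL2_one GL2_mul.
Proof. by move=> g; apply: val_inj; rewrite /= mulmx1. Qed.
Lemma GL2_mulV : left_inverse GL2_one GL2_inv GL2_mul.
Proof. by move=> g; apply: val_inj; rewrite /= mulVmx // (GL2mx_unit g). Qed.
Lemma GL2_mulrV : right_inverse GL2_one GL2_inv GL2_mul.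
Proof. by move=> g; apply: val_inj; rewrite /= mulmxV // (GL2mx_unit g). Qed.

HB.instance Definition _ := isGroup.Build G
  GL2_mulA GL2_mul1 GL2_mulr1 GL2_mulV GL2_mulrV.

(* The topology of GL_2(F) as a subspace of M_2(F) = F^4. *)
Definition GL2_open (U : set G) := forall g, U g -> exists n : int,
  forall h : G, (forall i j, valge n (h i j - g i j)) -> U h.

Lemma GL2_openT : GL2_open [set: G].
Proof. by move=> g _; exists 0. Qed.

Lemma GL2_openI (A B : set G) : GL2_open A -> GL2_open B -> GL2_open (A `&` B).
Proof.
move=> oA oB g [/oA[m Am] /oB[n Bn]]; exists (Num.max m n) => h gh; split.
  by apply: Am => i j; apply: valge_le (gh i j); rewrite le_max lexx.
by apply: Bn => i j; apply: valge_le (gh i j); rewrite le_max lexx orbT.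
Qed.

Lemma GL2_open_bigU (I : Type) (f : I -> set G) :
  (forall i, GL2_open (f i)) -> GL2_open (\bigcup_i f i).
Proof.
move=> of_ g [i _ /of_[n fn]]; exists n => h gh; exists i => //; exact: fn.
Qed.

HB.instance Definition _ := isOpenTopological.Build G
  GL2_openT GL2_openI GL2_open_bigU.

(* The matrix (a b; c d); only meaningful when ad - bc is nonzero (it is the
   identity otherwise). *)
Definition mx22 (a b c d : F) : G :=
  insubd (1%g : G)
    (\matrix_(i < 2, j < 2) nth 0 (nth [::] [:: [:: a; b]; [:: c; d]] i) j).

Definition integral_mx (m : 'M[F]_2) := forall i j, integral_elt (m i j).

(* K = GL_2(O), the matrices over O with an inverse over O. *)
Definition maxcompact : set G :=
  [set g : G | integral_mx g /\ integral_mx (g^-1)%g].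

Definition center : set G := [set z | forall g : G, (z * g = g * z)%g].

Definition KZ : set G := [set (h * z)%g | h in maxcompact & z in center].

Definition Pplus : set G :=
  [set g | exists a b, [/\ a != 0, integral_elt a, integral_elt b
                         & g = mx22 a b 0 1]].

Definition unipO : set G :=
  [set g | exists2 b, integral_elt b & g = mx22 1 b 0 1].

Definition is_subgroup (H : set G) :=
  [/\ H 1%g, forall g h, H g -> H h -> H (g * h)%g
    & forall g, H g -> H (g^-1)%g].

Definition KZcoset (g : G) : set G := [set (h * g)%g | h in KZ].

Lemma maxcompact_subgroup : is_subgroup maxcompact.
Proof.
have I1 : integral_mx 1%:M.
  by move=> i j; rewrite mxE; case: eqP => _;
     rewrite ?integral_elt1 ?integral_elt0.
have IM m n : integral_mx m -> integral_mx n -> integral_mx (m *m n).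
  move=> Im In i j; rewrite mxE; apply: integral_elt_sum => l.
  exact: integral_eltM.
split=> [|g h [Ig IgV] [Ih IhV]|g [Ig IgV]].
- by split; rewrite ?invg1.
- by split; rewrite ?invgM; apply: IM.
- by split; rewrite ?invgK.
Qed.

Lemma KZ_subgroup : is_subgroup KZ.
Proof.
have [K1 KM KV] := maxcompact_subgroup; split.
- exists 1%g => //; exists 1%g; rewrite ?mul1g //.
  by move=> g; rewrite mul1g mulg1.
- move=> _ _ [a Ka [z Zz <-]] [b Kb [w Zw <-]].
  exists (a * b)%g; first exact: KM.
  exists (z * w)%g; first by move=> g; rewrite -mulgA Zw !mulgA Zz.
  by rewrite -!mulgA; congr (_ * _)%g; rewrite !mulgA Zz.
- move=> _ [a Ka [z Zz <-]].
  exists (a^-1)%g; first exact: KV.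
  exists (z^-1)%g; last by rewrite -invgM Zz.
  by move=> g; apply: (@mulgI _ z); rewrite mulgA mulgV mul1g mulgA Zz mulgK.
Qed.

End GL2.

Section LinearAlgebra.
Context {k : fieldType} {V : lmodType k}.

Definition subspace (S : set V) :=
  S 0 /\ forall (a : k) x y, S x -> S y -> S (a *: x + y).

Definition lspan (A : set V) : set V :=
  [set x | exists n (c : 'I_n -> k) (a : 'I_n -> V),
     (forall i, A (a i)) /\ x = \sum_i c i *: a i].

(* For S a subspace. *)
Definition fin_dim (S : set V) := exists2 A : set V, finite_set A & S = lspan A.

End LinearAlgebra.

Structure rep (k : fieldType) (G : groupType) (V : lmodType k) := Rep {
  rep_act :> G -> V -> V;
  rep_linear : forall g, linear (rep_act g);
  rep1 : forall x, rep_act 1%g x = x;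
  repM : forall g h x, rep_act (g * h)%g x = rep_act g (rep_act h x)
}.

Section Rep.
Context {k : fieldType} {G : groupType} {V : lmodType k}.
Implicit Types (rho : rep G V) (H : set G) (S T A : set V).

Definition subrep rho H S :=
  subspace S /\ forall g x, H g -> S x -> S (rho g x).

Definition irreducible_subrep rho H S :=
  [/\ subrep rho H S, S <> [set 0] &
      forall T, subrep rho H T -> T `<=` S -> T = [set 0] \/ T = S].

Definition irreducible rho := irreducible_subrep rho [set: G] [set: V].

(* The span <H . A>; for H = G, the sub-k[G]-module generated by A. *)
Definition gen rho H A : set V := lspan [set rho g x | g in H & x in A].

Definition invariants rho H S : set V :=
  [set x | S x /\ forall g, H g -> rho g x = x].

Definition fin_gen rho S :=
  exists2 A, finite_set A & S = gen rho [set: G] A.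

(* Right translation: (g' f)(g) = f(g g'). *)
Definition rtrans_act (g' : G) (f : G -> V) : G -> V := fun g => f (g * g')%g.

Lemma rtrans_linear g : linear (rtrans_act g). Proof. by []. Qed.
Lemma rtrans1 f : rtrans_act 1%g f = f.
Proof. by apply/funext => x; rewrite /rtrans_act mulg1. Qed.
Lemma rtransM g h f : rtrans_act (g * h)%g f = rtrans_act g (rtrans_act h f).
Proof. by apply/funext => x; rewrite /rtrans_act mulgA. Qed.

Definition rtrans : rep G (G -> V) := Rep rtrans_linear rtrans1 rtransM.

End Rep.

Section RepGL2.
Context {p : nat} {F : localField p} {k : fieldType} {V : lmodType k}.
Local Notation G := (GL2 F).
Context (varpi : F) (pi : rep G V).

Definition smooth := forall x : V, exists H : set G,
  [/\ is_subgroup H, open H & forall g, H g -> pi g x = x].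

Definition admissible := smooth /\
  forall H : set G, is_subgroup H -> open H ->
    fin_dim (invariants pi H [set: V]).

Definition has_central_character := exists chi : G -> k,
  forall z x, center z -> pi z x = chi z *: x.

(* [sigma] is meant to be an irreducible KZ-subrepresentation of pi. *)
Definition Iplus (sigma : set V) : set V := gen pi Pplus sigma.
Definition Iminus (sigma : set V) : set V :=
  [set pi (mx22 0 1 varpi 0) x | x in Iplus sigma].
Definition D1 (sigma : set V) : set V := Iplus sigma `&` Iminus sigma.

(* c-Ind_{KZ}^G W for a KZ-stable subspace W of pi. *)
Definition cInd (W : set V) : set (G -> V) :=
  [set f : G -> V |
    [/\ forall g, W (f g),
        forall g, \forall h \near g, f h = f g,
        exists2 C : set G, compact C &
          forall g, f g != 0 -> exists2 c, C c & KZcoset c g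
      & forall h g, KZ h -> f (h * g)%g = pi h (f g)]].

(* [g, w]: supported on KZ g^-1, with value w at g^-1, hence (x g) w at x. *)
Definition bracket (g : G) (w : V) : G -> V :=
  fun x => if `[< KZ (x * g)%g >] then pi (x * g)%g w else 0.

(* The map c-Ind W -> pi sending [g, w] to g w (see [pres_map_bracket]): an f
   in c-Ind W is the sum of the [x^-1, f x] for x running through
   representatives of the (finitely many) cosets KZ x on which it is nonzero,
   and x^-1 f(x) does not depend on the representative. *)
Definition pres_map (f : G -> V) : V :=
  \sum_(C \in range KZcoset) (let x := xget 1%g C in pi (x^-1)%g (f x)).

Definition presentations : set (set V) :=
  [set W | [/\ subrep pi KZ W, fin_dim W & gen pi [set: G] W = [set: V]]].

Definition relations (W : set V) : set (G -> V) :=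
  [set f | cInd W f /\ pres_map f = 0].

Definition admits_finite_presentation :=
  exists2 W, presentations W & fin_gen rtrans (relations W).

Definition standard_relations (W : set V) : set (G -> V) :=
  [set bracket (mx22 varpi 0 0 1) x
       - bracket 1%g (pi (mx22 varpi 0 0 1) x)
  | x in W `&` [set pi (mx22 varpi^-1 0 0 1) y | y in W]].

Definition admits_standard_presentation :=
  exists2 W, presentations W &
    relations W = gen rtrans [set: G] (standard_relations W).

Lemma pres_map_bracket g w : pres_map (bracket g w) = pi g w.
Proof.
have [KZ1 KZM KZV] := @KZ_subgroup p F.
have piV0 h : pi h 0 = 0.
  have := rep_linear pi h (- 1) 0 0.
  by rewrite scaleN1r oppr0 addr0 scaleN1r addNr.
have KZxget (y : G) : KZcoset y (xget 1%g (KZcoset y)).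
  apply: (@xgetPex _ 1%g (KZcoset y)); exists y.
  by exists 1%g; [exact: KZ1 | rewrite mul1g].
rewrite /pres_map -(@fsbig_widen _ _ _ _ [set KZcoset (g^-1 : G)%g]).
- rewrite fsbig_set1 /bracket.
  have [h KZh <-] := KZxget (g^-1)%g.
  rewrite mulgVK asboolT //.
  by rewrite -repM invgM invgK -mulgA mulVg mulg1.
- by move=> _ ->; exists (g^-1)%g.
- move=> _ [[y _ <-] neq]; rewrite /bracket /=.
  have [h KZh yE] := KZxget y.
  rewrite asboolF ?piV0 // => KZyg; apply: neq.
  rewrite -yE in KZyg.
  have KZ' : KZ (y * g)%g.
    by have := KZM _ _ (KZV _ KZh) KZyg; rewrite -mulgA mulKg.
  apply/seteqP; split=> _ [l KZl <-].
    by exists (l * (y * g))%g; [exact: KZM | rewrite -mulgA mulgK].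
  exists (l * (y * g)^-1)%g; first by apply: KZM => //; exact: KZV.
  by rewrite invgM -!mulgA mulVg mulg1.
Qed.

End RepGL2.

(* Main.v *)
Require Import Defs.
From HB Require Import structures.
From mathcomp Require Import all_boot all_order all_algebra.
From mathcomp Require Import fingroup perm action cyclic pgroup sylow.
From mathcomp Require Import all_classical.
From mathcomp Require Import topology_structure compact.
From mathcomp Require Import zify ring.

Set Implicit Arguments.
Unset Strict Implicit.
Unset Printing Implicit Defensive.

Import Order.TTheory GRing.Theory Num.Theory.
Local Open Scope classical_set_scope.
Local Open Scope ring_scope.

(**
   The cosets g KZ are the vertices of the tree of PGL_2(F); a KZ-stable
   subspace W of pi attaches the subspace gW to each of them. The edge between
   the origin KZ and Pi KZ cuts the tree into two half-trees; the sums of the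
   gW over them are I^+ = <P^+ W> and I^- = Pi I^+, their sum is the space
   <G W>, and their intersection is D_1.

   Call W edge-closed if D_1(W) is contained in W. If D_1(sigma) is
   finite-dimensional, it lies in the sum W of the g sigma over a large ball,
   and this W is edge-closed ([ball_edge_closed]). For an edge-closed W the
   relations are the standard ones ([edge_closed_standard]): in a sum of
   vectors of the gW that vanishes in pi, the contribution of an extremal
   vertex lies in both half-trees of an edge, hence can be moved across that
   edge by a standard relation, until nothing is left. A standard presentation
   is finite, as W is finite-dimensional. Conversely, if finitely many
   relations generate all of them, an element of D_1(sigma), written in two
   ways, as a sum over each half-tree, gives a relation that splits along the
   edge up to a bounded error, so that the element comes from a bounded part of
   the tree ([fin_pres_fin_dim_D1]).

   Let now W be finite-dimensional and edge-closed, J = <P^+ W>, and N_0 the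
   group of upper unipotents over O. The heart of the rest is that
   J^{N_0} is contained in W ([Nfixed_halfspan_sub]). The filtration of J by
   the distance to the origin is such that the components along distinct
   branches are independent up to W ([layer_components]); hence the Hecke
   operator [hecke], the sum of the translates to the q children of the origin,
   increases the depth by exactly one. If some vector of J^{N_0} is not in W,
   its iterates span an infinite-dimensional space on which the torus over O
   acts through a finite quotient, and from an eigenvector outside W one gets
   an eigenvector a of the Iwahori subgroup in J, not in W ([exists_Ieig]). Put
   b = [hecke a]. An element of <K b> is determined by its components along the
   q branches of J at the origin: these are values of combinations of
   translates of a character of the residue field, and determine the component
   along the last branch by an identity on Jacobi sums
   ([character_combination], [genKZ_zero]). Every nonzero element of <G b>
   thus has a nonzero component at least as far away as b does, and a is not in
   <G b> ([hecke_not_gen]), against the irreducibility of pi.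

   Since sigma is contained in W, the N_0-invariants of I^+(sigma) lie in W,
   which is (v). For (iv), the component on J of a vector fixed by a congruence
   subgroup is fixed by it up to a cocycle with values in D_1(W). This cocycle
   is trivial on commutators deep enough in the group, so the component is
   fixed by unipotents of bounded level ([halves_invariants]); such vectors
   form a finite-dimensional space, as a p-group acting in characteristic p with
   finite-dimensional invariants acts on a finite-dimensional space
   ([halfspan_fixed_fin_dim]).
*)

(** * Subspaces of finite dimension *)

Section LinearMaps.
Context {k : fieldType} {V U : lmodType k} (f : V -> U) (f_lin : linear f).

Lemma lin0 : f 0 = 0.
Proof. by have := f_lin (-1) 0 0; rewrite !scaleN1r oppr0 addr0 addNr. Qed.

Lemma linZ a x : f (a *: x) = a *: f x.
Proof. by have := f_lin a x 0; rewrite lin0 !addr0. Qed.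

Lemma linD x y : f (x + y) = f x + f y.
Proof. by have := f_lin 1 x y; rewrite !scale1r. Qed.

Lemma linN x : f (- x) = - f x.
Proof. by rewrite -scaleN1r linZ scaleN1r. Qed.

Lemma linB x y : f (x - y) = f x - f y.
Proof. by rewrite linD linN. Qed.

Lemma lin_sum (I : Type) (r : seq I) (P : pred I) (x : I -> V) :
  f (\sum_(i <- r | P i) x i) = \sum_(i <- r | P i) f (x i).
Proof.
by elim/big_rec2: _ => [|i y z _ <-]; [exact: lin0 | rewrite linD].
Qed.

End LinearMaps.

Section Subspaces.
Context {k : fieldType} {V : lmodType k}.
Implicit Types (S T A B : set V) (s : seq V).

Lemma sub0 S : subspace S -> S 0. Proof. by case. Qed.

Lemma subD S x y : subspace S -> S x -> S y -> S (x + y).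
Proof. by move=> [_ SD] Sx Sy; rewrite -[x]scale1r; apply: SD. Qed.

Lemma subZ S a x : subspace S -> S x -> S (a *: x).
Proof. by move=> [S0 SD] Sx; rewrite -[_ *: _]addr0; apply: SD. Qed.

Lemma subN S x : subspace S -> S x -> S (- x).
Proof. by move=> Ss Sx; rewrite -scaleN1r; apply: subZ. Qed.

Lemma subB S x y : subspace S -> S x -> S y -> S (x - y).
Proof. by move=> Ss Sx Sy; apply: subD => //; apply: subN. Qed.

Lemma sub_addl S x y : subspace S -> S x -> S (x + y) -> S y.
Proof. by move=> Ss Sx /(subB Ss)/(_ Sx); rewrite addrC addKr. Qed.

Lemma sub_addr S x y : subspace S -> S y -> S (x + y) -> S x.
Proof. by rewrite addrC; apply: sub_addl. Qed.

Lemma sub_sum S (I : Type) (r : seq I) (P : pred I) (x : I -> V) :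
  subspace S -> (forall i, P i -> S (x i)) -> S (\sum_(i <- r | P i) x i).
Proof.
by move=> Ss Sx; elim/big_ind: _ => // [|y z]; [exact: sub0 | exact: subD].
Qed.

Lemma subspaceT : subspace [set: V]. Proof. by []. Qed.

Lemma subspace0 : subspace [set 0 : V].
Proof. by split=> // a x y -> ->; rewrite scaler0 addr0. Qed.

Lemma subspaceI S T : subspace S -> subspace T -> subspace (S `&` T).
Proof. by move=> [? SD] [? TD]; split=> // a x y [? ?] [? ?]; split; auto. Qed.

Lemma lspan_subspace A : subspace (lspan A).
Proof.
split; first by exists 0%N, (fun=> 0), (fun=> 0); split=> [[]//|]; rewrite big_ord0.
move=> b _ _ [n [c [x [Ax ->]]]] [m [d [y [Ay ->]]]].
exists (n + m)%N.
exists (fun i => match fintype.split i with inl j => b * c j | inr j => d j end).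
exists (fun i => match fintype.split i with inl j => x j | inr j => y j end).
split=> [i|]; first by case: (fintype.split i).
rewrite big_split_ord /= scaler_sumr; congr (_ + _).
  by apply: eq_bigr => i _; rewrite scalerA (unsplitK (inl i)).
by apply: eq_bigr => i _; rewrite (unsplitK (inr i)).
Qed.

Lemma lspan_inc A : A `<=` lspan A.
Proof.
by move=> x Ax; exists 1%N, (fun=> 1), (fun=> x); rewrite big_ord1 scale1r.
Qed.

Lemma lspan_min A S : subspace S -> A `<=` S -> lspan A `<=` S.
Proof.
by move=> Ss AS _ [n [c [x [Ax ->]]]]; apply: sub_sum => // i _; apply: subZ; auto.
Qed.

Definition addS A B : set V := [set x + y | x in A & y in B].

Lemma addS_subspace A B : subspace A -> subspace B -> subspace (addS A B).
Proof.
move=> As Bs; split.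
  by exists 0; [exact: sub0 | exists 0; [exact: sub0 | rewrite addr0]].
move=> a _ _ [x Ax [y By <-]] [x' Ax' [y' By' <-]].
exists (a *: x + x'); first by apply: As.2.
exists (a *: y + y'); first by apply: Bs.2.
by rewrite scalerDr addrACA.
Qed.

Lemma addSl A B : subspace B -> A `<=` addS A B.
Proof. by move=> Bs x Ax; exists x => //; exists 0; rewrite ?addr0 //; apply: sub0. Qed.

Lemma addSr A B : subspace A -> B `<=` addS A B.
Proof. by move=> As x Bx; exists 0; [exact: sub0 | exists x; rewrite ?add0r]. Qed.

Lemma addS_min A B S :
  subspace S -> A `<=` S -> B `<=` S -> addS A B `<=` S.
Proof. by move=> Ss AS BS _ [x /AS Sx [y /BS Sy <-]]; apply: subD. Qed.

(** The recursion on the generators is the one followed by the exchange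
    argument. *)
Fixpoint sp s : set V :=
  if s is x :: s' then [set y | exists c, exists2 z, sp s' z & y = c *: x + z]
  else [set 0].

Lemma sp_subspace s : subspace (sp s).
Proof.
elim: s => [|x s IH] /=; first exact: subspace0.
split; first by exists 0, 0; rewrite ?scale0r ?addr0 //; apply: sub0.
move=> a _ _ [c [y sy ->]] [d [z sz ->]].
exists (a * c + d), (a *: y + z); first exact: IH.2.
by rewrite scalerDr scalerDl scalerA addrACA.
Qed.

Lemma sp_mem s x : x \in s -> sp s x.
Proof.
elim: s => // y s IH /=; rewrite inE => /orP[/eqP->|/IH sx].
  by exists 1, 0; rewrite ?scale1r ?addr0 //; apply: sub0 (sp_subspace _).
by exists 0, x; rewrite ?scale0r ?add0r.
Qed.

Lemma sp_min s S : subspace S -> (forall x, x \in s -> S x) -> sp s `<=` S.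
Proof.
move=> Ss; elim: s => [|y s IH] sS /=; first by move=> _ ->; apply: sub0.
move=> _ [c [z /IH Sz ->]]; apply: subD => //.
  by apply: subZ => //; apply: sS; rewrite mem_head.
by apply: Sz => x xs; apply: sS; rewrite inE xs orbT.
Qed.

Lemma spE s : sp s = lspan [set` s].
Proof.
apply/seteqP; split.
  by apply: sp_min (lspan_subspace _) _ => x xs; apply: lspan_inc.
by apply: lspan_min (sp_subspace _) _ => x; apply: sp_mem.
Qed.

Lemma fin_dimP S : fin_dim S <-> exists s, S = sp s.
Proof.
split=> [[A /finite_seqP[s ->] ->]|[s ->]]; first by exists s; rewrite spE.
by exists [set` s]; [exact: finite_seq | rewrite spE].
Qed.

Lemma fin_dim_sp s : fin_dim (sp s). Proof. by apply/fin_dimP; exists s. Qed.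

(** Exchange argument: a vector with nonzero coefficient on the first
    generator can replace it, and then serves to eliminate that generator from
    the other vectors. *)
Lemma sub_sp s S : subspace S -> S `<=` sp s ->
  exists s', [/\ S = sp s', (size s' <= size s)%N &
    size s' = size s -> S = sp s].
Proof.
elim: s S => [|x s IH] S Ss sS /=.
  exists [::]; suff -> : S = [set 0] by [].
  by apply/seteqP; split=> // _ ->; apply: sub0.
have [s' [SE ss' full]] := IH _ (subspaceI Ss (sp_subspace s)) (@subIsetr _ _ _).
have [Ssub|/existsNP[z /not_implyP[Sz nz]]] := pselect (S `<=` sp s).
  exists s'; split; last by move=> e; move: ss'; rewrite e ltnn.
    by rewrite -SE; apply/esym/setIidPl.
  exact: leqW.
have [c [t st zE]] := sS _ Sz.
have c0 : c != 0.
  by apply/eqP => c0; apply: nz; rewrite zE c0 scale0r add0r.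
exists (z :: s'); split=> [||[e]] //=.
  apply/seteqP; split=> [y Sy|_ [d [y s'y ->]]]; last first.
    by apply: Ss.2 => //; move: s'y; rewrite -SE => -[].
  have [d [u su yE]] := sS _ Sy.
  exists (d / c), (y - (d / c) *: z); last by rewrite addrC subrK.
  rewrite -SE; split; first by apply: subB => //; apply: subZ.
  rewrite yE zE scalerDr scalerA divfK // opprD addrACA subrr add0r.
  apply: subB => //; first exact: sp_subspace.
  by apply: subZ => //; apply: sp_subspace.
have sSub : sp s `<=` S by rewrite -(full e) => y [].
apply/seteqP; split=> [//|_ [d [y sy ->]]]; apply: subD => //; last exact: sSub.
apply: subZ => //; rewrite -[x]scale1r -(mulVf c0) -scalerA; apply: subZ => //.
have -> : c *: x = z - t by rewrite zE addrK.
by apply: subB => //; apply: sSub.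
Qed.

Lemma fin_dim_sub S T : subspace S -> S `<=` T -> fin_dim T -> fin_dim S.
Proof.
move=> Ss ST /fin_dimP[s TE]; rewrite {}TE in ST.
by have [s' [-> _ _]] := sub_sp Ss ST; apply: fin_dim_sp.
Qed.

Lemma fin_dim_subspace S : fin_dim S -> subspace S.
Proof. by move=> /fin_dimP[s ->]; apply: sp_subspace. Qed.

Lemma fin_dim0 : fin_dim [set 0 : V]. Proof. exact: (fin_dim_sp [::]). Qed.

Lemma fin_dimD A B : fin_dim A -> fin_dim B -> fin_dim (addS A B).
Proof.
move=> /fin_dimP[s ->] /fin_dimP[t ->].
apply: (@fin_dim_sub _ (sp (s ++ t))); last exact: fin_dim_sp.
  by apply: addS_subspace; apply: sp_subspace.
apply: addS_min; first exact: sp_subspace.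
  by apply: sp_min (sp_subspace _) _ => x xs; apply: sp_mem; rewrite mem_cat xs.
by apply: sp_min (sp_subspace _) _ => x xs; apply: sp_mem; rewrite mem_cat xs orbT.
Qed.

(** Each of the finitely many generators lies in some term of the increasing
    union. *)
Lemma directed_sub S (D : nat -> set V) :
  (forall n, subspace (D n)) -> (forall n, D n `<=` D n.+1) ->
  fin_dim S -> S `<=` \bigcup_n D n -> exists n, S `<=` D n.
Proof.
move=> Ds Dinc /fin_dimP[s ->].
have Dle m n : (m <= n)%N -> D m `<=` D n.
  by move/subnK <-; elim: (n - m)%N => // j IH; apply: subset_trans IH (Dinc _).
move=> sD; suff [n Dn] : exists n, forall x, x \in s -> D n x.
  by exists n; apply: sp_min.
have {}sD x : x \in s -> exists n, D n x by move=> /sp_mem/sD[n _]; exists n.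
elim: s sD => [|y s IH] sD; first by exists 0%N.
have [|n Dn] := IH; first by move=> x xs; apply: sD; rewrite inE xs orbT.
have [m Dm] := sD y (mem_head _ _).
exists (maxn m n) => x; rewrite inE => /orP[/eqP->|/Dn].
  exact: Dle (leq_maxl _ _) _ Dm.
exact: Dle (leq_maxr _ _) _.
Qed.

End Subspaces.

Section FinDimMaps.
Context {k : fieldType} {V U : lmodType k} (f : V -> U) (f_lin : linear f).

Lemma im_subspace S : subspace S -> subspace (f @` S).
Proof.
move=> Ss; split; first by exists 0; [exact: sub0 | exact: lin0].
move=> a _ _ [x Sx <-] [y Sy <-]; exists (a *: x + y); first exact: Ss.2.
exact: f_lin.
Qed.

Lemma preim_subspace (T : set U) : subspace T -> subspace (f @^-1` T).
Proof.
move=> Ts; split=> /=; first by rewrite lin0 //; apply: sub0.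
by move=> a x y Tx Ty; rewrite f_lin; apply: Ts.2.
Qed.

Lemma im_lspan A : f @` lspan A = lspan (f @` A).
Proof.
apply/seteqP; split.
  move=> _ [x Ax <-]; suff : lspan A `<=` f @^-1` lspan (f @` A) by apply.
  apply: lspan_min; first exact: (preim_subspace (@lspan_subspace _ _ _)).
  by move=> y Ay; apply: lspan_inc; exists y.
apply: lspan_min; first exact: (im_subspace (@lspan_subspace _ _ _)).
by move=> _ [x Ax <-]; exists x => //; apply: lspan_inc.
Qed.

Lemma fin_dim_im S : fin_dim S -> fin_dim (f @` S).
Proof.
move=> [A finA ->]; exists (f @` A); first exact: finite_image.
exact: im_lspan.
Qed.

(** Preimages of generators of the image generate, together with the kernel.
    *)
Lemma fin_dim_fiber S : subspace S ->
  fin_dim (f @` S) -> fin_dim (S `&` [set x | f x = 0]) -> fin_dim S.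
Proof.
move=> Ss /fin_dimP[s imE] kerfd.
have [t tS tE] : exists2 t : seq V, (forall x, x \in t -> S x) & s = map f t.
  have : forall y, y \in s -> (f @` S) y by rewrite imE; exact: sp_mem.
  elim: s {imE} => [|y s IH] sS; first by exists [::].
  have [x xs|t tS ->] := IH; first by apply: sS; rewrite inE xs orbT.
  have [x Sx <-] := sS y (mem_head _ _); exists (x :: t) => // z.
  by rewrite inE => /orP[/eqP->|/tS].
apply: (@fin_dim_sub _ _ _ (addS (sp t) (S `&` [set x | f x = 0]))) => //; last first.
  exact: fin_dimD (fin_dim_sp _) kerfd.
move=> x Sx.
have : sp (map f t) `<=` f @` sp t.
  apply: sp_min; first exact: (im_subspace (@sp_subspace _ _ _)).
  by move=> _ /mapP[y yt ->]; exists y => //; apply: sp_mem.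
rewrite -tE -imE => /(_ (f x))[|y ty fyx]; first by exists x.
exists y => //; exists (x - y); last by rewrite addrC subrK.
split; last by rewrite /= (linB f_lin) fyx subrr.
by apply: subB => //; move: y ty {fyx}; apply: sp_min.
Qed.

End FinDimMaps.

(** * Operators of finite order *)

Section KernelLemma.
Context {k : fieldType} {V : lmodType k} (f : V -> V) (f_lin : linear f).

Let g c x := f x - c *: x.

Local Lemma g_lin c : linear (g c).
Proof.
move=> a x y; rewrite /g f_lin !scalerDr opprD addrACA scalerN; congr (_ - _ + _).
by rewrite !scalerA mulrC.
Qed.

Local Lemma ker_g c : [set x | g c x = 0] = [set x | f x = c *: x].
Proof.
apply/seteqP; split=> x /=; rewrite /g; last by move=> ->; rewrite subrr.
by move/eqP; rewrite subr_eq0 => /eqP.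
Qed.

Local Lemma fin_dim_foldl (cs : seq k) (Z : set V) :
  subspace Z -> (forall x, Z x -> Z (f x)) ->
  (forall x, Z x -> foldl (fun y c => g c y) x cs = 0) ->
  (forall c, c \in cs -> fin_dim (Z `&` [set x | f x = c *: x])) -> fin_dim Z.
Proof.
elim: cs Z => [|c cs IH] Z Zs Zf Z0 Zker /=.
  suff -> : Z = [set 0] by exact: fin_dim0.
  by apply/seteqP; split=> // _ ->; apply: sub0.
have gZ x : Z x -> Z (g c x) by move=> Zx; apply: subB; [| exact: Zf | exact: subZ].
have gZZ : g c @` Z `<=` Z by move=> _ [x /gZ ? <-].
apply: (fin_dim_fiber (@g_lin c) Zs).
  apply: IH; first exact: (im_subspace (@g_lin c) Zs).
  - move=> _ [x Zx <-]; exists (f x); first exact: Zf.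
    by rewrite /g (linB f_lin) (linZ f_lin).
  - by move=> _ [x /Z0 /= ? <-].
  - move=> d dcs; apply: (@fin_dim_sub _ _ _ (Z `&` [set x | f x = d *: x])).
    + apply: subspaceI; first exact: (im_subspace (@g_lin c) Zs).
      by rewrite -ker_g; apply: (preim_subspace (@g_lin d) (@subspace0 _ _)).
    + by move=> x [/gZZ Zx fx]; split.
    + by apply: Zker; rewrite inE dcs orbT.
by rewrite ker_g; apply: Zker; rewrite mem_head.
Qed.

Let ev (q : {poly k}) x := \sum_(i < size q) q`_i *: iter i f x.

Local Lemma evE n (q : {poly k}) x :
  (size q <= n)%N -> ev q x = \sum_(i < n) q`_i *: iter i f x.
Proof.
move=> /subnKC <-; rewrite big_split_ord /= [X in _ = _ + X]big1 ?addr0 // => i _.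
by rewrite nth_default ?scale0r // leq_addr.
Qed.

Local Lemma ev_factor (q : {poly k}) c x : ev (q * ('X - c%:P)) x = ev q (g c x).
Proof.
have [->|q0] := eqVneq q 0; first by rewrite mul0r /ev size_poly0 !big_ord0.
rewrite (@evE (size q).+1); last by rewrite size_Mmonic ?monicXsubC // size_XsubC addn2.
have fi_lin i : linear (iter i f).
  by elim: i => [|i IH] a u v //=; rewrite IH f_lin.
transitivity (\sum_(i < (size q).+1) (q * 'X)`_i *: iter i f x
             - \sum_(i < (size q).+1) (c * q`_i) *: iter i f x).
  rewrite -sumrB; apply: eq_bigr => i _.
  by rewrite mulrBr coefB coefMC scalerBl [c * _]mulrC.
rewrite big_ord_recl coefMX eqxx scale0r add0r big_ord_recr /=.
rewrite [q`_(size q)]nth_default // mulr0 scale0r addr0 -sumrB.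
apply: eq_bigr => i _; rewrite coefMX /= /g (linB (fi_lin i)) (linZ (fi_lin i)).
by rewrite -iterSr /= scalerBr scalerA [c * _]mulrC.
Qed.

Local Lemma ev_prod (cs : seq k) x :
  foldl (fun y c => g c y) x cs = ev (\prod_(c <- rev cs) ('X - c%:P)) x.
Proof.
elim: cs x => [|c cs IH] x /=.
  by rewrite big_nil /ev size_poly1 big_ord1 coef1 /= scale1r.
by rewrite IH rev_cons -cats1 big_cat big_seq1 /= ev_factor.
Qed.

(** The operator is killed by the product of the X - c over the roots c of X^N
    - 1. Applying the factors one after the other loses only finitely many
    dimensions each time, and leaves 0. *)
Lemma fin_dim_eigen (N : nat) (cs : seq k) (Z : set V) :
  (0 < N)%N -> 'X^N - 1 = \prod_(c <- cs) ('X - c%:P) ->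
  subspace Z -> (forall x, Z x -> Z (f x)) ->
  (forall x, Z x -> iter N f x = x) ->
  (forall c, c \in cs -> fin_dim (Z `&` [set x | f x = c *: x])) -> fin_dim Z.
Proof.
move=> N0 csE Zs Zf Zid Zker.
apply: (@fin_dim_foldl (rev cs)) => // [x Zx|c]; last by rewrite mem_rev; auto.
rewrite ev_prod revK -csE (@evE N.+1); last by rewrite size_XnsubC.
have coefE i : ('X^N - 1 : {poly k})`_i = (i == N)%:R - (i == 0%N)%:R.
  by rewrite coefB coefXn coef1.
rewrite big_ord_recr; case: N N0 csE Zid coefE => // N _ _ Zid coefE.
rewrite big_ord_recl /= !coefE /= !eqxx big1 => [|i _].
  by rewrite sub0r subr0 addr0 scaleN1r scale1r -iterS Zid ?addNr.
by rewrite coefE /bump /= add1n eqSS (ltn_eqF (ltn_ord i)) subrr scale0r.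
Qed.

End KernelLemma.

(** * Valuations *)

Section ValuationTheory.
Context {p : nat} {F : localField p}.
Implicit Types x y z : F.
Local Notation O := (@integral_elt p F).

Definition vunit x := (x != 0) && (valn x == 0).

Lemma valgeE n x : x != 0 -> valge n x = (n <= valn x).
Proof. by rewrite /valge => /negPf ->. Qed.

Lemma valnN1 : valn (-1 : F) = 0.
Proof.
have := @valnM _ F (-1) (-1); rewrite oppr_eq0 oner_neq0 mulrNN mulr1 valn1.
by move=> /(_ isT isT); lia.
Qed.

Lemma valnV x : x != 0 -> valn x^-1 = - valn x.
Proof.
move=> x0; have := @valnM _ F x x^-1 x0; rewrite invr_eq0 divff // valn1.
by move=> /(_ x0); lia.
Qed.

Lemma valnN x : valn (- x) = valn x.
Proof.
have [->|x0] := eqVneq x 0; first by rewrite oppr0.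
by rewrite -mulN1r (valnM (x := -1)) ?oppr_eq0 ?oner_neq0 // valnN1 add0r.
Qed.

Lemma valgeN n x : valge n (- x) = valge n x.
Proof. by rewrite /valge oppr_eq0 valnN. Qed.

Lemma valgeB n x y : valge n x -> valge n y -> valge n (x - y).
Proof. by move=> nx ny; apply: valgeD => //; rewrite valgeN. Qed.

Lemma valgeM m n x y : valge m x -> valge n y -> valge (m + n) (x * y).
Proof.
have [->|x0] := eqVneq x 0; first by rewrite mul0r !valge0.
have [->|y0] := eqVneq y 0; first by rewrite mulr0 !valge0.
by rewrite !valgeE ?mulf_neq0 // valnM //; lia.
Qed.

Lemma valgeMl n x y : O x -> valge n y -> valge n (x * y).
Proof. by move=> /valgeM + /[dup] => /[apply]; rewrite add0r. Qed.

Lemma valgeMr n x y : valge n x -> O y -> valge n (x * y).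
Proof. by move=> nx Oy; rewrite mulrC; apply: valgeMl. Qed.

Lemma valge_sym n x y : valge n (x - y) -> valge n (y - x).
Proof. by rewrite -valgeN opprB. Qed.

Lemma valge_trans n y x z :
  valge n (x - y) -> valge n (y - z) -> valge n (x - z).
Proof. by move=> xy yz; rewrite -(subrK y x) -addrA; apply: valgeD. Qed.

Lemma integralD x y : O x -> O y -> O (x + y). Proof. exact: valgeD. Qed.
Lemma integralB x y : O x -> O y -> O (x - y). Proof. exact: valgeB. Qed.
Lemma integralN x : O (- x) = O x. Proof. exact: valgeN. Qed.

Lemma valge_int n x : 0 <= n -> valge n x -> O x.
Proof. exact: valge_le. Qed.

Lemma valge1_int x : valge 1 x -> O x. Proof. exact: valge_int. Qed.

Lemma vunit_neq0 x : vunit x -> x != 0. Proof. by case/andP. Qed.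

Lemma vunit_int x : vunit x -> O x.
Proof. by case/andP=> x0 /eqP xv; rewrite /O valgeE // xv. Qed.

Lemma vunitV x : vunit x -> vunit x^-1.
Proof. by case/andP=> x0 /eqP xv; rewrite /vunit invr_eq0 x0 valnV // xv. Qed.

Lemma vunitN x : vunit (- x) = vunit x.
Proof. by rewrite /vunit oppr_eq0 valnN. Qed.

Lemma vunitM x y : vunit x -> vunit y -> vunit (x * y).
Proof.
case/andP=> x0 /eqP xv /andP[y0 /eqP yv].
by rewrite /vunit mulf_neq0 // valnM // xv yv.
Qed.

Lemma vunit1 : vunit (1 : F).
Proof. by rewrite /vunit oner_neq0 valn1. Qed.

Lemma vunitE x : vunit x = O x && ~~ valge 1 x.
Proof.
rewrite /vunit /O /valge; have [->|x0] //= := eqVneq x 0.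
by apply/eqP/andP; lia.
Qed.

Lemma vunitP x : O x -> vunit x || valge 1 x.
Proof. by move=> Ox; rewrite vunitE Ox; case: valge. Qed.

Lemma vunit_dvd x y : O x -> O y -> vunit (x * y) -> vunit x.
Proof.
move=> Ox Oy; rewrite /vunit mulf_eq0 negb_or => /andP[/andP[x0 y0]].
by rewrite x0 valnM //; move: Ox Oy; rewrite /O !valgeE //; lia.
Qed.

Lemma vunit_cong x y : vunit x -> valge 1 (y - x) -> vunit y.
Proof.
rewrite !vunitE => /andP[Ox x1] yx; apply/andP; split.
  by rewrite -(subrK x y); apply: integralD => //; apply: valge1_int.
apply: contra x1 => y1; rewrite -[x](subKr y).
exact: valgeB.
Qed.

Lemma vunit1D x : valge 1 x -> vunit (1 + x).
Proof. by move=> x1; apply: (vunit_cong vunit1); rewrite addrC addKr. Qed.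

Lemma integral_total x y : y != 0 -> O (x / y) \/ (x != 0 /\ valge 1 (y / x)).
Proof.
move=> y0; have [->|x0] := eqVneq x 0; first by left; rewrite mul0r integral_elt0.
case: (boolP (O (x / y))) => [|h]; [by left | right; split=> //].
move: h; rewrite /O !valgeE ?mulf_neq0 ?invr_eq0 // !valnM ?invr_eq0 // !valnV //.
by lia.
Qed.

Lemma valgeVM n x y : vunit x -> valge n (x * y) -> valge n y.
Proof.
by move=> ux xy; rewrite -[y](mulKf (vunit_neq0 ux)); apply: valgeMl => //;
   apply/vunit_int/vunitV.
Qed.

Lemma vunit_inv_cong x y : vunit x -> vunit y -> valge 1 (x - y) ->
  valge 1 (x^-1 - y^-1).
Proof.
move=> ux uy xy; have x0 := vunit_neq0 ux; have y0 := vunit_neq0 uy.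
have -> : x^-1 - y^-1 = (- (x^-1 * y^-1)) * (x - y) by field; rewrite x0 y0.
apply: valgeMl => //; rewrite integralN.
by apply: integral_eltM; apply/vunit_int/vunitV.
Qed.

(** * Residue classes *)

Let s : seq F := sval (cid (residue_finite F)).
Let rep x := nth 0 s (find (fun y => valge 1 (x - y)) s).

Local Lemma repP x : O x -> rep x \in s /\ valge 1 (x - rep x).
Proof.
move=> Ox; have [y ys yx] := svalP (cid (residue_finite F)) x Ox.
have hs : has (fun y => valge 1 (x - y)) s by apply/hasP; exists y.
by split; [rewrite mem_nth // -has_find | apply: (nth_find 0 hs)].
Qed.

Local Lemma rep_cong x y : valge 1 (x - y) -> rep x = rep y.
Proof.
move=> xy; rewrite /rep; congr nth; apply: eq_find => z.
by apply/idP/idP; apply: valge_trans => //; apply: valge_sym.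
Qed.

Let rseq : seq F := [seq rep y | y <- s & O y].

Local Lemma rep_rseq x : O x -> rep x \in rseq.
Proof.
move=> Ox; have [rs rx] := repP Ox.
apply/mapP; exists (rep x); last exact: rep_cong.
rewrite mem_filter rs andbT -(subKr x (rep x)).
by apply: integralB => //; apply: valge1_int.
Qed.

(** Each residue class contains exactly one of these elements: the
    representative of x is the first element of a fixed finite sequence that
    is congruent to x. *)
Definition residue : finType := seq_sub rseq.

Definition res_elt (i : residue) : F := ssval i.

Definition res_class (x : F) : residue :=
  insubd (SeqSub (rep_rseq integral_elt0)) (rep x).

Lemma res_int i : O (res_elt i).
Proof.
have /mapP[y] : res_elt i \in rseq := ssvalP i.
rewrite mem_filter => /andP[Oy _] ->; have [_ ry] := repP Oy; rewrite -(subKr y (rep y)).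
by apply: integralB => //; apply: valge1_int.
Qed.

Lemma res_classP x : O x -> valge 1 (x - res_elt (res_class x)).
Proof.
move=> Ox; have := insubdK (SeqSub (rep_rseq integral_elt0)) (rep_rseq Ox).
rewrite -/(res_class x) /res_elt => /= ->; exact: (repP Ox).2.
Qed.

Lemma res_inj i j : valge 1 (res_elt i - res_elt j) -> i = j.
Proof.
have E l : rep (res_elt l) = res_elt l.
  have /mapP[y] : res_elt l \in rseq := ssvalP l.
  rewrite mem_filter => /andP[Oy _] ->; by have [_ /valge_sym] := repP Oy; apply: rep_cong.
by move=> /rep_cong; rewrite !E => /val_inj.
Qed.

Definition res_invariant (T : Type) (f : F -> T) :=
  forall x y, O x -> O y -> valge 1 (x - y) -> f x = f y.

(** Sums over the residue field are sums over the representatives of functions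
    that depend only on the class; a change of variables need only be
    invertible modulo the maximal ideal. *)
Lemma res_sum_reindex (U : nmodType) (f : F -> U) (phi psi : F -> F) :
  res_invariant f ->
  (forall x, O x -> O (phi x)) -> (forall x, O x -> O (psi x)) ->
  (forall x y, O x -> O y -> valge 1 (x - y) -> valge 1 (phi x - phi y)) ->
  (forall x y, O x -> O y -> valge 1 (x - y) -> valge 1 (psi x - psi y)) ->
  (forall x, O x -> valge 1 (phi (psi x) - x)) ->
  (forall x, O x -> valge 1 (psi (phi x) - x)) ->
  \sum_i f (res_elt i) = \sum_i f (phi (res_elt i)).
Proof.
move=> f_inv phiO psiO phi_inv psi_inv phiK psiK.
have half (g h : F -> F) : (forall x, O x -> O (g x)) -> (forall x, O x -> O (h x)) ->
  (forall x y, O x -> O y -> valge 1 (x - y) -> valge 1 (g x - g y)) ->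
  (forall x, O x -> valge 1 (g (h x) - x)) ->
  forall i, res_class (g (res_elt (res_class (h (res_elt i))))) = i.
  move=> gO hO ginv ghK i; have Oi := res_int i; apply: res_inj.
  apply: (@valge_trans _ (g (res_elt (res_class (h (res_elt i)))))).
    by apply/valge_sym/res_classP/gO/res_int.
  apply: (@valge_trans _ (g (h (res_elt i)))); last exact: (ghK _ Oi).
  by apply: ginv; rewrite ?res_int //; [exact: hO | apply/valge_sym/res_classP/hO].
rewrite (reindex (fun i => res_class (phi (res_elt i)))) /=; last first.
  exists (fun i => res_class (psi (res_elt i))) => i _.
    by apply: (half psi phi).
  by apply: (half phi psi).
apply: eq_bigr => i _; have Oi := res_int i.
by apply: f_inv; rewrite ?res_int ?phiO //; apply/valge_sym/res_classP/phiO.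
Qed.

Lemma res_sum_shift (U : nmodType) (f : F -> U) b : O b -> res_invariant f ->
  \sum_i f (res_elt i) = \sum_i f (res_elt i + b).
Proof.
move=> Ob f_inv; apply: (@res_sum_reindex _ f (fun x => x + b) (fun x => x - b)) => //.
- by move=> x Ox; apply: integralD.
- by move=> x Ox; apply: integralB.
- by move=> x y _ _; rewrite opprD addrACA subrr addr0.
- by move=> x y _ _; rewrite opprB addrA subrK.
- by move=> x Ox; rewrite subrK subrr valge0.
- by move=> x Ox; rewrite addrK subrr valge0.
Qed.

Lemma res_sum_scale (U : nmodType) (f : F -> U) u : vunit u -> res_invariant f ->
  \sum_i f (res_elt i) = \sum_i f (u * res_elt i).
Proof.
move=> uu f_inv; have Ou := vunit_int uu; have OuV := vunit_int (vunitV uu).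
have u0 := vunit_neq0 uu.
apply: (@res_sum_reindex _ f (fun x => u * x) (fun x => u^-1 * x)) => //.
- by move=> x Ox; apply: integral_eltM.
- by move=> x Ox; apply: integral_eltM.
- by move=> x y _ _ xy; rewrite -mulrBr; apply: valgeMl.
- by move=> x y _ _ xy; rewrite -mulrBr; apply: valgeMl.
- by move=> x Ox; rewrite mulVKf // subrr valge0.
- by move=> x Ox; rewrite mulKf // subrr valge0.
Qed.

(** Inversion on the residue field, with the convention that 0 is its own
    inverse. *)
Definition uinv x : F := if vunit x then x^-1 else 0.

Lemma uinv_int x : O (uinv x).
Proof.
by rewrite /uinv; case: ifP => [/vunitV/vunit_int|_] //; apply: integral_elt0.
Qed.

Lemma uinv_cong x y : O x -> O y -> valge 1 (x - y) -> valge 1 (uinv x - uinv y).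
Proof.
rewrite /uinv => Ox Oy xy.
have -> : vunit y = vunit x.
  by apply/idP/idP => /vunit_cong; apply=> //; apply: valge_sym.
by case: ifP => ux; [apply: vunit_inv_cong => //; apply: vunit_cong ux _;
   apply: valge_sym | rewrite subrr valge0].
Qed.

Lemma res_sum_inv (U : nmodType) (f : F -> U) : res_invariant f ->
  \sum_i f (res_elt i) = \sum_i f (uinv (res_elt i)).
Proof.
have uinvK x : O x -> valge 1 (uinv (uinv x) - x).
  move=> Ox; rewrite /uinv; case ux: (vunit x) (vunitP Ox) => /= xm.
    by rewrite vunitV // invrK subrr valge0.
  by rewrite /vunit eqxx /= sub0r valgeN.
move=> f_inv; apply: (@res_sum_reindex _ f uinv uinv) => //.
- by move=> x _; apply: uinv_int.
- by move=> x _; apply: uinv_int.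
- exact: uinv_cong.
- exact: uinv_cong.
Qed.

(** Translation by 1 permutes the residue classes without fixed point, and its
    p-th power is trivial. *)
Lemma dvdp_card_residue : prime p -> (p %| #|residue|)%N.
Proof.
move=> p_pr; pose sh (i : residue) := res_class (res_elt i + 1).
have O1 i : O (res_elt i + 1) by apply: integralD (res_int i) integral_elt1.
have shE i : valge 1 (res_elt (sh i) - (res_elt i + 1)) by apply/valge_sym/res_classP.
have sh_inj : injective sh.
  move=> i j ij; apply: res_inj; have := shE j; rewrite -ij => /valge_sym.
  move=> /valge_trans/(_ (shE i)).
  by rewrite opprD addrACA subrr addr0 => /valge_sym.
pose t := perm sh_inj.
have tX n i : valge 1 (res_elt ((t ^+ n)%g i) - (res_elt i + n%:R)).
  elim: n i => [|n IH] i; first by rewrite expg0 perm1 addr0 subrr valge0.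
  rewrite expgSr permM permE; apply: valge_trans (shE _) _.
  by rewrite mulrSr addrA opprD addrACA subrr addr0; apply: IH.
have tp : (t ^+ p = 1)%g.
  apply/permP => i; rewrite perm1; apply: res_inj.
  apply: (valge_trans (tX p i)); rewrite addrC addKr; exact: residue_pchar.
have ordt : (p.-group <[t]>)%g.
  rewrite /pgroup -orderE; have := pnat_dvd _ (pnat_id p_pr); apply.
  by rewrite order_dvdn tp.
have nfix : ('Fix_(finset.setTfor residue | 'P)(<[t]>) = finset.set0)%g.
  apply/finset.setP => i; rewrite finset.in_setI finset.in_setT finset.in_set0 /=.
  apply/negbTE/negP => /afixP fix_i.
  have := fix_i t (cycle_id t); rewrite /= apermE permE => shi.
  have := shE i; rewrite shi opprD addNKr valgeN.
  by rewrite valgeE ?oner_neq0 // valn1.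
have := pgroup_fix_mod ordt (S := finset.setTfor residue) (to := 'P%act).
rewrite nfix cards0 cardsT mod0n => fixE; apply/eqP/fixE.
by apply/actsP => x _ y; rewrite !inE.
Qed.

End ValuationTheory.

(** * Two by two matrices *)

Section Matrices.
Context {p : nat} {F : localField p}.
Local Notation G := (GL2 F).
Local Notation O := (@integral_elt p F).
Implicit Types (a b c d x y z u : F) (g h : G).

Let m22 a b c d : 'M[F]_2 :=
  \matrix_(i < 2, j < 2) nth 0 (nth [::] [:: [:: a; b]; [:: c; d]] i) j.

Local Lemma det_m22 a b c d : \det (m22 a b c d) = a * d - b * c.
Proof.
rewrite (expand_det_row _ 0) !big_ord_recl big_ord0 addr0 /cofactor !det_mx11.
by rewrite !mxE /= expr0 expr1 mul1r mulN1r mulrN.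
Qed.

Local Lemma mx22_val a b c d : a * d - b * c != 0 -> mx22 a b c d = m22 a b c d :> 'M_2.
Proof.
move=> dt; rewrite /mx22 -/(m22 a b c d).
by rewrite (insubdK (1%g : G)) // unfold_in /= unitmxE det_m22 unitfE.
Qed.

Lemma mx22_entries a b c d : a * d - b * c != 0 ->
  [/\ mx22 a b c d 0 0 = a, mx22 a b c d 0 1 = b,
      mx22 a b c d 1 0 = c & mx22 a b c d 1 1 = d].
Proof. by move=> dt; rewrite mx22_val // !mxE. Qed.

Lemma forall_ord2 (P : 'I_2 -> 'I_2 -> Prop) :
  P 0 0 -> P 0 1 -> P 1 0 -> P 1 1 -> forall i j, P i j.
Proof.
move=> P00 P01 P10 P11 i j.
have ord2 (l : 'I_2) : l = 0 \/ l = 1.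
  by case: l => [[|[|//]] hl]; [left | right]; apply: val_inj.
by case: (ord2 i) => ->; case: (ord2 j) => ->.
Qed.

Lemma mx22P g : exists a b c d, a * d - b * c != 0 /\ g = mx22 a b c d.
Proof.
exists (g 0 0), (g 0 1), (g 1 0), (g 1 1).
have gE : (g : 'M_2) = m22 (g 0 0) (g 0 1) (g 1 0) (g 1 1).
  by apply/matrixP; apply: forall_ord2; rewrite !mxE.
have dt : g 0 0 * g 1 1 - g 0 1 * g 1 0 != 0.
  by rewrite -det_m22 -gE -unitfE -unitmxE; apply: GL2mx_unit.
by split=> //; apply: val_inj; rewrite /= mx22_val.
Qed.

Lemma mx22M a b c d a' b' c' d' :
  a * d - b * c != 0 -> a' * d' - b' * c' != 0 ->
  (mx22 a b c d * mx22 a' b' c' d')%g =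
  mx22 (a * a' + b * c') (a * b' + b * d') (c * a' + d * c') (c * b' + d * d').
Proof.
move=> dt dt'; apply: val_inj => /=; rewrite !mx22_val //; last first.
  have -> : (a * a' + b * c') * (c * b' + d * d') -
      (a * b' + b * d') * (c * a' + d * c') =
      (a * d - b * c) * (a' * d' - b' * c') by ring.
  exact: mulf_neq0.
by apply/matrixP; apply: forall_ord2; rewrite !mxE !big_ord_recl big_ord0 !mxE /= addr0.
Qed.

Lemma mx22_1 : mx22 1 0 0 1 = 1%g :> G.
Proof.
have dt : 1 * 1 - 0 * 0 != 0 :> F by rewrite mul1r mulr0 subr0 oner_neq0.
by apply: val_inj; rewrite /= mx22_val //; apply/matrixP; apply: forall_ord2; rewrite !mxE.
Qed.

Lemma mx22V a b c d (t := a * d - b * c) : t != 0 ->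
  ((mx22 a b c d)^-1)%g = mx22 (d / t) (- b / t) (- c / t) (a / t).
Proof.
move=> t0; have t'0 : d / t * (a / t) - - b / t * (- c / t) != 0.
  have -> : d / t * (a / t) - - b / t * (- c / t) = t^-1.
    by rewrite /t; field.
  by rewrite invr_eq0.
apply: (mulgI (mx22 a b c d)); rewrite mulgV mx22M // -mx22_1.
by congr mx22; rewrite /t in t0 *; field.
Qed.

Lemma KZ1 : KZ (1%g : G). Proof. by case: (@KZ_subgroup p F). Qed.
Lemma KZM g h : KZ g -> KZ h -> KZ (g * h)%g.
Proof. by case: (@KZ_subgroup p F) => _ + _; apply. Qed.
Lemma KZV g : KZ g -> KZ (g^-1)%g.
Proof. by case: (@KZ_subgroup p F) => _ _; apply. Qed.

Lemma center_scalar z : z != 0 -> center (mx22 z 0 0 z).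
Proof.
move=> z0 g; have [a [b [c [d [dt ->]]]]] := mx22P g.
have zz : z * z - 0 * 0 != 0 by rewrite mulr0 subr0 mulf_neq0.
by rewrite !mx22M //; congr mx22; ring.
Qed.

Lemma centerP g : center g -> exists2 z, z != 0 & g = mx22 z 0 0 z.
Proof.
have [a [b [c [d [dt ->]]]]] := mx22P g => cg.
have d1 : 1 * 1 - 1 * 0 != 0 :> F by rewrite mul1r mulr0 subr0 oner_neq0.
have d2 : 1 * 1 - 0 * 1 != 0 :> F by rewrite mul1r mul0r subr0 oner_neq0.
have e1 := cg (mx22 1 1 0 1); have e2 := cg (mx22 1 0 1 1).
rewrite !mx22M // in e1 e2.
have pr (x y z t x' y' z' t' : F) : x * t - y * z != 0 -> x' * t' - y' * z' != 0 ->
    mx22 x y z t = mx22 x' y' z' t' -> [/\ x = x', y = y', z = z' & t = t'].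
  move=> dd dd' ee; have [h1 h2 h3 h4] := mx22_entries dd.
  have [g1 g2 g3 g4] := mx22_entries dd'; rewrite ee in h1 h2 h3 h4.
  by split; [rewrite -h1 g1 | rewrite -h2 g2 | rewrite -h3 g3 | rewrite -h4 g4].
case/pr: e1 => [||e11 e12 _ _].
- have -> : (a * 1 + b * 0) * (c * 1 + d * 1) - (a * 1 + b * 1) * (c * 1 + d * 0)
    = a * d - b * c by ring.
  by [].
- have -> : (1 * a + 1 * c) * (0 * b + 1 * d) - (1 * b + 1 * d) * (0 * a + 1 * c)
    = a * d - b * c by ring.
  by [].
case/pr: e2 => [||f11 _ _ _].
- have -> : (a * 1 + b * 1) * (c * 0 + d * 1) - (a * 0 + b * 1) * (c * 1 + d * 1)
    = a * d - b * c by ring.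
  by [].
- have -> : (1 * a + 0 * c) * (1 * b + 1 * d) - (1 * b + 0 * d) * (1 * a + 1 * c)
    = a * d - b * c by ring.
  by [].
have c0 : c = 0 by move: e11; rewrite !mulr1 mulr0 addr0 !mul1r -{1}[a]addr0 => /addrI.
have b0 : b = 0 by move: f11; rewrite !mulr1 mul1r mul0r addr0 -{2}[a]addr0 => /addrI.
have ad : a = d by move: e12; rewrite !mulr1 !mul1r b0 addr0 add0r.
exists d; last by rewrite ad b0 c0.
by apply: contraNneq dt => d0; rewrite d0 b0 mulr0 mul0r subr0.
Qed.

Lemma maxcompactP a b c d : a * d - b * c != 0 ->
  maxcompact (mx22 a b c d) <->
  [/\ O a, O b, O c, O d & vunit (a * d - b * c)].
Proof.
move=> dt; have [h1 h2 h3 h4] := mx22_entries dt.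
set t := a * d - b * c.
have t'0 : d / t * (a / t) - - b / t * (- c / t) = t^-1 by rewrite /t; field.
have [h1' h2' h3' h4'] : [/\ (mx22 a b c d)^-1%g 0 0 = d / t,
    (mx22 a b c d)^-1%g 0 1 = - b / t, (mx22 a b c d)^-1%g 1 0 = - c / t
    & (mx22 a b c d)^-1%g 1 1 = a / t].
  by rewrite mx22V //; apply: mx22_entries; rewrite t'0 invr_eq0.
split=> [[gI gVI]|[Oa Ob Oc Od ut]].
  have Oa : O a by move: (gI 0 0); rewrite h1.
  have Ob : O b by move: (gI 0 1); rewrite h2.
  have Oc : O c by move: (gI 1 0); rewrite h3.
  have Od : O d by move: (gI 1 1); rewrite h4.
  have OV : O t^-1.
    move: (gVI 0 0) (gVI 0 1) (gVI 1 0) (gVI 1 1); rewrite h1' h2' h3' h4'.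
    by move=> *; rewrite -t'0; apply: integralB; apply: integral_eltM.
  have Ot : O t by apply: integralB; apply: integral_eltM.
  by split=> //; apply: (@vunit_dvd _ _ _ t^-1) => //; rewrite divff //; apply: vunit1.
have OV := vunit_int (vunitV ut).
split; apply: forall_ord2.
1-4: by rewrite ?h1 ?h2 ?h3 ?h4.
all: rewrite ?h1' ?h2' ?h3' ?h4'; apply: integral_eltM; rewrite ?integralN //.
Qed.

Lemma KZ_center g : center g -> KZ g.
Proof.
by move=> cg; exists 1%g; [case: (@maxcompact_subgroup p F) | exists g; rewrite ?mul1g].
Qed.

Lemma KZ_maxcompact g : maxcompact g -> KZ g.
Proof. by move=> Kg; exists g => //; exists 1%g; [move=> h; rewrite mul1g mulg1 | rewrite mulg1]. Qed.

Lemma KZ_mx22 a b c d : O a -> O b -> O c -> O d -> vunit (a * d - b * c) ->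
  KZ (mx22 a b c d).
Proof.
by move=> *; apply/KZ_maxcompact/maxcompactP => //; apply: vunit_neq0.
Qed.

Lemma KZ_mx22_scale z a b c d : z != 0 ->
  O a -> O b -> O c -> O d -> vunit (a * d - b * c) ->
  KZ (mx22 (z * a) (z * b) (z * c) (z * d)).
Proof.
move=> z0 Oa Ob Oc Od dt.
have zz : z * z - 0 * 0 != 0 by rewrite mulr0 subr0 mulf_neq0.
have -> : mx22 (z * a) (z * b) (z * c) (z * d) = (mx22 z 0 0 z * mx22 a b c d)%g.
  by rewrite mx22M //; [congr mx22; ring | exact: vunit_neq0].
by apply: KZM; [apply/KZ_center/center_scalar | apply: KZ_mx22].
Qed.

Lemma KZP g : KZ g -> exists z a b c d, [/\ z != 0, O a /\ O b, O c /\ O d,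
  vunit (a * d - b * c) & g = mx22 (z * a) (z * b) (z * c) (z * d)].
Proof.
move=> [h Kh [z /centerP[x x0 ->] <-]].
have [a [b [c [d [dt hE]]]]] := mx22P h; rewrite {}hE in Kh *.
have [Oa Ob Oc Od ut] := (maxcompactP dt).1 Kh.
have xx : x * x - 0 * 0 != 0 by rewrite mulr0 subr0 mulf_neq0.
by exists x, a, b, c, d; split=> //; rewrite mx22M //; congr mx22; ring.
Qed.

Lemma Pplus_mx22 x y : x != 0 -> O x -> O y -> Pplus (mx22 x y 0 1).
Proof. by move=> *; exists x, y. Qed.

Lemma Pplus_det x y : x != 0 -> x * 1 - y * 0 != 0.
Proof. by rewrite mulr1 mulr0 subr0. Qed.

Lemma PplusM g h : Pplus g -> Pplus h -> Pplus (g * h)%g.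
Proof.
move=> [x [y [x0 Ox Oy ->]]] [x' [y' [x'0 Ox' Oy' ->]]].
rewrite mx22M ?Pplus_det //.
have -> : mx22 (x * x' + y * 0) (x * y' + y * 1) (0 * x' + 1 * 0) (0 * y' + 1 * 1)
  = mx22 (x * x') (x * y' + y) 0 1 :> G by congr mx22; ring.
apply: Pplus_mx22; rewrite ?mulf_neq0 //; first exact: integral_eltM.
by apply: integralD => //; apply: integral_eltM.
Qed.

Lemma Pplus1 : Pplus (1%g : G).
Proof.
by rewrite -mx22_1; apply: Pplus_mx22;
   rewrite ?oner_neq0 ?integral_elt1 ?integral_elt0.
Qed.

(** The cosets g KZ are the vertices of the tree of PGL_2(F). Those contained
    in P^+ KZ form a half-tree: one side of the edge that joins the origin KZ
    to Pi KZ. *)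
Definition PKZ : set G := [set (q * h)%g | q in @Pplus p F & h in KZ].

Lemma PKZ_KZ g h : PKZ g -> KZ h -> PKZ (g * h)%g.
Proof.
move=> [q Pq [h' Kh' <-]] Kh; exists q => //; exists (h' * h)%g; first exact: KZM.
by rewrite mulgA.
Qed.

(** When the lower right entry divides the lower left one, a column operation
    over O makes the matrix upper triangular. *)
Lemma PKZ_lower_r a b c d (t := a * d - b * c) : t != 0 -> d != 0 ->
  O (c / d) -> O (b / d) -> O (t / d ^+ 2) -> PKZ (mx22 a b c d).
Proof.
move=> t0 d0 Oc Ob Ot.
exists (mx22 (t / d ^+ 2) (b / d) 0 1).
  by apply: Pplus_mx22; rewrite // mulf_neq0 ?invr_eq0 ?expf_neq0.
exists (mx22 (d * 1) (d * 0) (d * (c / d)) (d * 1)).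
  by apply: KZ_mx22_scale; rewrite ?integral_elt1 ?integral_elt0 // mulr1 mul0r subr0 vunit1.
rewrite mx22M; first by congr mx22; rewrite /t; field.
  by apply: Pplus_det; rewrite mulf_neq0 ?invr_eq0 ?expf_neq0.
by rewrite !mulr1 mulr0 mul0r subr0 mulf_neq0.
Qed.

(** The same, after exchanging the columns. *)
Lemma PKZ_lower_l a b c d (t := a * d - b * c) : t != 0 -> c != 0 ->
  O (d / c) -> O (a / c) -> O (t / c ^+ 2) -> PKZ (mx22 a b c d).
Proof.
move=> t0 c0 Od Oa Ot.
exists (mx22 (- t / c ^+ 2) (a / c) 0 1).
  by apply: Pplus_mx22; rewrite ?mulf_neq0 ?oppr_eq0 ?invr_eq0 ?expf_neq0 // mulNr integralN.
exists (mx22 (c * 0) (c * 1) (c * 1) (c * (d / c))).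
  apply: KZ_mx22_scale; rewrite ?integral_elt1 ?integral_elt0 //.
  by rewrite mulr1 mul0r sub0r vunitN vunit1.
rewrite mx22M; first by congr mx22; rewrite /t; field.
  by apply: Pplus_det; rewrite mulf_neq0 ?oppr_eq0 ?invr_eq0 ?expf_neq0.
by rewrite mulr0 mul0r sub0r oppr_eq0 mulr1 mulf_neq0.
Qed.

End Matrices.

(** * Half-trees in the group *)

Notation "'n_' b" := (mx22 1 b 0 1) (at level 8, b at level 2, format "'n_' b").
Notation lw c := (mx22 1 0 c 1).
Notation dg x y := (mx22 x 0 0 y).
Notation ww := (mx22 0 1 1 0).

Ltac nz := by rewrite ?(add0r, addr0, mul0r, mulr0, mul1r, mulr1, subr0, sub0r, oppr_eq0,
  invr_eq0, oner_neq0, mulf_neq0, expf_neq0) //.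

Section MatrixIdentities.
Context {p : nat} {F : localField p} (varpi : F) (varpi_unif : uniformizer varpi).
Local Notation G := (GL2 F).
Local Notation O := (@integral_elt p F).
Implicit Types (a b c d x y z u : F) (g h : G).
Local Notation al := (mx22 varpi 0 0 1).
Local Notation Pi := (mx22 0 1 varpi 0).

Lemma varpi_neq0 : varpi != 0. Proof. by case/andP: varpi_unif. Qed.
Lemma valn_varpi : valn varpi = 1. Proof. by case/andP: varpi_unif => _ /eqP. Qed.
Hint Resolve varpi_neq0 : core.

Lemma valge_varpi : valge 1 varpi.
Proof. by rewrite valgeE // valn_varpi. Qed.

Lemma varpi_int : O varpi. Proof. exact/valge1_int/valge_varpi. Qed.

Lemma valge_mul_varpi n x : valge n x -> valge (n + 1) (varpi * x).
Proof. by move=> nx; rewrite addrC; apply: valgeM => //; apply: valge_varpi. Qed.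

Lemma valge_div_varpi n x : valge (n + 1) x -> valge n (x / varpi).
Proof.
move=> nx; have -> : n = (n + 1) - 1 by rewrite addrK.
by apply: valgeM => //; rewrite valgeE ?invr_eq0 // valnV // valn_varpi.
Qed.

Lemma valge1_div x : valge 1 x -> O (x / varpi).
Proof. by move=> x1; apply: valge_div_varpi; rewrite add0r. Qed.

Lemma valge_varpiX (n : nat) x : valge n x -> exists2 y, O y & x = varpi ^+ n * y.
Proof.
elim: n x => [|n IH] x nx; first by exists x; rewrite ?expr0 ?mul1r.
have [|y Oy xE] := IH (x / varpi); first by apply: valge_div_varpi; rewrite -addn1 PoszD in nx.
by exists y => //; rewrite exprSr mulrAC -xE divfK.
Qed.

Lemma integral_decomp x : x != 0 -> O x ->
  exists n u, vunit u /\ x = varpi ^+ n * u.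
Proof.
move=> x0 Ox; have [n nE] : exists n : nat, valn x = n.
  by move: Ox; rewrite /O valgeE //; case: (valn x) => // n _; exists n.
exists n, (x / varpi ^+ n); split; last by rewrite mulrC divfK ?expf_neq0.
have vX : valn (varpi ^+ n) = n.
  elim: n {nE} => [|n IH]; first by rewrite expr0 valn1.
  by rewrite exprS valnM ?expf_neq0 // IH valn_varpi.
have X0 : varpi ^+ n != 0 by rewrite expf_neq0.
have V0 : valn (x / varpi ^+ n) = 0.
  by rewrite valnM ?invr_eq0 // valnV // vX nE subrr.
by rewrite /vunit V0 mulf_neq0 ?invr_eq0.
Qed.

Lemma upM b b' : (n_ b * n_ b' = n_ (b + b') :> G)%g.
Proof. by rewrite mx22M; [congr mx22; ring | nz..]. Qed.

Lemma up0 : n_ 0 = 1%g :> G. Proof. exact: mx22_1. Qed.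

Lemma upV b : ((n_ b)^-1 = n_ (- b) :> G)%g.
Proof. by apply: (mulgI (n_ b)); rewrite mulgV upM subrr up0. Qed.

Lemma dgM x y x' y' : x != 0 -> y != 0 -> x' != 0 -> y' != 0 ->
  (dg x y * dg x' y' = dg (x * x') (y * y') :> G)%g.
Proof. by move=> *; rewrite mx22M; [congr mx22; ring | nz..]. Qed.

Lemma al_up b : (al * n_ b = n_ (varpi * b) * al :> G)%g.
Proof. by rewrite !mx22M; [congr mx22; ring | nz..]. Qed.

Lemma dg_up x y b : x != 0 -> y != 0 ->
  (dg x y * n_ b = n_ (x / y * b) * dg x y :> G)%g.
Proof. by move=> *; rewrite !mx22M; [congr mx22; field | nz..]. Qed.

Lemma dg_al x y : x != 0 -> y != 0 -> (dg x y * al = al * dg x y :> G)%g.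
Proof. by move=> *; rewrite !mx22M; [congr mx22; ring | nz..]. Qed.

Lemma wwPi : (ww * Pi = al :> G)%g.
Proof. by rewrite mx22M; [congr mx22; ring | nz..]. Qed.

Lemma wwal : (ww * al = Pi :> G)%g.
Proof. by rewrite mx22M; [congr mx22; ring | nz..]. Qed.

Lemma Pi2 : (Pi * Pi = dg varpi varpi :> G)%g.
Proof. by rewrite mx22M; [congr mx22; ring | nz..]. Qed.

Lemma alPi : (al * Pi = ww * dg varpi varpi :> G)%g.
Proof. by rewrite !mx22M; [congr mx22; ring | nz..]. Qed.

Lemma up_Pi b : (n_ b * Pi = Pi * lw (varpi * b) :> G)%g.
Proof. by rewrite !mx22M; [congr mx22; ring | nz..]. Qed.

Lemma dg_Pi x y : x != 0 -> y != 0 -> (dg x y * Pi = Pi * dg y x :> G)%g.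
Proof. by move=> *; rewrite !mx22M; [congr mx22; ring | nz..]. Qed.

(** The branches at the origin are indexed by the projective line over the
    residue field, on which [ww] acts by inversion. *)
Lemma ww_up_al x : x != 0 ->
  (ww * (n_ x * al) = n_ (x^-1) * al * (dg (- x^-1) x * lw (varpi / x)) :> G)%g.
Proof.
move=> x0; have x'0 : x^-1 != 0 by rewrite invr_eq0.
by rewrite !mx22M; [congr mx22; field | nz..].
Qed.

(** Lower unipotents act on the projective line by homographies. *)
Lemma lw_up_al c x (t := 1 + c * x) : t != 0 ->
  (lw c * (n_ x * al) = n_ (x / t) * al * (dg t^-1 t * lw (c * varpi / t)) :> G)%g.
Proof.
move=> t0; have t'0 : t^-1 != 0 by rewrite invr_eq0.
by rewrite !mx22M; [congr mx22; rewrite /t in t0 *; field | nz..].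
Qed.

Lemma dg_KZ x y : vunit x -> vunit y -> KZ (dg x y : G).
Proof.
move=> ux uy; apply: KZ_mx22; rewrite ?integral_elt0 ?vunit_int // mulr0 subr0.
exact: vunitM.
Qed.

Lemma up_KZ b : O b -> KZ (n_ b : G).
Proof.
by move=> Ob; apply: KZ_mx22; rewrite ?integral_elt0 ?integral_elt1 // mulr0 subr0 mulr1 vunit1.
Qed.

Lemma ww_KZ : KZ (ww : G).
Proof.
apply: KZ_mx22; rewrite ?integral_elt0 ?integral_elt1 //.
by rewrite mulr1 mul0r sub0r vunitN vunit1.
Qed.

Lemma scalar_KZ z : z != 0 -> KZ (dg z z : G).
Proof. by move=> z0; apply/KZ_center/center_scalar. Qed.

Lemma PiV : (Pi^-1 = dg varpi^-1 varpi^-1 * Pi :> G)%g.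
Proof.
apply: (mulgI Pi); rewrite mulgV (center_scalar _ _) ?invr_eq0 // mulgA Pi2.
by rewrite dgM ?invr_eq0 // divff // mx22_1.
Qed.

(** Pivot on the lower right entry. When it is a unit, as for the elements of
    the Iwahori subgroup, the factors are integral. *)
Lemma Iwahori_factor a b c d (t := a * d - b * c) : t != 0 -> d != 0 ->
  mx22 a b c d = (n_ (b / d) * (dg (t / d) d * lw (c / d)) :> G)%g.
Proof.
by move=> t0 d0; rewrite !mx22M; [congr mx22; rewrite /t; field | nz..].
Qed.

(** When [c] is a unit and [m] is congruent to [a / c], the last factor is
    upper triangular modulo the maximal ideal. *)
Lemma Bruhat_factor a b c d m : a * d - b * c != 0 ->
  mx22 a b c d = (n_ m * (ww * mx22 c d (a - m * c) (b - m * d)) :> G)%g.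
Proof.
move=> t0; have t'0 : c * (b - m * d) - d * (a - m * c) != 0.
  have -> : c * (b - m * d) - d * (a - m * c) = - (a * d - b * c) by ring.
  by rewrite oppr_eq0.
have ww0 : 0 * 0 - 1 * 1 != 0 :> F by nz.
have up0 : 1 * 1 - m * 0 != 0 by nz.
rewrite (mx22M ww0 t'0) mx22M //; first by congr mx22; ring.
have -> : (0 * c + 1 * (a - m * c)) * (1 * d + 0 * (b - m * d)) -
  (0 * d + 1 * (b - m * d)) * (1 * c + 0 * (a - m * c)) = a * d - b * c by ring.
by [].
Qed.

(** The neighbours of the origin are the vertices of the [n_ (res_elt i) *
    al], and that of [Pi]. *)
Lemma KZ_al g : KZ g ->
  (exists i, exists2 h, KZ h & (g * al = n_ (res_elt i) * al * h)%g) \/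
  (exists2 h, KZ h & (g * al = Pi * h)%g).
Proof.
move=> /KZP[z [a [b [c [d [z0 [Oa Ob] [Oc Od] ut ->]]]]]].
have t0 := vunit_neq0 ut.
have zz : z * z - 0 * 0 != 0 by nz.
have gE : mx22 (z * a) (z * b) (z * c) (z * d) = (dg z z * mx22 a b c d :> G)%g.
  by rewrite mx22M //; congr mx22; ring.
have cz := center_scalar z0.
have [ud|d1] := orP (vunitP Od).
- left; have d0 := vunit_neq0 ud; pose i := res_class (b / d).
  have Obd : O (b / d) by apply: integral_eltM => //; apply/vunit_int/vunitV.
  set l := res_elt i; have Ol : O l := res_int i.
  have bl : valge 1 (b - l * d).
    have -> : b - l * d = (b / d - l) * d by field.
    by apply: valgeMr => //; apply: res_classP.
  pose h := mx22 (a - l * c) ((b - l * d) / varpi) (c * varpi) d.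
  have hE : (a - l * c) * d - (b - l * d) / varpi * (c * varpi) = a * d - b * c by field.
  exists i, (dg z z * h)%g.
    apply: KZM; first exact: scalar_KZ.
    apply: KZ_mx22; rewrite ?hE //.
    + by apply: integralB => //; apply: integral_eltM.
    + exact: valge1_div.
    + by apply: integral_eltM => //; apply: varpi_int.
  rewrite gE -mulgA -[in RHS]mulgA [in RHS](mulgA al) -(cz al) -[in RHS]mulgA.
  rewrite [in RHS]mulgA -(cz (n_ l)) -[in RHS]mulgA; congr (_ * _)%g.
  rewrite /h mx22M //; last by nz.
  rewrite [(al * _)%g]mx22M ?hE //; last by nz.
  rewrite mx22M; [congr mx22; field => // | nz |].
  have -> : (varpi * (a - l * c) + 0 * (c * varpi)) * (0 * ((b - l * d) / varpi) + 1 * d)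
    - (varpi * ((b - l * d) / varpi) + 0 * d) * (0 * (a - l * c) + 1 * (c * varpi))
    = varpi * (a * d - b * c) by field.
  exact: mulf_neq0.
- right; pose h := mx22 c (d / varpi) (a * varpi) b.
  have hE : c * b - d / varpi * (a * varpi) = - (a * d - b * c) by field.
  exists (dg z z * h)%g.
    apply: KZM; first exact: scalar_KZ.
    apply: KZ_mx22; rewrite ?hE ?vunitN //; first exact: valge1_div.
    by apply: integral_eltM => //; apply: varpi_int.
  rewrite gE -mulgA [in RHS]mulgA -(cz Pi) -[in RHS]mulgA; congr (_ * _)%g.
  rewrite /h !mx22M //; [congr mx22; field => // | nz | by rewrite hE oppr_eq0 | nz].
Qed.

Lemma PiV_mul x y : x != 0 ->
  (Pi^-1 * mx22 x y 0 1)%g = mx22 0 varpi^-1 x y :> G.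
Proof.
move=> x0; apply: (mulgI Pi); rewrite mulKVg mx22M; [congr mx22; field => // | nz..].
Qed.

(** A column operation over O leaves a matrix with lower row 0, 1 and upper
    row x, y. It lies in the half-tree of the origin if x and y are integral;
    otherwise the larger of the two is the pivot that puts its translate by
    the inverse of [Pi] in P^+ KZ. *)
Lemma PKZ_cover g : PKZ g \/ PKZ (Pi^-1 * g)%g.
Proof.
suff H x y : x != 0 -> PKZ (mx22 x y 0 1) \/ PKZ (Pi^-1 * mx22 x y 0 1)%g.
  have [a [b [c [d [t0 ->]]]]] := mx22P g.
  suff [x [y [h [x0 Kh ->]]]] : exists x y (h : G), [/\ x != 0, KZ h
      & mx22 a b c d = (mx22 x y 0 1 * h)%g].
    case: (H x y x0) => [l|r]; [left | right; rewrite mulgA]; exact: PKZ_KZ.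
  have [d0|d0] := eqVneq d 0.
    have c0 : c != 0 by apply: contraNneq t0 => ->; rewrite d0 !mulr0 subr0.
    have b0 : b != 0 by apply: contraNneq t0 => ->; rewrite d0 mulr0 mul0r subr0.
    exists (b / c), (a / c), (mx22 (c * 0) (c * 1) (c * 1) (c * 0)); split.
    - by nz.
    - apply: KZ_mx22_scale; rewrite ?integral_elt0 ?integral_elt1 //.
      by rewrite mulr1 mul0r sub0r vunitN vunit1.
    - by rewrite mx22M; [congr mx22; rewrite ?d0; field | nz..].
  have [Oc|[c0 Od]] := integral_total c d0.
    exists ((a * d - b * c) / d ^+ 2), (b / d),
      (mx22 (d * 1) (d * 0) (d * (c / d)) (d * 1)); split.
    - by nz.
    - apply: KZ_mx22_scale; rewrite ?integral_elt0 ?integral_elt1 //.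
      by rewrite mulr1 mul0r subr0 vunit1.
    - by rewrite mx22M; [congr mx22; field | nz..].
  exists (- (a * d - b * c) / c ^+ 2), (a / c),
    (mx22 (c * 0) (c * 1) (c * 1) (c * (d / c))); split.
  - by nz.
  - apply: KZ_mx22_scale; rewrite ?integral_elt0 ?integral_elt1 //; first exact: valge1_int.
    by rewrite mulr1 mul0r sub0r vunitN vunit1.
  - by rewrite mx22M; [congr mx22; field | nz..].
move=> x0; have invO z : ~~ O z -> z != 0 /\ O (varpi * z)^-1.
  have [->|z0] := eqVneq z 0; first by rewrite integral_elt0.
  rewrite /O !valgeE ?invr_eq0 ?mulf_neq0 // valnV ?mulf_neq0 // valnM // valn_varpi.
  by lia.
have [/andP[Ox Oy]|] := boolP (O x && O y).
  left; exists (mx22 x y 0 1); first exact: Pplus_mx22.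
  by exists 1%g; [exact: KZ1 | rewrite mulg1].
rewrite negb_and => nO; right; rewrite PiV_mul //.
have dt : 0 * y - varpi^-1 * x != 0 by nz.
have left_case : O (y / x) -> ~~ O x -> PKZ (mx22 0 varpi^-1 x y).
  move=> Oyx /invO[_ OVx]; apply: PKZ_lower_l => //.
    by rewrite mul0r integral_elt0.
  have -> : (0 * y - varpi^-1 * x) / x ^+ 2 = - (varpi * x)^-1 by field; rewrite x0 /=.
  by rewrite integralN.
have [y0|y0] := eqVneq y 0.
  apply: left_case; first by rewrite y0 mul0r integral_elt0.
  by move: nO; rewrite y0 integral_elt0 orbF.
have [Oxy|[_ /valge1_int Oyx]] := integral_total x y0; last first.
  apply: left_case => //; case/orP: nO => // nOy; apply: contra nOy => Ox.
  by rewrite -[y](divfK x0); apply: integral_eltM.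
have [_ OVy] : y != 0 /\ O (varpi * y)^-1.
  apply: invO; case/orP: nO => // nOx; apply: contra nOx => Oy.
  by rewrite -[x](divfK y0); apply: integral_eltM.
apply: PKZ_lower_r => //; first by rewrite -invfM.
have -> : (0 * y - varpi^-1 * x) / y ^+ 2 = - (x / y) * (varpi * y)^-1 by field; rewrite y0 /=.
by apply: integral_eltM; rewrite ?integralN.
Qed.

(** If q KZ = Pi q' KZ with q and q' in P^+, then q^-1 Pi q' is a scalar z
    times an element of K. Its upper right entry bounds the valuation of z
    from above, its determinant bounds it from below, and the bounds are
    incompatible. *)
Lemma PKZ_disjoint g : PKZ g -> PKZ (Pi^-1 * g)%g -> False.
Proof.
move=> [_ [x [y [x0 Ox Oy ->]]] [h Kh gE]].
move=> [_ [x' [y' [x'0 Ox' Oy' ->]]] [h' Kh' gE']].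
have {gE gE'} hE : (h * h'^-1 = (mx22 x y 0 1)^-1 * (Pi * mx22 x' y' 0 1))%g.
  apply: (mulgI (mx22 x y 0 1)); rewrite mulKVg mulgA gE.
  by apply: (mulIg h'); rewrite mulgVK -mulgA gE' mulKVg.
have := KZM Kh (KZV Kh'); rewrite hE => /KZP[z [a [b [c [d [z0 [Oa Ob] _ ut mE]]]]]].
have {mE} mE : (Pi * mx22 x' y' 0 1 = mx22 x y 0 1 * mx22 (z * a) (z * b) (z * c) (z * d))%g.
  by rewrite -mE mulKVg.
have t0 := vunit_neq0 ut.
have zt0 : z * a * (z * d) - z * b * (z * c) != 0.
  have -> : z * a * (z * d) - z * b * (z * c) = z * z * (a * d - b * c) by ring.
  by nz.
move: mE; rewrite mx22M; [|nz|nz]; rewrite mx22M; [|nz|exact: zt0].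
set d1 := (0 * x' + 1 * 0) * (varpi * y' + 0 * 1) - (0 * y' + 1 * 1) * (varpi * x' + 0 * 0).
have d1E : d1 = - (varpi * x') by rewrite /d1; ring.
have d10 : d1 != 0 by rewrite d1E; nz.
set d2 := (x * (z * a) + y * (z * c)) * (0 * (z * b) + 1 * (z * d)) -
  (x * (z * b) + y * (z * d)) * (0 * (z * a) + 1 * (z * c)).
have d2E : d2 = x * z * z * (a * d - b * c) by rewrite /d2; ring.
have d20 : d2 != 0 by rewrite d2E; nz.
have [e1 e2 e3 e4] := mx22_entries d10; have [f1 f2 f3 f4] := mx22_entries d20.
move=> mE; rewrite mE in e1 e2 e3 e4.
have uu : vunit (1 - varpi * (y * y')).
  apply: vunit1D; rewrite valgeN; apply: valgeMr; first exact: valge_varpi.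
  exact: integral_eltM.
have uE : x * z * b = 1 - varpi * (y * y').
  have h2 : x * (z * b) + y * (z * d) = 0 * y' + 1 * 1 by apply: etrans (esym f2) e2.
  have h4 : 0 * (z * b) + 1 * (z * d) = varpi * y' + 0 * 1 by apply: etrans (esym f4) e4.
  have {}h4 : z * d = varpi * y' by move: h4; rewrite !mul0r mul1r add0r addr0.
  have {}h2 : x * (z * b) = 1 - y * (z * d).
    by apply/eqP; rewrite eq_sym subr_eq h2 mul0r mul1r add0r.
  by rewrite -mulrA h2 h4; ring.
have dE : varpi * x' = - (x * z * z * (a * d - b * c)).
  have h1 : x * (z * a) + y * (z * c) = 0 * x' + 1 * 0 by apply: etrans (esym f1) e1.
  have h2 : x * (z * b) + y * (z * d) = 0 * y' + 1 * 1 by apply: etrans (esym f2) e2.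
  have h3 : 0 * (z * a) + 1 * (z * c) = varpi * x' + 0 * 0 by apply: etrans (esym f3) e3.
  have h4 : 0 * (z * b) + 1 * (z * d) = varpi * y' + 0 * 1 by apply: etrans (esym f4) e4.
  by rewrite -d2E /d2 h1 h2 h3 h4; ring.
have b0 : b != 0 by apply: contraTneq uu => b0; rewrite -uE b0 mulr0 /vunit eqxx.
have v1 : valn (x * z * b) = 0 by rewrite uE; case/andP: uu => _ /eqP.
have v2 : valn (varpi * x') = valn (x * z * z * (a * d - b * c)) by rewrite dE valnN.
have vt : valn (a * d - b * c) = 0 by case/andP: ut => _ /eqP.
move: v1 v2 Ox Ob Ox'; rewrite /O !valgeE // !valnM ?mulf_neq0 // valn_varpi vt.
by move: (valn x) (valn z) (valn b) (valn x'); clear; lia.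
Qed.

(** The Iwahori subgroup fixes the edge between the origin and [Pi] and its
    two ends, hence preserves the half-trees. *)
Lemma lw_Pplus c q : valge 1 c -> Pplus q -> PKZ (lw c * q)%g.
Proof.
move=> c1 [x [y [x0 Ox Oy ->]]].
have ud : vunit (1 + c * y) by apply: vunit1D; apply: valgeMr.
have d0 := vunit_neq0 ud; have OV := vunit_int (vunitV ud).
rewrite mx22M; [|nz|nz].
have -> : mx22 (1 * x + 0 * 0) (1 * y + 0 * 1) (c * x + 1 * 0) (c * y + 1 * 1)
  = mx22 x y (c * x) (1 + c * y) :> G by congr mx22; ring.
have tE : x * (1 + c * y) - y * (c * x) = x by ring.
apply: PKZ_lower_r; rewrite ?tE //; try exact: integral_eltM.
  by apply: integral_eltM => //; apply: integral_eltM => //; apply: valge1_int.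
by rewrite -exprVn; apply: integral_eltM => //; apply: integral_eltM.
Qed.

(** The branches other than the one through the translate of the origin by
    [al] lie, seen from that vertex, on the side of the origin. *)
Lemma opposite_branch v q : vunit v -> Pplus q ->
  PKZ (Pi^-1 * (al^-1 * (n_ v * al)) * q)%g.
Proof.
move=> uv [x [y [x0 Ox Oy ->]]].
have v0 := vunit_neq0 uv.
have u2 : vunit (v + varpi * y).
  apply: (vunit_cong uv); rewrite addrC addKr; apply: valgeMr => //.
  exact: valge_varpi.
set d := v + varpi * y; have d0 := vunit_neq0 u2; have OV := vunit_int (vunitV u2).
have alE : (al^-1 * (n_ v * al) = n_ (v / varpi) :> G)%g.
  by apply: (mulgI al); rewrite mulKVg al_up mulrC divfK.
rewrite alE -mulgA [(n_ _ * _)%g]mx22M; [|nz|nz].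
have -> : mx22 (1 * x + v / varpi * 0) (1 * y + v / varpi * 1) (0 * x + 1 * 0)
  (0 * y + 1 * 1) = mx22 x (d / varpi) 0 1 :> G by congr mx22; rewrite /d; field.
rewrite PiV_mul //; have tE : 0 * (d / varpi) - varpi^-1 * x = - x / varpi by field.
apply: PKZ_lower_r; rewrite ?tE; try by nz.
- have -> : x / (d / varpi) = varpi * x * d^-1 by field; rewrite d0 varpi_neq0.
  by apply: integral_eltM => //; apply: integral_eltM => //; apply: varpi_int.
- by have -> : varpi^-1 / (d / varpi) = d^-1 by field; rewrite d0 varpi_neq0.
- have -> : - x / varpi / (d / varpi) ^+ 2 = - (varpi * x * (d^-1 * d^-1)).
    by field; rewrite d0 varpi_neq0.
  rewrite integralN; apply: integral_eltM; apply: integral_eltM => //.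
  exact: varpi_int.
Qed.

Lemma Pplus_factor q : Pplus q -> exists n b u,
  [/\ O b, vunit u & q = (n_ b * (al ^+ n * dg u 1%R))%g].
Proof.
move=> [x [y [x0 Ox Oy ->]]]; have [n [u [uu xE]]] := integral_decomp x0 Ox.
have u0 := vunit_neq0 uu; exists n, y, u; split=> //.
have alX : (al ^+ n = mx22 (varpi ^+ n) 0 0 1 :> G)%g.
  elim: n {xE} => [|n IH]; first by rewrite expg0 expr0 mx22_1.
  by rewrite expgS IH mx22M; [congr mx22; rewrite ?exprS; ring | nz..].
rewrite alX [(_ * dg u 1%R)%g]mx22M; [|nz|nz].
by rewrite mx22M; [congr mx22; rewrite ?xE; ring | nz..].
Qed.

Lemma Pplus_up_al b : O b -> Pplus (n_ b * al)%g.
Proof.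
move=> Ob; apply: PplusM; apply: Pplus_mx22;
  rewrite ?oner_neq0 ?integral_elt1 ?integral_elt0 ?varpi_neq0 //; exact: varpi_int.
Qed.

Lemma Pplus_dg u : vunit u -> Pplus (dg u 1%R : G).
Proof.
by move=> uu; apply: Pplus_mx22;
   [exact: vunit_neq0 | exact: vunit_int | exact: integral_elt0].
Qed.

Lemma Pplus_up b : O b -> Pplus (n_ b : G).
Proof. by move=> Ob; apply: Pplus_mx22; rewrite ?oner_neq0 ?integral_elt1. Qed.

End MatrixIdentities.

(** * Generated subrepresentations *)

Section GenericRep.
Context {p : nat} {F : localField p} {k : fieldType} {U : lmodType k}.
Context (rho : rep (GL2 F) U).
Local Notation G := (GL2 F).
Implicit Types (H : set G) (A S T : set U).

Lemma repK g x : rho (g^-1)%g (rho g x) = x.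
Proof. by rewrite -repM mulVg rep1. Qed.

Lemma repVK g x : rho g (rho (g^-1)%g x) = x.
Proof. by rewrite -repM mulgV rep1. Qed.

Lemma gen_subspace H A : subspace (gen rho H A). Proof. exact: lspan_subspace. Qed.

Lemma gen_inc H A g x : H g -> A x -> gen rho H A (rho g x).
Proof. by move=> Hg Ax; apply: lspan_inc; exists g => //; exists x. Qed.

Lemma gen_min H A S : subspace S ->
  (forall g x, H g -> A x -> S (rho g x)) -> gen rho H A `<=` S.
Proof. by move=> Ss HS; apply: lspan_min => // _ [g Hg [x Ax <-]]; apply: HS. Qed.

Lemma im_rep_subspace g S : subspace S -> subspace [set rho g x | x in S].
Proof. by move=> Ss; apply: im_subspace => //; apply: rep_linear. Qed.

Lemma preim_rep_subspace g S : subspace S -> subspace [set x | S (rho g x)].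
Proof. by move=> Ss; apply: (preim_subspace (rep_linear rho g) Ss). Qed.

Lemma gen_act H H' A S g : (forall h, H h -> H' (g * h)%g) -> subspace S ->
  (forall h x, H' h -> A x -> S (rho h x)) ->
  forall x, gen rho H A x -> S (rho g x).
Proof.
move=> HH' Ss HS; suff : gen rho H A `<=` [set x | S (rho g x)] by apply.
apply: gen_min; first exact: preim_rep_subspace.
by move=> h x Hh Ax /=; rewrite -repM; apply: HS => //; apply: HH'.
Qed.

Lemma gen_subrep H A : is_subgroup H -> subrep rho H (gen rho H A).
Proof.
move=> [H1 HM HV]; split; first exact: gen_subspace.
move=> g x Hg; apply: (@gen_act H H) => //; first by move=> h; apply: HM.
  exact: gen_subspace.
by move=> h y; apply: gen_inc.
Qed.

Lemma gen_self H A : H 1%g -> A `<=` gen rho H A.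
Proof. by move=> H1 x Ax; rewrite -[x](rep1 rho); apply: gen_inc. Qed.

Lemma gen_mono H A B : A `<=` B -> gen rho H A `<=` gen rho H B.
Proof.
by move=> AB; apply: gen_min; [exact: gen_subspace | move=> g x Hg /AB; apply: gen_inc].
Qed.

Lemma setT_subgroup : is_subgroup [set: G]. Proof. by []. Qed.

End GenericRep.

(** * Spans over half-trees and balls *)

Section HalfTrees.
Context {p : nat} {F : localField p} (varpi : F) (varpi_unif : uniformizer varpi).
Context {k : fieldType} {U : lmodType k} (rho : rep (GL2 F) U).
Local Notation G := (GL2 F).
Local Notation O := (@integral_elt p F).
Local Notation al := (mx22 varpi 0 0 1).
Local Notation Pi := (mx22 0 1 varpi 0).
Implicit Types (S T A : set U).

Lemma rhoD g x y : rho g (x + y) = rho g x + rho g y.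
Proof. exact: linD (rep_linear rho g) _ _. Qed.
Lemma rhoB g x y : rho g (x - y) = rho g x - rho g y.
Proof. exact: linB (rep_linear rho g) _ _. Qed.
Lemma rho0 g : rho g 0 = 0.
Proof. exact: lin0 (rep_linear rho g). Qed.
Lemma rhoZ g c x : rho g (c *: x) = c *: rho g x.
Proof. exact: linZ (rep_linear rho g) _ _. Qed.
Lemma rho_sum g (I : Type) (r : seq I) (P : pred I) (x : I -> U) :
  rho g (\sum_(i <- r | P i) x i) = \sum_(i <- r | P i) rho g (x i).
Proof. exact: (lin_sum (rep_linear rho g)). Qed.

(** Representatives of the neighbours of the origin that lie in its half-tree.
    *)
Definition child (i : residue) : G := (n_ (res_elt i) * al)%g.

Definition branch T : set U :=
  [set \sum_i rho (child i) (f i) | f in [set f : residue -> U | forall i, T (f i)]].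

Lemma branch_subspace T : subspace T -> subspace (branch T).
Proof.
move=> Ts; split.
  exists (fun=> 0) => [i|]; first exact: sub0.
  by rewrite big1 // => i _; rewrite rho0.
move=> a _ _ [f Tf <-] [g Tg <-]; exists (fun i => a *: f i + g i).
  by move=> i; apply: Ts.2.
rewrite scaler_sumr -big_split; apply: eq_bigr => i _ /=.
by rewrite rhoD rhoZ.
Qed.

Lemma branchS T T' : T `<=` T' -> branch T `<=` branch T'.
Proof. by move=> TT' _ [f Tf <-]; exists f => // i; apply: TT'. Qed.

Lemma branch_single T i x : subspace T -> T x -> branch T (rho (child i) x).
Proof.
move=> Ts Tx; exists (fun j => if j == i then x else 0).
  by move=> j; case: ifP => // _; apply: sub0.
by rewrite (bigD1 i) //= eqxx big1 ?addr0 // => j /negPf ->; rewrite rho0.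
Qed.

Lemma branch_min T S : subspace S ->
  (forall i x, T x -> S (rho (child i) x)) -> branch T `<=` S.
Proof. by move=> Ss TS _ [f Tf <-]; apply: sub_sum => // i _; apply: TS. Qed.

Lemma up_al_child b : O b -> exists2 b', O b' &
  (n_ b * al = child (res_class b) * n_ b')%g.
Proof.
move=> Ob; exists ((b - res_elt (res_class b)) / varpi).
  exact/valge1_div/res_classP.
rewrite /child -mulgA (al_up varpi_unif) mulgA upM; congr (n_ _ * _)%g.
by rewrite mulrC divfK ?varpi_neq0 // addrC subrK.
Qed.

Lemma branch_up_al T b x : subspace T ->
  (forall b y, O b -> T y -> T (rho (n_ b) y)) -> O b -> T x ->
  branch T (rho (n_ b * al)%g x).
Proof.
move=> Ts TN Ob Tx; have [b' Ob' ->] := up_al_child Ob.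
by rewrite repM; apply: branch_single => //; apply: TN.
Qed.

(** With [S] attached to the origin and its translates to the other vertices:
    the span over the vertices of the half-tree at distance at most [n] from
    the origin. *)
Fixpoint layer S n : set U :=
  if n is n'.+1 then addS S (branch (layer S n')) else S.

Lemma layer_subspace S n : subspace S -> subspace (layer S n).
Proof.
by move=> Ss; elim: n => //= n IH; apply: addS_subspace => //; apply: branch_subspace.
Qed.

Lemma layer_incr S n : subspace S -> layer S n `<=` layer S n.+1.
Proof.
move=> Ss; elim: n => [|n IH] /=.
  exact: addSl (branch_subspace Ss).
move=> _ [x Sx [y /(branchS IH) By <-]]; exists x => //; exists y => //.
Qed.

Lemma layer_le S m n : subspace S -> (m <= n)%N -> layer S m `<=` layer S n.
Proof.
move=> Ss /subnK <-; elim: (n - m)%N => // j IH; apply: subset_trans IH _.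
exact: layer_incr.
Qed.

Lemma layer_base S n : subspace S -> S `<=` layer S n.
Proof. by move=> Ss; apply: (@layer_le S 0 n Ss). Qed.

Lemma layer_child S n i x : subspace S -> layer S n x ->
  layer S n.+1 (rho (child i) x).
Proof.
move=> Ss Sx; apply: (addSr Ss); apply: branch_single => //.
exact: layer_subspace.
Qed.

(** For the representation pi this is the space I^+ defined from [S], and
    [opp_halfspan] is I^-. Both are also needed for functions on G, in order
    to lift to compact inductions. *)
Definition halfspan S := gen rho (@Pplus p F) S.
Definition opp_halfspan S : set U := [set rho Pi x | x in halfspan S].

Lemma halfspan_subspace S : subspace (halfspan S). Proof. exact: gen_subspace. Qed.
Lemma opp_halfspan_subspace S : subspace (opp_halfspan S).
Proof. exact: im_rep_subspace (halfspan_subspace S). Qed.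

Lemma halfspan_self S : S `<=` halfspan S.
Proof. by apply: gen_self; apply: Pplus1. Qed.

Lemma halfspan_Pplus S q x : Pplus q -> halfspan S x -> halfspan S (rho q x).
Proof.
move=> Pq; apply: (@gen_act _ _ _ _ rho (@Pplus p F) (@Pplus p F)).
- by move=> h; apply: PplusM.
- exact: halfspan_subspace.
- by move=> h y; apply: gen_inc.
Qed.

Lemma halfspan_child S i x : halfspan S x -> halfspan S (rho (child i) x).
Proof. by apply/halfspan_Pplus/Pplus_up_al => //; apply: res_int. Qed.

Section KZstable.
Variables (S : set U) (S_KZ : subrep rho KZ S).
Let Ss : subspace S := S_KZ.1.
Let SK g x : KZ g -> S x -> S (rho g x) := @proj2 _ _ S_KZ g x.
Local Notation L := (layer S).

Lemma layer_up n b x : O b -> L n x -> L n (rho (n_ b) x).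
Proof.
elim: n b x => [|n IH] b x Ob /=; first by apply/SK/up_KZ.
move=> [s Ss' [_ [f Lf <-] <-]]; rewrite rhoD rho_sum.
apply: subD; first exact: (@layer_subspace S n.+1 Ss).
  by apply: (addSl (branch_subspace (@layer_subspace S n Ss))); apply/SK/Ss'/up_KZ.
apply: (addSr Ss); apply: sub_sum; first exact/branch_subspace/layer_subspace.
move=> i _; rewrite -repM /child mulgA upM; apply: branch_up_al => //.
- exact: layer_subspace.
- exact: (integralD Ob (res_int i)).
Qed.

Lemma layer_up_al n b x : O b -> L n x -> L n.+1 (rho (n_ b * al)%g x).
Proof.
move=> Ob Lx; have [b' Ob' ->] := up_al_child Ob; rewrite repM.
by apply: layer_child => //; apply: layer_up.
Qed.

Lemma layer_al n x : L n x -> L n.+1 (rho al x).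
Proof.
by move=> Lx; have := layer_up_al integral_elt0 Lx; rewrite up0 mul1g.
Qed.

Lemma layer_scalar n z x : z != 0 -> L n x -> L n (rho (dg z z) x).
Proof.
move=> z0; elim: n x => [|n IH] x /=; first exact/SK/scalar_KZ.
move=> [s Ss' [_ [f Lf <-] <-]]; rewrite rhoD rho_sum.
exists (rho (dg z z) s); first by apply/SK/Ss'/scalar_KZ.
eexists; last reflexivity; exists (fun i => rho (dg z z) (f i)).
  by move=> i; apply: IH.
by apply: eq_bigr => i _; rewrite -!repM center_scalar.
Qed.

Lemma layer_halfspan n : L n `<=` halfspan S.
Proof.
elim: n => [|n IH] /=; first exact: halfspan_self.
apply: addS_min (halfspan_subspace _) (@halfspan_self S) _.
by apply: branch_min (halfspan_subspace _) _ => i x /IH; apply: halfspan_child.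
Qed.

(** Each element of P^+ is a product n_b al^n t with t in the torus over O,
    which stabilizes [S]. *)
Lemma halfspan_layer : halfspan S = \bigcup_n L n.
Proof.
have Usub : subspace (\bigcup_n L n).
  split; first by exists 0%N => //; apply: sub0.
  move=> a x y [m _ Lx] [n _ Ly]; exists (maxn m n) => //.
  apply: (layer_subspace _ Ss).2.
    exact: (layer_le Ss (leq_maxl _ _) Lx).
  exact: (layer_le Ss (leq_maxr _ _) Ly).
apply/seteqP; split=> [|x [n _ /layer_halfspan]] //.
apply: gen_min => // q x /(Pplus_factor varpi_unif)[n [b [u [Ob uu ->]]]] Sx.
exists n => //; rewrite !repM; apply: layer_up => //.
have {}Sx : S (rho (dg u 1) x) by apply: SK => //; apply: dg_KZ => //; apply: vunit1.
move: (rho _ x) Sx => {}x Sx; elim: n => [|n IH]; first by rewrite expg0 rep1.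
by rewrite expgS repM; apply: layer_al.
Qed.

Lemma halfspan_PKZ g x : PKZ g -> S x -> halfspan S (rho g x).
Proof. by move=> [q Pq [h Kh <-]] Sx; rewrite repM; apply: gen_inc => //; apply: SK. Qed.

Lemma halfspan_stable g x : (forall q, Pplus q -> PKZ (g * q)%g) ->
  halfspan S x -> halfspan S (rho g x).
Proof.
move=> gP; apply: (@gen_act _ _ _ _ rho (@Pplus p F) (@PKZ p F)) => //.
  exact: halfspan_subspace.
by move=> h y; apply: halfspan_PKZ.
Qed.

Lemma halfspan_lw c x : valge 1 c -> halfspan S x -> halfspan S (rho (lw c) x).
Proof. by move=> c1; apply: halfspan_stable => q; apply: lw_Pplus. Qed.

Lemma halfspan_scalar z x : z != 0 -> halfspan S x -> halfspan S (rho (dg z z) x).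
Proof.
by move=> z0; rewrite halfspan_layer => -[n _ Lx]; exists n => //; apply: layer_scalar.
Qed.

Lemma opp_halfspan_Pi x : opp_halfspan S (rho Pi x) <-> halfspan S x.
Proof.
split=> [[y Py /(congr1 (rho (Pi^-1)%g))]|Px]; last by exists x.
by rewrite !repK => <-.
Qed.

Lemma opp_halfspan_PiV x : opp_halfspan S x <-> halfspan S (rho (Pi^-1)%g x).
Proof. by rewrite -opp_halfspan_Pi repVK. Qed.

Lemma rho_Pi2 x : rho Pi (rho Pi x) = rho (dg varpi varpi) x.
Proof. by rewrite -repM (Pi2 varpi_unif). Qed.

Lemma opp_halfspan_halfspan_Pi x : opp_halfspan S x -> halfspan S (rho Pi x).
Proof.
by move=> [y Py <-]; rewrite rho_Pi2; apply: halfspan_scalar => //; apply: varpi_neq0.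
Qed.

(** Each vertex belongs to one of the two half-trees of an edge. *)
Lemma gen_halves : gen rho [set: G] S = addS (halfspan S) (opp_halfspan S).
Proof.
apply/seteqP; split.
  apply: gen_min; first exact/addS_subspace/opp_halfspan_subspace/halfspan_subspace.
  move=> g x _ Sx; have [gP|gP] := PKZ_cover varpi_unif g.
    by apply: (addSl (opp_halfspan_subspace S)); apply: halfspan_PKZ.
  by apply: (addSr (halfspan_subspace S)); apply/opp_halfspan_PiV; rewrite -repM; apply: halfspan_PKZ.
have gs := gen_subspace rho [set: G] S.
apply: addS_min => //; first by apply: gen_min => // g x _; apply: gen_inc.
move=> _ [x Px <-]; apply: (@gen_act _ _ _ _ rho (@Pplus p F) [set: G] S) Px => //.
by move=> h y _; apply: gen_inc.
Qed.

(** Seen from the i-th child, the origin and all the other branches are on the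
    opposite side, so that the i-th component is also a sum over that side. *)
Lemma branch_components (f : residue -> U) :
  (forall i, halfspan S (f i)) -> S (\sum_i rho (child i) (f i)) ->
  forall i, halfspan S (f i) /\ opp_halfspan S (f i).
Proof.
move=> Pf Sf i; split=> //; apply/opp_halfspan_PiV.
set t := \sum_i _ in Sf.
have -> : f i = rho ((child i)^-1)%g t
    - \sum_(j | j != i) rho ((child i)^-1 * child j)%g (f j).
  rewrite /t (bigD1 i) //= rhoD repK rho_sum -addrA -sumrB big1 ?addr0 // => j _.
  by rewrite -repM subrr.
have al0 := varpi_neq0 varpi_unif.
rewrite rhoB rho_sum; apply: subB; first exact: halfspan_subspace.
  apply: halfspan_self; rewrite -repM; apply: SK => //.
  rewrite /child invgM mulgA; apply: KZM; last by apply/KZV/up_KZ/res_int.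
  rewrite -(wwPi varpi_unif) invgM mulgA; apply: KZM; last exact/KZV/ww_KZ.
  by rewrite -invgM (Pi2 varpi_unif); apply/KZV/scalar_KZ.
apply: sub_sum; first exact: halfspan_subspace.
move=> j ji; rewrite -repM; apply: halfspan_stable => // q Pq.
have -> : ((child i)^-1 * child j = al^-1 * (n_ (res_elt j - res_elt i) * al))%g.
  rewrite /child invgM -!mulgA; congr (_ * _)%g.
  by rewrite upV mulgA upM addrC.
apply: (opposite_branch varpi_unif) => //.
have Oji : O (res_elt j - res_elt i) by apply: integralB; apply: res_int.
by have [//|/res_inj ji'] := orP (vunitP Oji); rewrite ji' eqxx in ji.
Qed.

(** The span over the vertices at distance at most [n] from the origin in all
    directions. It is built from neighbours, which makes it stable under KZ.
    *)
Fixpoint ball n : set U :=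
  if n is n'.+1 then gen rho KZ (ball n' `|` [set rho al x | x in ball n'])
  else S.

Lemma ball_subrep n : subrep rho KZ (ball n).
Proof. by case: n => //= n; apply/gen_subrep/KZ_subgroup. Qed.

Lemma ball_subspace n : subspace (ball n).
Proof. exact: (ball_subrep n).1. Qed.

Lemma ball_KZ n g x : KZ g -> ball n x -> ball n (rho g x).
Proof. exact: (ball_subrep n).2. Qed.

Lemma ball_incr n : ball n `<=` ball n.+1.
Proof. by move=> x Bx; apply: gen_self (KZ1) _ _; left. Qed.

Lemma ball_le m n : (m <= n)%N -> ball m `<=` ball n.
Proof.
move=> /subnK <-; elim: (n - m)%N => // j IH; apply: subset_trans IH _.
exact: ball_incr.
Qed.

Lemma ball_al n x : ball n x -> ball n.+1 (rho al x).
Proof. by move=> Bx; apply: gen_self (KZ1) _ _; right; exists x. Qed.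

Lemma ball_child n i x : ball n x -> ball n.+1 (rho (child i) x).
Proof.
by move=> Bx; rewrite repM; apply: ball_KZ (ball_al Bx); apply/up_KZ/res_int.
Qed.

Lemma ball_Pi n x : ball n x -> ball n.+1 (rho Pi x).
Proof.
by move=> Bx; rewrite -(wwal varpi_unif) repM; apply: ball_KZ (ball_al Bx); apply: ww_KZ.
Qed.

Lemma layer_ball n : L n `<=` ball n.
Proof.
elim: n => // n IH; apply: addS_min; first exact: ball_subspace.
  exact: (@ball_le 0 n.+1).
by apply: branch_min (ball_subspace _) _ => i x /IH; apply: ball_child.
Qed.

Lemma rho_al_Pi x : rho al (rho Pi x) = rho ww (rho (dg varpi varpi) x).
Proof. by rewrite -!repM (alPi varpi_unif). Qed.

(** The edge between the origin and [Pi] cuts a ball into a ball in each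
    half-tree, of radius smaller by one on the far side. *)
Lemma ball_halves n : ball n.+1 = addS (L n.+1) [set rho Pi x | x in L n].
Proof.
have Ls m := @layer_subspace S m Ss.
have PLs m := im_rep_subspace rho Pi (Ls m).
apply/seteqP; split; last first.
  apply: addS_min; [exact: ball_subspace | exact: layer_ball |].
  by move=> _ [x /layer_ball Bx <-]; apply: ball_Pi.
elim: n => [|n IH].
  apply: gen_min; first exact: addS_subspace.
  move=> g x Kg [Sx|[y Sy <-]].
    by apply: addSl => //; apply: (@layer_base S 1 Ss); apply: SK.
  rewrite -repM; have [[i [h Kh ->]]|[h Kh ->]] := KZ_al varpi_unif Kg; rewrite repM.
    by apply: addSl => //; apply: layer_child => //; apply: SK.
  by apply: addSr => //; exists (rho h y) => //; apply: SK.
have IH' x : ball n.+1 x -> addS (L n.+2) [set rho Pi x | x in L n.+1] x.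
  move=> /IH[y Ly [_ [z Lz <-] <-]]; exists y; first exact: layer_incr.
  by exists (rho Pi z) => //; exists z => //; apply: layer_incr.
have As : subspace (addS (L n.+2) [set rho Pi x | x in L n.+1]) by apply: addS_subspace.
apply: gen_min => // g x Kg [Bx|[y By <-]]; first by apply: IH'; apply: ball_KZ.
have al0 := varpi_neq0 varpi_unif.
rewrite -repM; have [[i [h Kh ->]]|[h Kh ->]] := KZ_al varpi_unif Kg.
  rewrite repM; have /IH[y1 Ly1 [_ [y2 Ly2 <-] <-]] := @ball_KZ n.+1 h y Kh By.
  rewrite rhoD; apply: subD => //.
    by apply: addSl => //; apply: layer_child.
  apply: IH'; apply: ball_incr; rewrite repM rho_al_Pi.
  apply: ball_KZ; first by apply/up_KZ/res_int.
  apply: ball_KZ; first exact: ww_KZ.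
  by apply: layer_ball; apply: layer_scalar.
rewrite repM; have /IH[y1 Ly1 [_ [y2 Ly2 <-] <-]] := @ball_KZ n.+1 h y Kh By.
rewrite rhoD; apply: subD => //; first by apply: addSr => //; exists y1.
apply: addSl => //; rewrite rho_Pi2; apply: layer_scalar => //.
by apply: (layer_le Ss _ Ly2); lia.
Qed.

Lemma ball_half n x : ball n x ->
  exists2 y, L n y & x = y \/ exists2 z, L n.-1 z & x = y + rho Pi z.
Proof.
case: n => [|n]; first by exists x; [|left].
rewrite ball_halves => -[y Ly [_ [z Lz <-] <-]]; exists y => //.
by right; exists z.
Qed.

Lemma gen_ball : gen rho [set: G] S = \bigcup_n ball n.
Proof.
apply/seteqP; split.
  rewrite gen_halves halfspan_layer => _ [x [m _ Lx] [_ [y + <-] <-]].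
  rewrite halfspan_layer => -[n _ Ly]; exists (maxn m n.+1) => //.
  apply: subD; first exact: ball_subspace.
    exact: (ball_le (leq_maxl _ _) (layer_ball Lx)).
  exact: (ball_le (leq_maxr _ _) (ball_Pi (layer_ball Ly))).
move=> x [n _]; elim: n x => [|n IH] x; first exact: (@gen_self _ _ _ _ rho [set: G] S).
apply: gen_min; first exact: gen_subspace.
have gs := (gen_subrep rho S (@setT_subgroup p F)).2.
by move=> g y _ [/IH|[z /IH gz <-]]; last rewrite -repM; apply: gs.
Qed.

(** Balls centred in the half-tree leave it only within the ball around the
    origin. *)
Lemma halfspan_ball n : halfspan (ball n) `<=` addS (halfspan S) (ball n).
Proof.
have Ps := halfspan_subspace S; have Bs := ball_subspace n.
have Zs := addS_subspace Ps Bs.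
apply: gen_min => // q x /(Pplus_factor varpi_unif)[j [b [u [Ob uu ->]]]] Bx.
rewrite !repM; set y := rho _ (rho _ x).
suff [y1 Py1 [y2 By2 ->]] : exists2 y1, halfspan S y1 & exists2 y2, ball n y2 & y = y1 + y2.
  rewrite rhoD; exists (rho (n_ b) y1); first by apply: halfspan_Pplus => //; apply: Pplus_up.
  by exists (rho (n_ b) y2) => //; apply: ball_KZ => //; apply: up_KZ.
rewrite {}/y; have {}Bx : ball n (rho (dg u 1) x).
  by apply: ball_KZ => //; apply: dg_KZ => //; apply: vunit1.
move: (rho _ x) Bx => {}x Bx; elim: j => [|j [y1 Py1 [y2 By2 E]]].
  by exists 0; [exact: sub0 | exists x; rewrite // expg0 rep1 add0r].
rewrite expgS repM E rhoD.
have Pal z : halfspan S z -> halfspan S (rho al z).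
  by apply: halfspan_Pplus; rewrite -[al]mul1g -up0; apply/(Pplus_up_al varpi_unif)/integral_elt0.
have [y3 Ly3 [->|[z Lz ->]]] := ball_half By2.
  exists (rho al y1 + rho al y3); last by exists 0; [exact: sub0 | rewrite addr0].
  by apply: subD => //; apply: Pal => //; apply: layer_halfspan Ly3.
exists (rho al y1 + rho al y3).
  by apply: subD => //; apply: Pal => //; apply: layer_halfspan Ly3.
exists (rho al (rho Pi z)); last by rewrite rhoD addrA.
rewrite rho_al_Pi; apply: ball_KZ; first exact: ww_KZ.
apply: ball_KZ; first exact/scalar_KZ/varpi_neq0.
by apply: (@ball_le n.-1); [exact: leq_pred | exact: layer_ball].
Qed.

Lemma layer_fin_dim n : fin_dim S -> fin_dim (L n).
Proof.
move=> fdS; elim: n => //= n IH; apply: fin_dimD => //.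
have Ls := layer_subspace n Ss.
pose T r := [set x | exists2 f : residue -> U, (forall i, L n (f i)) &
    x = \sum_(i <- r) rho (child i) (f i)].
have Ts r : subspace (T r).
  split; first by exists (fun=> 0) => [j|]; rewrite ?big1 // => *;
    [exact: sub0 | rewrite rho0].
  move=> a _ _ [f Tf ->] [g Tg ->]; exists (fun i => a *: f i + g i).
    by move=> j; apply: Ls.2.
  by rewrite scaler_sumr -big_split; apply: eq_bigr => j _ /=; rewrite rhoD rhoZ.
have bE r : fin_dim (T r).
  elim: r => [|i r IHr].
    by apply: (fin_dim_sub (Ts _) _ (@fin_dim0 _ _)) => x [f _]; rewrite big_nil.
  apply: (fin_dim_sub (Ts _) _ (fin_dimD (fin_dim_im (rep_linear rho (child i)) IH) IHr)).
  move=> x [f Lf ->]; rewrite big_cons; exists (rho (child i) (f i)); first by exists (f i).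
  by exists (\sum_(j <- r) rho (child j) (f j)) => //; exists f.
have := bE (index_enum residue); congr fin_dim.
by apply/seteqP; split=> x [f Lf xE]; exists f.
Qed.

Lemma ball_fin_dim n : fin_dim S -> fin_dim (ball n).
Proof.
case: n => // n fdS; rewrite ball_halves; apply: fin_dimD; first exact: layer_fin_dim.
exact/fin_dim_im/layer_fin_dim/fdS/rep_linear.
Qed.

End KZstable.

End HalfTrees.

(** * Congruence subgroups and the topology of the group *)

Section Congruence.
Context {p : nat} {F : localField p}.
Local Notation G := (GL2 F).
Local Notation O := (@integral_elt p F).
Implicit Types (g h : G) (x y : F).

Lemma GL2_mulE g h i j : (g * h)%g i j = \sum_l g i l * h l j.
Proof. by rewrite mxE. Qed.

Definition cong (n : int) : set G :=
  [set g | forall i j, valge n (g i j - (1%g : G) i j)].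

Lemma GL2_1E : [/\ (1%g : G) 0 0 = 1, (1%g : G) 0 1 = 0, (1%g : G) 1 0 = 0
  & (1%g : G) 1 1 = 1].
Proof. by rewrite -mx22_1; apply: mx22_entries; nz. Qed.

Lemma cong_mx22 n a b c d : a * d - b * c != 0 ->
  cong n (mx22 a b c d) <->
  [/\ valge n (a - 1), valge n b, valge n c & valge n (d - 1)].
Proof.
move=> t0; have [e1 e2 e3 e4] := mx22_entries t0; have [f1 f2 f3 f4] := GL2_1E.
split=> [cg|[h1 h2 h3 h4]].
  move: (cg 0 0) (cg 0 1) (cg 1 0) (cg 1 1).
  by rewrite e1 e2 e3 e4 f1 f2 f3 f4 !subr0.
by apply: forall_ord2; rewrite ?e1 ?e2 ?e3 ?e4 ?f1 ?f2 ?f3 ?f4 ?subr0.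
Qed.

Lemma cong_le m n g : m <= n -> cong n g -> cong m g.
Proof. by move=> mn cg i j; apply: valge_le mn (cg i j). Qed.

Lemma cong_KZ n g : 1 <= n -> cong n g -> KZ g.
Proof.
move=> n1 /(cong_le n1); have [a [b [c [d [t0 ->]]]]] := mx22P g.
move=> /(cong_mx22 _ t0)[a1 b1 c1 d1].
have Oa : O a by rewrite -(subrK 1 a); apply: integralD (valge1_int a1) integral_elt1.
have Od : O d by rewrite -(subrK 1 d); apply: integralD (valge1_int d1) integral_elt1.
apply: KZ_mx22 => //; try exact: valge1_int.
apply: (vunit_cong vunit1).
have -> : a * d - b * c - 1 = (a - 1) * d + (d - 1) - b * c by ring.
apply: valgeB; first by apply: valgeD => //; apply: valgeMr.
by apply: valgeMr => //; apply: valge1_int.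
Qed.

Lemma valge_exists x : exists n : nat, valge (- n%:Z) x.
Proof.
have [->|x0] := eqVneq x 0; first by exists 0%N; apply: valge0.
by exists `|valn x|%N; rewrite valgeE //; lia.
Qed.

Lemma cong_near g (m : int) : exists n : int, forall h,
  (forall i j, valge n (h i j - g i j)) -> cong m (h * g^-1)%g.
Proof.
have [N NP] : exists N : nat, forall i j, valge (- N%:Z) ((g^-1)%g i j).
  have [a aP] := valge_exists ((g^-1)%g 0 0); have [b bP] := valge_exists ((g^-1)%g 0 1).
  have [c cP] := valge_exists ((g^-1)%g 1 0); have [d dP] := valge_exists ((g^-1)%g 1 1).
  exists (a + b + c + d)%N.
  by apply: forall_ord2; [move: aP|move: bP|move: cP|move: dP]; apply: valge_le; lia.
exists (m + N%:Z) => h hP i j.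
have -> : (h * g^-1)%g i j - (1%g : G) i j = \sum_l (h i l - g i l) * (g^-1)%g l j.
  have -> : (1%g : G) = (g * g^-1)%g by rewrite mulgV.
  by rewrite !GL2_mulE -sumrB; apply: eq_bigr => l _; rewrite mulrBl.
elim/big_ind: _ => [|*|l _]; [exact: valge0 | exact: valgeD |].
have -> : m = m + N%:Z + - N%:Z by rewrite addrK.
exact: valgeM.
Qed.

Lemma congM m g h : 0 <= m -> cong m g -> cong m h -> cong m (g * h)%g.
Proof.
move=> m0 cg ch i j.
have Oh l : O (h l j).
  rewrite -(subrK ((1%g : G) l j) (h l j)); apply: integralD.
    exact: valge_int m0 (ch l j).
  have [f1 f2 f3 f4] := GL2_1E.
  by move: l j {ch}; apply: forall_ord2;
     rewrite ?f1 ?f2 ?f3 ?f4 ?integral_elt0 ?integral_elt1.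
have -> : (g * h)%g i j - (1%g : G) i j =
    \sum_l (g i l - (1%g : G) i l) * h l j + (h i j - (1%g : G) i j).
  rewrite addrA; congr (_ - _).
  have -> : h i j = (1%g * h)%g i j by rewrite mul1g.
  by rewrite !GL2_mulE -big_split; apply: eq_bigr => l _; rewrite /= mulrBl subrK.
apply: valgeD => //; elim/big_ind: _ => [|*|l _]; [exact: valge0 | exact: valgeD |].
exact: valgeMr.
Qed.

Lemma GL2_openP (P : set G) :
  (forall g, P g -> exists2 m, 0 <= m & forall u, cong m u -> P (u * g)%g) -> open P.
Proof.
move=> oP; suff : GL2_open P by [].
move=> g Pg; have [m _ mP] := oP g Pg; have [n nP] := cong_near g m.
by exists n => h /nP/mP; rewrite mulgVK.
Qed.

Lemma nbhs_cong (P : set G) g m : 0 <= m ->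
  (forall u, cong m u -> P (u * g)%g) -> \forall h \near g, P h.
Proof.
move=> m0 mP; suff : nbhs g P by [].
rewrite nbhsE; exists [set h | cong m (h * g^-1)%g]; first split.
- apply: GL2_openP => h hP; exists m => // u uP /=.
  by rewrite -mulgA; apply: congM.
- by rewrite /= mulgV => i j; rewrite subrr valge0.
- by move=> h /mP; rewrite mulgVK.
Qed.

Lemma open_cong (H : set G) : open H -> H 1%g -> exists2 n : nat, (0 < n)%N & cong n `<=` H.
Proof.
move=> oH; have {}oH : GL2_open H := oH.
move=> /oH[n nH]; exists (maxn 1 `|n|); first by rewrite leq_max.
by move=> g cg; apply: nH => i j; apply: valge_le (cg i j); lia.
Qed.

Lemma KZcoset_open g : open (@KZcoset p F g).
Proof.
apply: GL2_openP => h [h' Kh' <-]; exists 1 => // u cu.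
by exists (u * h')%g; rewrite ?mulgA //; apply: KZM => //; apply: cong_KZ cu.
Qed.

Lemma KZcosetP g h : KZcoset g h <-> KZ (h * g^-1)%g.
Proof.
split=> [[u Ku <-]|Khg]; first by rewrite mulgK.
by exists (h * g^-1)%g => //; rewrite mulgVK.
Qed.

Lemma KZcoset_eq g h : KZcoset g h -> KZcoset g = KZcoset h.
Proof.
move=> [u Ku <-]; apply/seteqP; split=> x /KZcosetP Kx; apply/KZcosetP.
  by rewrite invgM mulgA; apply: KZM (KZV Ku).
have -> : (x * g^-1 = x * (u * g)^-1 * u)%g by rewrite invgM mulgA mulgVK.
exact: KZM.
Qed.

Lemma KZcoset_self g : KZcoset g g.
Proof. by apply/KZcosetP; rewrite mulgV; apply: KZ1. Qed.

HB.instance Definition _ := isPointed.Build G (1%g : G).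

(** The cosets are open, so finitely many of them cover a compact set. *)
Lemma compact_KZcosets (C : set G) : compact C ->
  exists s : seq G, forall g c, C c -> KZcoset c g -> exists2 x, x \in s & KZcoset x g.
Proof.
move=> cptC; have : cover_compact C by rewrite -compact_cover.
move=> /(_ _ C (@KZcoset p F)) cC.
have [//|x Cx|D _ CD] := cC; first by move=> i _; apply: KZcoset_open.
  by exists x => //; apply: KZcoset_self.
exists (finmap.enum_fset D) => g c /CD[x /= xD /KZcoset_eq <-] xg; by exists x.
Qed.

End Congruence.

(** * Compact induction *)

Section CompactInduction.
Context {p : nat} {F : localField p} {k : fieldType} {V : lmodType k}.
Local Notation G := (GL2 F).
Context (pi : rep G V) (pi_smooth : smooth pi).
Variables (W : set V) (W_KZ : subrep pi KZ W).
Let Ws : subspace W := W_KZ.1.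
Let WK g x : KZ g -> W x -> W (pi g x) := @proj2 _ _ W_KZ g x.
Local Notation rt := (@rtrans k G V).
Local Notation br := (bracket pi).

Lemma smooth_cong x : exists2 n : nat, (0 < n)%N & forall g, cong n g -> pi g x = x.
Proof.
have [H [[H1 _ _] oH Hx]] := pi_smooth x.
by have [n n0 nH] := open_cong oH H1; exists n => // g /nH/Hx.
Qed.

Lemma funZD a (f g : G -> V) x : (a *: f + g) x = a *: f x + g x.
Proof. by []. Qed.

Lemma bracketZD g a v w : br g (a *: v + w) = a *: br g v + br g w.
Proof.
apply/funext => x; rewrite funZD /bracket; case: asboolP => _ //.
  by rewrite (rep_linear pi).
by rewrite scaler0 addr0.
Qed.

Lemma rtrans_bracket g h w : rt g (br h w) = br (g * h)%g w.
Proof. by apply/funext => x; rewrite /= /rtrans_act /bracket mulgA. Qed.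

Lemma bracket_KZ g h w : KZ h -> br (g * h)%g w = br g (pi h w).
Proof.
move=> Kh; apply/funext => x; rewrite /bracket mulgA.
have -> : `[< KZ (x * g * h)%g >] = `[< KZ (x * g)%g >].
  apply/asboolP/asboolP => [Kx|Kx]; last exact: KZM.
  by rewrite -(mulgK h (x * g)%g); apply: KZM => //; apply: KZV.
by case: asboolP => // _; rewrite repM.
Qed.

Lemma bracket_cInd g w : W w -> cInd pi W (br g w).
Proof.
move=> Ww; split.
- by move=> x; rewrite /bracket; case: asboolP => [Kx|_]; [apply: WK | apply: sub0].
- move=> x; have [n n0 nP] := smooth_cong (br g w x).
  apply: (@nbhs_cong _ _ _ _ n) => // u cu; have Ku := cong_KZ (n := n) _ cu.
  rewrite -[RHS](nP _ cu) /bracket.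
  have -> : `[< KZ (u * x * g)%g >] = `[< KZ (x * g)%g >].
    apply/asboolP/asboolP => [Kx|Kx]; rewrite -mulgA in Kx *.
      by rewrite -(mulKg u (x * g)%g); apply: KZM => //; apply/KZV/Ku.
    by apply: KZM => //; apply: Ku.
  by case: asboolP => _; [rewrite -mulgA repM | rewrite rho0].
- exists [set (g^-1)%g]; first exact: compact_set1.
  move=> x; rewrite /bracket; case: asboolP => [Kx _|_]; last by rewrite eqxx.
  by exists (g^-1)%g => //; apply/KZcosetP; rewrite invgK.
- move=> h x Kh; rewrite /bracket.
  have -> : `[< KZ (h * x * g)%g >] = `[< KZ (x * g)%g >].
    apply/asboolP/asboolP => [Kx|Kx]; rewrite -mulgA in Kx *; last exact: KZM.
    by rewrite -(mulKg h (x * g)%g); apply: KZM => //; apply: KZV.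
  by case: asboolP => _; [rewrite -mulgA repM | rewrite rho0].
Qed.

Lemma cInd_subspace : subspace (cInd pi W).
Proof.
split.
  split.
  - by move=> g; apply: sub0.
  - by move=> g; apply: (@nbhs_cong _ _ _ _ 0).
  - by exists set0; [exact: compact0 | move=> g; rewrite eqxx].
  - by move=> h g Kh; rewrite rho0.
move=> a f g [fW fc [C cC fC] fK] [gW gc [D cD gD] gK]; split.
- by move=> x; apply: Ws.2.
- move=> x; have := fc x; have := gc x; apply: filterS2 => y.
  by rewrite !funZD => -> ->.
- exists (C `|` D); first exact: compactU.
  move=> x; rewrite funZD => nz0.
  have [f0|/fC[c Cc cx]] := eqVneq (f x) 0; last by exists c => //; left.
  have [g0|/gD[c Cc cx]] := eqVneq (g x) 0; last by exists c => //; right.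
  by move: nz0; rewrite f0 g0 scaler0 addr0 eqxx.
- by move=> h x Kh; rewrite !funZD fK // gK // (rep_linear pi).
Qed.

Lemma cInd_support f : cInd pi W f ->
  exists s : seq G, forall g, f g != 0 -> exists2 x, x \in s & KZcoset x g.
Proof.
move=> [_ _ [C /compact_KZcosets[s sP] fC] _]; exists s => g /fC[c Cc].
exact: sP.
Qed.

Definition brackets : set (G -> V) := [set br 1%g w | w in W].

Lemma brackets_KZ : subrep rt KZ brackets.
Proof.
split; first split.
- exists 0; first exact: sub0.
  by apply/funext => x; rewrite /bracket rho0; case: asboolP.
- move=> a _ _ [v Wv <-] [w Ww <-]; exists (a *: v + w); first exact: Ws.2.
  exact: bracketZD.
- move=> g _ Kg [w Ww <-]; exists (pi g w); first exact: WK.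
  by rewrite -bracket_KZ // rtrans_bracket mulg1 mul1g.
Qed.

(** Subtracting from a function the bracket that has the same value at a
    representative removes one coset from its support. *)
Lemma cInd_gen : cInd pi W = gen rt [set: G] brackets.
Proof.
apply/seteqP; split; last first.
  apply: gen_min; first exact: cInd_subspace.
  by move=> g _ _ [w Ww <-]; rewrite rtrans_bracket mulg1; apply: bracket_cInd.
move=> f cf; have [s sP] := cInd_support cf.
elim: s f cf sP => [|c s IH] f cf sP.
  suff -> : f = 0 by apply: sub0; apply: gen_subspace.
  by apply/funext => x; apply/eqP; apply: contraT => /sP[].
have [fW _ _ fK] := cf; pose b := br (c^-1)%g (f c).
have gb : gen rt [set: G] brackets b.
  rewrite /b -[(c^-1)%g]mulg1 -rtrans_bracket; apply: gen_inc => //.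
  by exists (f c).
rewrite -(subrK b f); apply: subD => //; first exact: gen_subspace.
apply: IH; first by apply: subB; [exact: cInd_subspace | | exact: bracket_cInd].
move=> g; rewrite -[f - b]/(f + - b) -scaleN1r addrC funZD /b /bracket; case: asboolP => [Kg|nKg].
  have -> : f g = pi (g * c^-1)%g (f c) by rewrite -fK // mulgVK.
  by rewrite scaleN1r addNr eqxx.
rewrite scaler0 add0r => /sP[x]; rewrite inE => /orP[/eqP->|xs] xg; last by exists x.
by case: nKg; apply/KZcosetP.
Qed.

Lemma rtrans_cInd g f : cInd pi W f -> cInd pi W (rt g f).
Proof.
by rewrite cInd_gen; apply: (gen_subrep rt brackets (@setT_subgroup p F)).2.
Qed.

Let term (f : G -> V) (C : set G) : V := pi ((xget 1%g C)^-1)%g (f (xget 1%g C)).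

(** Every finite set of cosets that covers the support computes the sum, which
    makes it additive. *)
Local Lemma pres_map_finite f (s : seq G) :
  (forall g, f g != 0 -> exists2 x, x \in s & KZcoset x g) ->
  pres_map pi f = \sum_(C <- finmap.enum_fset (fset_set [set KZcoset x | x in [set` s]])) term f C.
Proof.
move=> sP; have fA : finite_set [set @KZcoset p F x | x in [set` s]].
  exact/finite_image/finite_seq.
rewrite -fsbig_finite // /pres_map; apply/esym/fsbig_widen.
  by move=> _ [x _ <-]; exists x.
move=> _ [[y _ <-] /= nA]; apply/eqP/contraT => t0.
have f0 : f (xget 1%g (KZcoset y)) != 0.
  by apply: contraNneq t0 => f0; rewrite /term f0 rho0.
have [x xs xg] := sP _ f0; case: nA; exists x => //.
have yg : KZcoset y (xget 1%g (KZcoset y)).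
  by apply: xgetPex; exists y; apply: KZcoset_self.
exact: etrans (KZcoset_eq xg) (esym (KZcoset_eq yg)).
Qed.

Lemma pres_map_linear a f g : cInd pi W f -> cInd pi W g ->
  pres_map pi (a *: f + g) = a *: pres_map pi f + pres_map pi g.
Proof.
move=> /cInd_support[s sP] /cInd_support[t tP].
have sP' h : f h != 0 -> exists2 x, x \in s ++ t & KZcoset x h.
  by move=> /sP[x xs xh]; exists x; rewrite ?mem_cat ?xs.
have tP' h : g h != 0 -> exists2 x, x \in s ++ t & KZcoset x h.
  by move=> /tP[x xs xh]; exists x; rewrite ?mem_cat ?xs ?orbT.
rewrite (pres_map_finite sP') (pres_map_finite tP') (@pres_map_finite _ (s ++ t)).
  rewrite scaler_sumr -big_split; apply: eq_bigr => C _ /=.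
  by rewrite /term funZD (rep_linear pi).
move=> h; rewrite funZD => nz0.
have [f0|/sP'] := eqVneq (f h) 0; last by [].
have [g0|/tP'] := eqVneq (g h) 0; last by [].
by move: nz0; rewrite f0 g0 scaler0 addr0 eqxx.
Qed.

Lemma pres_map0 : pres_map pi 0 = 0.
Proof.
have c0 := sub0 cInd_subspace.
by have := pres_map_linear (-1) c0 c0; rewrite !scaleN1r oppr0 addr0 addNr.
Qed.

Lemma pres_mapD f g : cInd pi W f -> cInd pi W g ->
  pres_map pi (f + g) = pres_map pi f + pres_map pi g.
Proof. by move=> cf cg; rewrite -[f]scale1r pres_map_linear // !scale1r. Qed.

Lemma pres_mapN f : cInd pi W f -> pres_map pi (- f) = - pres_map pi f.
Proof.
move=> cf; have := pres_map_linear (-1) cf (sub0 cInd_subspace).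
by rewrite pres_map0 !addr0 !scaleN1r.
Qed.

Lemma pres_mapB f g : cInd pi W f -> cInd pi W g ->
  pres_map pi (f - g) = pres_map pi f - pres_map pi g.
Proof.
move=> cf cg; rewrite pres_mapD //; last by apply: subN => //; apply: cInd_subspace.
by rewrite pres_mapN.
Qed.

Lemma pres_map_sum (I : Type) (r : seq I) (f : I -> G -> V) :
  (forall i, cInd pi W (f i)) ->
  pres_map pi (\sum_(i <- r) f i) = \sum_(i <- r) pres_map pi (f i).
Proof.
move=> cf; elim: r => [|i r IH]; first by rewrite !big_nil pres_map0.
rewrite !big_cons pres_mapD // ?IH //.
by apply: sub_sum => //; apply: cInd_subspace.
Qed.

Lemma pres_map_rtrans g f : cInd pi W f ->
  pres_map pi (rt g f) = pi g (pres_map pi f).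
Proof.
move=> cf; suff H : gen rt [set: G] brackets `<=`
    [set f | cInd pi W f /\ pres_map pi (rt g f) = pi g (pres_map pi f)].
  by have [|_ ->] := H f; rewrite -?cInd_gen.
apply: gen_min.
  split; first by split; [exact: sub0 cInd_subspace | rewrite pres_map0 rho0].
  move=> a f1 f2 [c1 e1] [c2 e2]; split; first exact: cInd_subspace.2.
  rewrite (rep_linear rt) !pres_map_linear //; try by apply: rtrans_cInd.
  by rewrite e1 e2 (rep_linear pi).
move=> h _ _ [w Ww <-]; rewrite !rtrans_bracket !mulg1; split; first exact: bracket_cInd.
by rewrite rtrans_bracket !pres_map_bracket repM.
Qed.

Lemma relations_subrep : subrep rt [set: G] (relations pi W).
Proof.
split; first split.
- by split; [exact: sub0 cInd_subspace | exact: pres_map0].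
- move=> a f g [cf f0] [cg g0]; split; first exact: cInd_subspace.2.
  by rewrite pres_map_linear // f0 g0 scaler0 addr0.
- move=> g f _ [cf f0]; split; first exact: rtrans_cInd.
  by rewrite pres_map_rtrans // f0 rho0.
Qed.

End CompactInduction.

(** * Standard presentations *)

Section EdgeClosed.
Context {p : nat} {F : localField p} (varpi : F) (varpi_unif : uniformizer varpi).
Context {k : fieldType} {V : lmodType k} (pi : rep (GL2 F) V).
Local Notation G := (GL2 F).
Local Notation al := (mx22 varpi 0 0 1).
Local Notation Pi := (mx22 0 1 varpi 0).
Implicit Types (S W : set V).

Lemma D1_subspace S : subspace (D1 varpi pi S).
Proof. by apply: subspaceI; [exact: halfspan_subspace | exact: opp_halfspan_subspace]. Qed.

Lemma D1_Pi S x : subrep pi KZ S -> D1 varpi pi S x -> D1 varpi pi S (pi Pi x).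
Proof.
by move=> SK [Px /(opp_halfspan_halfspan_Pi varpi_unif SK) Mx]; split=> //; apply/(opp_halfspan_Pi varpi pi S).
Qed.

Lemma D1_PiV S x : subrep pi KZ S -> D1 varpi pi S (pi Pi x) -> D1 varpi pi S x.
Proof.
move=> SK [/= Px Mx]; have {Mx} Qx : halfspan pi S x by apply/(opp_halfspan_Pi varpi pi S).
split=> //; apply/(opp_halfspan_PiV varpi pi S).
have v0 := varpi_neq0 varpi_unif.
rewrite (PiV varpi_unif) repM; apply: (halfspan_scalar varpi_unif SK) => //.
by rewrite invr_eq0.
Qed.

(** The space D_1 of an edge is then contained in the translates of [W]
    attached to its two ends, by stability under [Pi]. *)
Definition edge_closed W := D1 varpi pi W `<=` W.

Lemma edge_closed_al W x : subrep pi KZ W -> edge_closed W ->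
  D1 varpi pi W x -> W (pi al x).
Proof.
move=> WK eW /(D1_Pi WK)/eW Wx; rewrite -(wwPi varpi_unif) repM.
by apply: WK.2 => //; apply: ww_KZ.
Qed.

(** Enlarging [S] to a ball adds to each half-tree only vectors of a smaller
    ball on the other side of the edge. Moving these to the correct side, what
    is left of an element of D_1 of the ball is an element of D_1 of [S]. *)
Lemma ball_edge_closed S n : subrep pi KZ S ->
  D1 varpi pi S `<=` ball varpi pi S n.+1 -> edge_closed (ball varpi pi S n.+1).
Proof.
move=> SK D1B; have Ss := SK.1.
have Bs m := ball_subspace varpi SK m.
have half x : halfspan pi (ball varpi pi S n.+1) x ->
    exists2 y, halfspan pi S y & exists2 z, layer varpi pi S n z & x = y + pi Pi z.
  move=> /(halfspan_ball varpi_unif SK)[y Py [u + <-]].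
  rewrite (ball_halves varpi_unif SK) => -[v Lv [_ [z Lz <-] <-]].
  exists (y + v); last by exists z; rewrite ?addrA.
  by apply: subD (halfspan_subspace _ _) _ _ => //; apply: layer_halfspan Lv.
have LB := @layer_ball _ _ varpi _ _ pi S SK.
have scal m z c : c != 0 -> ball varpi pi S m z -> ball varpi pi S m (pi (dg c c) z).
  by move=> c0; apply: ball_KZ => //; apply: scalar_KZ.
move=> x [/half[y Py [z Lz xE]] [_ /half[y' Py' [z' Lz' ->]] xE']].
have v0 := varpi_neq0 varpi_unif.
pose t := pi (dg varpi varpi) z'.
have Lt : layer varpi pi S n t by apply: layer_scalar.
have tE : x = pi Pi y' + t by rewrite -xE' rhoD rho_Pi2.
have D : D1 varpi pi S (y - t).
  split; first by apply: subB (halfspan_subspace _ _) _ _ => //; apply: layer_halfspan Lt.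
  exists (y' - z); last first.
    rewrite rhoB; apply/eqP; rewrite subr_eq addrAC eq_sym subr_eq -xE.
    by rewrite tE addrC.
  by apply: subB (halfspan_subspace _ _) _ _ => //; apply: layer_halfspan Lz.
rewrite xE -(subrK t y); apply: subD (Bs _) _ _; last exact/ball_Pi/LB.
apply: subD (Bs _) _ _; first exact: D1B.
exact/ball_incr/LB.
Qed.

Section Presentation.
Context (pi_smooth : smooth pi).
Variables (W : set V) (W_KZ : subrep pi KZ W).
Let Ws : subspace W := W_KZ.1.
Let WK g x : KZ g -> W x -> W (pi g x) := @proj2 _ _ W_KZ g x.
Local Notation rt := (@rtrans k G V).
Local Notation br := (bracket pi).
Local Notation E := (brackets pi W).
Local Notation phi := (pres_map pi).
Let E_KZ : subrep rt KZ E := brackets_KZ W_KZ.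

Let cs : subspace (cInd pi W) := cInd_subspace W_KZ.

Lemma layer_cInd n f : layer varpi rt E n f -> cInd pi W f.
Proof.
move=> Lf; rewrite (cInd_gen pi_smooth W_KZ) (gen_ball varpi_unif E_KZ).
by exists n => //; apply: layer_ball.
Qed.

Lemma pres_map_layer n f : layer varpi rt E n f -> layer varpi pi W n (phi f).
Proof.
elim: n f => [|n IH] f /=; first by move=> [w Ww <-]; rewrite pres_map_bracket rep1.
move=> [_ [w Ww <-] [_ [g Lg <-] <-]].
have cg i : cInd pi W (rt (child varpi i) (g i)).
  by apply: rtrans_cInd => //; apply: layer_cInd (Lg i).
rewrite (@pres_mapD _ _ _ _ pi W) ?(pres_map_sum W_KZ) //; last 2 first.
- exact: bracket_cInd.
- exact: sub_sum.
rewrite pres_map_bracket rep1; exists w => //; eexists; last reflexivity.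
exists (fun i => phi (g i)); first by move=> i; apply: IH.
by apply: eq_bigr => i _; rewrite (pres_map_rtrans pi_smooth W_KZ) //; apply: layer_cInd (Lg i).
Qed.

Lemma pres_map_halfspan f : halfspan rt E f -> halfspan pi W (phi f).
Proof.
rewrite (halfspan_layer varpi_unif E_KZ) => -[n _ /pres_map_layer Ln].
exact: layer_halfspan Ln.
Qed.

Local Notation M := (gen rt [set: G] (standard_relations varpi pi W)).

Lemma standard_relationsE x : W x -> W (pi al x) ->
  standard_relations varpi pi W (br al x - br 1%g (pi al x)).
Proof.
move=> Wx Wax; exists x => //; split=> //; exists (pi al x) => //.
have v0 := varpi_neq0 varpi_unif.
by rewrite -repM dgM ?invr_eq0 ?oner_neq0 // mulVf // mul1r mx22_1 rep1.
Qed.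

Lemma standard_relations_al f : standard_relations varpi pi W f ->
  exists x, [/\ W x, W (pi al x) & f = br al x - br 1%g (pi al x)].
Proof.
move=> [x [Wx [y Wy xE]] <-]; exists x; split=> //; rewrite -xE -repM.
have v0 := varpi_neq0 varpi_unif.
by rewrite dgM ?invr_eq0 ?oner_neq0 // divff // mul1r mx22_1 rep1.
Qed.

Lemma standard_relations_sub : M `<=` relations pi W.
Proof.
have rs := relations_subrep pi_smooth W_KZ.
apply: gen_min; first exact: rs.1.
move=> g f _ /standard_relations_al[x [Wx Wax ->]]; apply: rs.2 => //.
have c1 := bracket_cInd pi_smooth W_KZ al Wx.
have c2 := bracket_cInd pi_smooth W_KZ 1%g Wax.
split; first by apply: subB.
by rewrite (pres_mapB W_KZ) // !pres_map_bracket rep1 subrr.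
Qed.

Lemma standard_edge g x : KZ g -> W x -> W (pi al x) ->
  M (br (g * al)%g x - br 1%g (pi (g * al)%g x)).
Proof.
move=> Kg Wx Wax.
have -> : br (g * al)%g x - br 1%g (pi (g * al)%g x) =
    rt g (br al x - br 1%g (pi al x)).
  by rewrite rhoB !rtrans_bracket repM -(bracket_KZ _ _ _ Kg) mul1g mulg1.
by apply: gen_inc => //; apply: standard_relationsE.
Qed.

(** Modulo the standard relations, an element supported on the half-tree whose
    image lies in [W] can be carried down to the origin: its components along
    the branches lie in the subspaces of the edges, and can be moved across
    them. *)
Lemma standard_reduction n f : edge_closed W -> layer varpi rt E n f ->
  W (phi f) -> M (f - br 1%g (phi f)).
Proof.
move=> eW; have Ms := gen_subspace rt [set: G] (standard_relations varpi pi W).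
elim: n f => [|n IH] f /=.
  by move=> [w Ww <-] _; rewrite pres_map_bracket rep1 subrr; apply: sub0.
move=> [_ [w Ww <-] [_ [g Lg <-] <-]].
have cg i : cInd pi W (g i) := layer_cInd (Lg i).
have crg i : cInd pi W (rt (child varpi i) (g i)) by apply: rtrans_cInd.
have cb := bracket_cInd pi_smooth W_KZ 1%g Ww.
pose y i := phi (g i).
rewrite (@pres_mapD _ _ _ _ pi W) ?(pres_map_sum W_KZ) //; last exact: sub_sum.
have -> : \sum_i phi (rt (child varpi i) (g i)) = \sum_i pi (child varpi i) (y i).
  by apply: eq_bigr => i _; rewrite (pres_map_rtrans pi_smooth W_KZ).
rewrite pres_map_bracket rep1 => Wsum.
have Wy : W (\sum_i pi (child varpi i) (y i)) by apply: sub_addl Wsum.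
have Py i : halfspan pi W (y i) by apply: layer_halfspan (pres_map_layer (Lg i)).
have Dy i : D1 varpi pi W (y i) := branch_components varpi_unif W_KZ Py Wy i.
have blin := bracketZD pi 1%g.
rewrite (linD blin) (lin_sum blin) opprD addrACA subrr add0r -sumrB; apply: sub_sum => // i _.
rewrite -(subrK (br (child varpi i) (y i)) (rt _ _)) -addrA; apply: subD => //; last first.
  apply: standard_edge; [apply/up_KZ/res_int | exact: eW | exact: edge_closed_al].
rewrite -[X in br X]mulg1 -rtrans_bracket -rhoB.
apply: (gen_subrep rt _ (@setT_subgroup p F)).2 => //.
exact: (IH _ (Lg i) (eW _ (Dy i))).
Qed.

(** The parts of a relation on the two half-trees have opposite images, which
    lie in D_1(W). Both parts are thus carried to the ends of the edge, where
    they cancel by a standard relation. *)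
Lemma edge_closed_standard : edge_closed W -> relations pi W = M.
Proof.
move=> eW; apply/seteqP; split; last exact: standard_relations_sub.
have Ms := gen_subspace rt [set: G] (standard_relations varpi pi W).
move=> f [cf]; have := cf; rewrite {1}(cInd_gen pi_smooth W_KZ).
rewrite (gen_halves varpi_unif E_KZ) => -[f1 Pf1 [_ [f2 Pf2 <-] <-]].
have := Pf1; have := Pf2; rewrite (halfspan_layer varpi_unif E_KZ) => -[m _ Lf2] [n _ Lf1].
have c1 := layer_cInd Lf1; have c2 := layer_cInd Lf2.
rewrite (@pres_mapD _ _ _ _ pi W) //; last exact: rtrans_cInd.
rewrite (pres_map_rtrans pi_smooth W_KZ) //; set y1 := phi f1; set y2 := phi f2.
move=> /eqP; rewrite addr_eq0 => /eqP y1E.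
have Py1 : halfspan pi W y1 := pres_map_halfspan Pf1; have Py2 : halfspan pi W y2 := pres_map_halfspan Pf2.
have Dy1 : D1 varpi pi W y1.
  by split=> //; rewrite y1E; apply: subN (opp_halfspan_subspace _ _ _) _; exists y2.
have Dy2 : D1 varpi pi W y2.
  apply: D1_PiV => //; rewrite -[pi _ _]opprK -y1E.
  exact: subN (D1_subspace _) _.
have M1 := standard_reduction eW Lf1 (eW _ Dy1).
have M2 := standard_reduction eW Lf2 (eW _ Dy2).
have M3 := standard_edge (ww_KZ) (eW _ Dy2) (edge_closed_al W_KZ eW Dy2).
rewrite (wwal varpi_unif) in M3.
have -> : f1 + rt Pi f2 = (f1 - br 1%g y1) + rt Pi (f2 - br 1%g y2)
    + (br Pi y2 - br 1%g (pi Pi y2)).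
  have -> : br 1%g (pi Pi y2) = - br 1%g y1.
    by rewrite -(linN (bracketZD pi 1%g)) y1E opprK.
  rewrite opprK rhoB rtrans_bracket mulg1 [X in _ = X + _]addrACA -opprD.
  by rewrite [br Pi y2 + _]addrC subrK.
apply: subD => //; apply: subD => //.
exact: (gen_subrep rt _ (@setT_subgroup p F)).2.
Qed.

Lemma standard_relations_fin_gen : fin_dim W -> fin_gen rt M.
Proof.
move=> fdW; pose r x := br al x - br 1%g (pi al x).
have r_lin : linear r.
  move=> a x y; rewrite /r (rep_linear pi) !bracketZD // scalerBr.
  by rewrite opprD addrACA.
have alW : subspace (W `&` [set x | W (pi al x)]).
  by apply: subspaceI => //; apply: (preim_rep_subspace pi al Ws).
have /fin_dimP[s sE] := fin_dim_sub alW (@subIsetl _ _ _) fdW.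
have sW x : x \in s -> W x /\ W (pi al x) by move=> xs; have := sp_mem xs; rewrite -sE.
exists (r @` [set` s]); first exact/finite_image/finite_seq.
apply/seteqP; split; last first.
  apply: (@gen_mono _ _ _ _ rt [set: G]) =>  _ [x /sW[Wx Wax] <-].
  exact: standard_relationsE.
have gs := gen_subspace rt [set: G] (r @` [set` s]).
apply: gen_min => // g f _ /standard_relations_al[x [Wx Wax ->]].
have : (r @` sp s) (r x) by exists x => //; rewrite -sE.
rewrite spE im_lspan // => rx; apply: (gen_subrep rt _ (@setT_subgroup p F)).2 => //.
have sub : lspan (r @` [set` s]) `<=` gen rt [set: G] (r @` [set` s]).
  by apply: lspan_min => //; apply: (@gen_self _ _ _ _ rt [set: G]).
exact: (sub (r x) rx).
Qed.

End Presentation.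

End EdgeClosed.

(** * Finite presentations *)

Section FinitePresentation.
Context {p : nat} {F : localField p} (varpi : F) (varpi_unif : uniformizer varpi).
Context {k : fieldType} {V : lmodType k} (pi : rep (GL2 F) V) (pi_smooth : smooth pi).
Local Notation G := (GL2 F).
Local Notation Pi := (mx22 0 1 varpi 0).
Local Notation rt := (@rtrans k G V).
Local Notation br := (bracket pi).
Local Notation phi := (pres_map pi).
Variables (W : set V) (W_KZ : subrep pi KZ W).
Local Notation E := (brackets pi W).
Let E_KZ : subrep rt KZ E := brackets_KZ W_KZ.
Let cs : subspace (cInd pi W) := cInd_subspace W_KZ.

Local Lemma phi_subspace (S : set (G -> V)) : subspace S -> S `<=` cInd pi W ->
  subspace (phi @` S).
Proof.
move=> Ss SC; split; first by exists 0; [exact: sub0 | exact: (pres_map0 W_KZ)].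
move=> a _ _ [f Sf <-] [g Sg <-]; exists (a *: f + g); first exact: Ss.2.
by rewrite (@pres_map_linear _ _ _ _ pi W) //; apply: SC.
Qed.

Local Lemma phi_fin_dim (S : set (G -> V)) : fin_dim S -> S `<=` cInd pi W ->
  fin_dim (phi @` S).
Proof.
move=> fdS SC; have Ss := fin_dim_subspace fdS; have /fin_dimP[s SE] := fdS.
apply: (fin_dim_sub (phi_subspace Ss SC) _ (fin_dim_sp (map phi s))).
rewrite {}SE in SC * => {Ss fdS}; elim: s SC => [|f s IH] SC _ [g + <-] /=.
  by move=> ->; rewrite (pres_map0 W_KZ).
have fC : cInd pi W f by apply: SC; apply: sp_mem; rewrite mem_head.
have sC : sp s `<=` cInd pi W.
  by apply: sp_min => // h hs; apply: SC; apply: sp_mem; rewrite inE hs orbT.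
move=> [c [h sh ->]]; exists c, (phi h).
  by apply: IH => //; exists h.
by rewrite (@pres_map_linear _ _ _ _ pi W) //; apply: sC.
Qed.

Local Lemma ball_cInd n : ball varpi rt E n `<=` cInd pi W.
Proof. by move=> f Bf; rewrite (cInd_gen pi_smooth W_KZ) (gen_ball varpi_unif E_KZ); exists n. Qed.

Local Lemma gen_cInd (H : set G) (S : set (G -> V)) :
  S `<=` cInd pi W -> gen rt H S `<=` cInd pi W.
Proof. by move=> SC; apply: gen_min => // g f _ /SC; apply: rtrans_cInd. Qed.

(** Functions supported on the two half-trees of an edge have disjoint
    supports. *)
Local Lemma half_supports f : halfspan rt E f -> opp_halfspan varpi rt E f -> f = 0.
Proof.
have supp h : halfspan rt E h -> forall x, h x != 0 -> PKZ (x^-1)%g.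
  pose S : set (G -> V) := [set h | forall x, ~ PKZ (x^-1)%g -> h x = 0].
  have SE : halfspan rt E `<=` S.
    apply: gen_min; first split=> //.
      by move=> a f1 f2 h1 h2 x nx; rewrite funZD h1 // h2 // scaler0 addr0.
    move=> q _ Pq [w Ww <-] x nx; rewrite rtrans_bracket mulg1 /bracket.
    case: asboolP => // Kxq; case: nx.
    have -> : (x^-1 = q * (x * q)^-1)%g by rewrite invgM mulgA mulgV mul1g.
    by exists q => //; exists ((x * q)^-1)%g => //; apply: KZV.
  move=> /SE Sh x hx; apply: contrapT => nx; by rewrite Sh ?eqxx in hx.
move=> Pf [g Pg fE]; apply/funext => x; apply/eqP; apply: contraT => fx.
have /supp/(_ x fx) Px := Pf.
have gx : g (x * Pi)%g != 0 by move: fx; rewrite -fE.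
have := supp _ Pg _ gx; rewrite invgM => PPx.
by case: (PKZ_disjoint varpi_unif Px PPx).
Qed.

(** An element of D_1 lifts to both half-trees, up to a bounded error; the
    difference of the lifts is a relation. As the relations are generated by
    finitely many functions, it splits into relations on the two sides, up to
    a bounded error again. Correcting the lifts by these relations makes them
    equal, hence supported on a bounded part of the tree. *)
Lemma fin_pres_fin_dim_D1 (S : set V) : fin_dim W -> gen pi [set: G] W = [set: V] ->
  fin_gen rt (relations pi W) -> fin_dim S -> fin_dim (D1 varpi pi S).
Proof.
move=> fdW Wgen [A finA relE] fdS.
have fdE : fin_dim E by apply: (fin_dim_im (bracketZD pi 1%g)).
have cIndE : cInd pi W = \bigcup_n ball varpi rt E n.
  by rewrite (cInd_gen pi_smooth W_KZ) (gen_ball varpi_unif E_KZ).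
have Bs n := ball_subspace varpi E_KZ n.
have rs := relations_subrep pi_smooth W_KZ.
have Arel : A `<=` relations pi W by rewrite relE; apply: gen_self.
have [M1 AM1] : exists n, lspan A `<=` ball varpi rt E n.
  apply: directed_sub Bs _ _ _; first by move=> n; apply: ball_incr.
    by exists A.
  by rewrite -cIndE; apply: lspan_min => // f /Arel[].
have onto x : exists2 f, cInd pi W f & phi f = x.
  have : gen pi [set: G] W x by rewrite Wgen.
  suff : gen pi [set: G] W `<=` phi @` cInd pi W by move=> /[apply] -[f]; exists f.
  apply: gen_min; first exact: phi_subspace.
  move=> g w _ Ww; exists (br g w); first exact: bracket_cInd.
  by rewrite pres_map_bracket.
have [M2 SM2] : exists n, S `<=` phi @` ball varpi rt E n.
  apply: (@directed_sub _ _ _ (fun n => phi @` ball varpi rt E n)) => //.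
  - by move=> n; apply: phi_subspace => //; apply: ball_cInd.
  - by move=> n _ [f Bf <-]; exists f => //; apply: ball_incr.
  - move=> x _; have [f + <-] := onto x; rewrite cIndE => -[n _ Bf].
    by exists n => //; exists f.
pose M := (maxn M1 M2).+1; pose B := ball varpi rt E M.
have BK : subrep rt KZ B := ball_subrep varpi E_KZ M.
have BC : B `<=` cInd pi W by apply: ball_cInd.
have AB : A `<=` B.
  move=> f Af; have : ball varpi rt E M1 f by apply: AM1; apply: lspan_inc.
  by apply: ball_le => //; rewrite leqW ?leq_maxl.
have SB : S `<=` phi @` B.
  move=> x /SM2[f Bf <-]; exists f => //; apply: (ball_le _ Bf).
  by rewrite leqW ?leq_maxr.
pose R0 := gen rt KZ A.
have R0K : subrep rt KZ R0 by apply: gen_subrep; apply: KZ_subgroup.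
have R0B : R0 `<=` B by apply: gen_min; [exact: BK.1 | move=> g f Kg /AB; apply: BK.2].
have PB : halfspan rt B `<=` cInd pi W by apply: gen_cInd.
have PBs : subspace (halfspan rt B) by apply: halfspan_subspace.
have PR0 : halfspan rt R0 `<=` relations pi W.
  apply: gen_min; first exact: rs.1.
  move=> g f _ R0f; apply: rs.2 => //; move: f R0f; apply: gen_min; first exact: rs.1.
  by move=> h f _ /Arel; apply: rs.2.
have relS : relations pi W `<=` addS (halfspan rt R0) (opp_halfspan varpi rt R0).
  rewrite -(gen_halves varpi_unif R0K) relE; apply: gen_mono.
  exact: gen_self KZ1.
have lift x : halfspan pi S x -> (phi @` halfspan rt B) x.
  move: x; apply: gen_min; first exact: phi_subspace.
  move=> q x Pq /SB[f Bf <-]; exists (rt q f); first exact: gen_inc.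
  by rewrite (pres_map_rtrans pi_smooth W_KZ) //; apply: BC.
have fdB : fin_dim B by apply: ball_fin_dim.
apply: (fin_dim_sub (D1_subspace _ _ _) _ (phi_fin_dim fdB BC)).
move=> x [/lift[f Pf fx] [_ /lift[f' Pf' <-] xE]].
have cf := PB _ Pf; have cf' := PB _ Pf'.
have cPf' : cInd pi W (rt Pi f') by apply: rtrans_cInd.
have [|r1 Pr1 [_ [r2 Pr2 <-] rE]] := relS (f - rt Pi f').
  split; first exact: subB.
  rewrite (pres_mapB W_KZ) // (pres_map_rtrans pi_smooth W_KZ) // fx xE.
  by rewrite subrr.
have gE : f - r1 = rt Pi (f' + r2).
  rewrite rhoD; apply/eqP; rewrite subr_eq -addrA [rt Pi r2 + _]addrC rE.
  by rewrite addrC subrK.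
have R0PB : halfspan rt R0 `<=` halfspan rt B by apply: gen_mono.
have Pg : halfspan rt B (f - r1) by apply: subB => //; apply: R0PB.
have Pg' : halfspan rt B (f' + r2) by apply: subD => //; apply: R0PB.
exists (f - r1); last first.
  rewrite (pres_mapB W_KZ) // ?fx; last exact: (PR0 _ Pr1).1.
  by rewrite (PR0 _ Pr1).2 subr0.
have [e Pe [b Bb ebE]] := halfspan_ball varpi_unif E_KZ Pg.
have [e' Pe' [b' Bb' ebE']] := halfspan_ball varpi_unif E_KZ Pg'.
have := Bb; have := Bb'; rewrite /B /M !(ball_halves varpi_unif E_KZ).
move=> [c1' Lc1' [_ [c2' Lc2' <-] bE']] [c1 Lc1 [_ [c2 Lc2 <-] bE]].
pose d := rt (dg varpi varpi) c2'.
have v0 := varpi_neq0 varpi_unif.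
have Ld : layer varpi rt E (maxn M1 M2) d by apply: layer_scalar.
have key : e + c1 - d = rt Pi (e' + c1' - c2).
  have eq1 := gE; rewrite -ebE -ebE' -bE -bE' !rhoD (rho_Pi2 varpi_unif) in eq1.
  rewrite rhoB rhoD; apply/eqP; rewrite subr_eq addrAC eq_sym subr_eq.
  by rewrite -!addrA eq1.
have Ps := halfspan_subspace rt E.
have k0 : e + c1 - d = 0.
  apply: half_supports.
    by apply: subB => //; [apply: subD => //; exact: layer_halfspan Lc1 | exact: layer_halfspan Ld].
  exists (e' + c1' - c2) => //.
  by apply: subB => //; [apply: subD => //; exact: layer_halfspan Lc1' | exact: layer_halfspan Lc2].
have {}k0 : e + c1 = d by apply/eqP; rewrite -subr_eq0 k0.
have Bd : B d by apply/ball_incr/layer_ball.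
have Bc : B (rt Pi c2) by apply/ball_Pi/layer_ball.
rewrite -ebE -bE addrA k0 -(ball_halves varpi_unif E_KZ).
exact: (subD BK.1 Bd Bc).
Qed.

End FinitePresentation.

(** * Finite-dimensional representations of KZ *)

Section FiniteReps.
Context {p : nat} {F : localField p}.
Local Notation G := (GL2 F).
Local Notation O := (@integral_elt p F).
Context (varpi : F) (varpi_unif : uniformizer varpi).

Lemma finite_approx n : exists l : seq F, forall x, O x ->
  exists2 y, y \in l & valge n%:Z (x - y).
Proof.
elim: n => [|n [l lP]].
  by exists [:: 0] => x Ox; exists 0; rewrite ?mem_head // subr0.
exists [seq res_elt i + varpi * y | i <- enum (@residue p F), y <- l] => x Ox.
have v0 := varpi_neq0 varpi_unif; pose i := res_class x.
have [y yl xy] := lP _ (valge1_div varpi_unif (res_classP Ox)).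
exists (res_elt i + varpi * y).
  by apply/allpairsP; exists (i, y); rewrite mem_enum.
have -> : x - (res_elt i + varpi * y) = varpi * ((x - res_elt i) / varpi - y).
  by field.
by rewrite -addn1 PoszD; apply: valge_mul_varpi.
Qed.

Lemma finite_cong n : exists s : seq G, forall g, maxcompact g ->
  exists2 h, h \in s & maxcompact h /\ cong n%:Z (h^-1 * g)%g.
Proof.
have [l lP] := finite_approx n.
pose near (t : F * F * F * F) (g : G) := [/\ valge n (g 0 0 - t.1.1.1),
  valge n (g 0 1 - t.1.1.2), valge n (g 1 0 - t.1.2) & valge n (g 1 1 - t.2)].
pose f t := xget 1%g [set g | maxcompact g /\ near t g].
exists [seq f t | t <- [seq (u, d) | u <- [seq (v, c) | v <- [seq (a, b) | a <- l, b <- l], c <- l], d <- l]].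
move=> g Kg; have [gO _] := Kg.
have [a al ga] := lP _ (gO 0 0); have [b bl gb] := lP _ (gO 0 1).
have [c cl gc] := lP _ (gO 1 0); have [d dl gd] := lP _ (gO 1 1).
pose t := (a, b, c, d).
have [Kf [f1 f2 f3 f4]] : maxcompact (f t) /\ near t (f t).
  by apply: (@xgetPex _ 1%g [set g | maxcompact g /\ near t g]); exists g.
exists (f t).
  apply/mapP; exists t => //; apply/allpairsP; exists ((a, b, c), d) => //; split=> //.
  apply/allpairsP; exists ((a, b), c) => //; split=> //.
  by apply/allpairsP; exists (a, b).
split=> //; have [_ fO] := Kf.
have close : forall i j, valge n (g i j - f t i j).
  by apply: forall_ord2; (eapply valge_trans; [eassumption|]); apply: valge_sym.
move=> i j.
have -> : ((f t)^-1 * g)%g i j - (1%g : G) i j =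
    \sum_l ((f t)^-1)%g i l * (g l j - f t l j).
  have -> : (1%g : G) = ((f t)^-1 * f t)%g by rewrite mulVg.
  by rewrite !GL2_mulE -sumrB; apply: eq_bigr => m _; rewrite mulrBr.
elim/big_ind: _ => [|*|m _]; [exact: valge0 | exact: valgeD |].
by apply: valgeMl => //; apply: fO.
Qed.

Context {k : fieldType} {V : lmodType k} (pi : rep G V) (pi_smooth : smooth pi).
Context (pi_central : has_central_character pi).

(** A vector is fixed by a congruence subgroup, which has finite index in K,
    and the centre acts by scalars. *)
Lemma gen_KZ_fin_dim x : fin_dim (gen pi KZ [set x]).
Proof.
have [n _ nP] := smooth_cong pi_smooth x; have [s sP] := finite_cong n.
have [chi chiP] := pi_central.
apply: (fin_dim_sub (gen_subspace _ _ _) _ (fin_dim_sp [seq pi h x | h <- s])).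
apply: gen_min; first exact: sp_subspace.
move=> _ _ [g Kg [z cz <-]] ->.
rewrite repM (chiP z x cz) rhoZ; apply: subZ; first exact: sp_subspace.
have [h hs [_ ch]] := sP _ Kg; rewrite -(mulKVg h g) repM nP //.
by apply: sp_mem; apply: map_f.
Qed.

Lemma KZ_self (S : set V) x : subrep pi KZ S -> S x -> gen pi KZ [set x] `<=` S.
Proof. by move=> SK Sx; apply: gen_min; [exact: SK.1 | move=> g _ Kg ->; apply: SK.2]. Qed.

Lemma nonzero_elt (S : set V) : subspace S -> S <> [set 0] -> exists2 x, S x & x != 0.
Proof.
move=> Ss S0; apply: contrapT => nx; apply: S0; apply/seteqP; split=> [x Sx|_ ->].
  by apply/eqP; apply: contraT => x0; case: nx; exists x.
exact: sub0.
Qed.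

Lemma irreducible_KZ_fin_dim (S : set V) : irreducible_subrep pi KZ S -> fin_dim S.
Proof.
move=> [SK S0 irr]; have [x Sx x0] := nonzero_elt SK.1 S0.
have gx : gen pi KZ [set x] x by apply: gen_self => //; apply: KZ1.
have [gE|<-] := irr _ (gen_subrep pi [set x] (@KZ_subgroup p F)) (KZ_self SK Sx).
  by move: gx x0; rewrite gE => ->; rewrite eqxx.
exact: gen_KZ_fin_dim.
Qed.

Lemma irreducible_gen (A : set V) x : irreducible pi -> A x -> x != 0 ->
  gen pi [set: G] A = [set: V].
Proof.
move=> [_ _ irr] Ax x0; have gx : gen pi [set: G] A x by apply: gen_self.
have [gE|//] := irr _ (gen_subrep pi A (@setT_subgroup p F)) (@subsetT _ _).
by move: gx x0; rewrite gE => ->; rewrite eqxx.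
Qed.

(** A nonzero subrepresentation with the least number of generators is
    irreducible, by the exchange argument. *)
Lemma exists_irreducible_KZ : irreducible pi ->
  exists S, irreducible_subrep pi KZ S.
Proof.
move=> [_ V0 _]; have [x _ x0] := nonzero_elt (@subspaceT _ _) V0.
pose good n := exists s : seq V, [/\ size s = n, subrep pi KZ (sp s) & sp s <> [set 0]].
have [n gn] : exists n, good n.
  have /fin_dimP[s sE] := gen_KZ_fin_dim x; exists (size s), s; split=> //.
    by rewrite -sE; apply: gen_subrep; apply: KZ_subgroup.
  move=> s0; have : gen pi KZ [set x] x by apply: gen_self => //; apply: KZ1.
  by rewrite sE s0 => xE; rewrite xE eqxx in x0.
have {n gn} [n [[s [sn sK s0]] nmin]] : exists n, good n /\ forall m, good m -> (n <= m)%N.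
  have exn : exists n, `[< good n >] by exists n; apply/asboolP.
  case: (ex_minnP exn) => m /asboolP gm mmin; exists m; split=> // j gj.
  by apply: mmin; apply/asboolP.
exists (sp s); split=> // T TK Ts.
have [|T0] := pselect (T = [set 0]); [by left | right].
have [s' [TE s's full]] := sub_sp TK.1 Ts.
apply: full; apply/eqP; rewrite eqn_leq s's sn; apply: nmin.
by exists s'; rewrite -TE.
Qed.

End FiniteReps.

(** * Sums of characters of the residue field *)

Section CharacterSums.
Context {p : nat} (p_prime : prime p) {F : localField p}.
Context {k : fieldType} (k_pchar : p \in [pchar k]).
Local Notation O := (@integral_elt p F).
Local Notation R := (@residue p F).

Lemma res_sum_const (v : k) : \sum_(i : R) v = 0.
Proof.
rewrite sumr_const -mulr_natr; have := @dvdp_card_residue p F p_prime.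
by rewrite (dvdn_pcharf k_pchar) => /eqP ->; rewrite mulr0.
Qed.

Lemma res_sum_nonunit (U : nmodType) (v : U) :
  \sum_(i : R) (if vunit (res_elt i) then 0 else v) = v.
Proof.
have O0 := @integral_elt0 p F; have c0 := res_classP O0.
rewrite (bigD1 (res_class 0)) //= big1 => [|i i0].
  have -> : vunit (res_elt (res_class (0 : F))) = false; last by rewrite addr0.
  by rewrite vunitE; move: c0; rewrite sub0r valgeN => ->; rewrite andbF.
case: ifP => // ui; case/negP: i0; apply/eqP; apply: res_inj.
have := vunitP (res_int i); rewrite ui /= => i1.
by apply: valgeB => //; move: c0; rewrite sub0r valgeN.
Qed.

Context (psi : F -> k) (psi0 : forall x, ~~ vunit x -> psi x = 0).
Context (psi1 : psi 1 = 1) (psi_inv : res_invariant psi).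
Context (psiM : forall x y, vunit x -> vunit y -> psi (x * y) = psi x * psi y).

Local Lemma psi_shift m : O m -> \sum_(i : R) psi (res_elt i - m) = \sum_(i : R) psi (res_elt i).
Proof.
move=> Om; have ON : O (- m) by rewrite integralN.
by rewrite [RHS](res_sum_shift ON psi_inv).
Qed.

(** Scaling the variable by [u] multiplies the sum by [psi u]. *)
Local Lemma psi_sum0 u : vunit u -> psi u != 1 -> \sum_(i : R) psi (res_elt i) = 0.
Proof.
move=> uu pu; set s := \sum_i _.
have sE : s = psi u * s.
  rewrite {1}/s (res_sum_scale uu psi_inv) mulr_sumr; apply: eq_bigr => i _.
  have [ui|ui] := boolP (vunit (res_elt i)); first by rewrite psiM.
  rewrite (psi0 ui) mulr0 psi0 //; apply: contra ui => uui.
  have OV := vunit_int (vunitV uu).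
  rewrite -[res_elt i](mulKf (vunit_neq0 uu)); apply: vunitM => //; exact: vunitV.
have : (1 - psi u) * s == 0 by rewrite mulrBl mul1r -sE subrr.
by rewrite mulf_eq0 subr_eq0 eq_sym (negPf pu) => /eqP.
Qed.

(** The sum counts the nonzero classes, and the number of classes is 0 in
    characteristic p. *)
Local Lemma psi_sum1 : (forall u, vunit u -> psi u = 1) ->
  \sum_(i : R) psi (res_elt i) = -1.
Proof.
move=> triv; apply/eqP; rewrite -subr_eq0 opprK; apply/eqP.
rewrite -[X in _ + X](@res_sum_nonunit k 1) -big_split -[RHS](res_sum_const 1).
apply: eq_bigr => i _ /=; case: ifP => ui; first by rewrite triv // addr0.
by rewrite psi0 ?ui // add0r.
Qed.

(** The substitution of 1 / x for x turns the terms into [psi (1 - m * x)],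
    where x runs through the nonzero classes. *)
Local Lemma psi_jacobi u m : vunit u -> psi u != 1 -> O m ->
  \sum_(i : R) psi (uinv (res_elt i)) * psi (res_elt i - m) = -1.
Proof.
move=> uu pu Om; pose H y : k := if vunit y then psi (1 - m * y) else 0.
have HE x : O x -> psi (uinv x) * psi (x - m) = H (uinv x).
  move=> Ox; rewrite /H /uinv; case: ifP => ux; last first.
    have n0 : ~~ vunit (0 : F) by rewrite /vunit eqxx.
    by rewrite (negPf n0) (psi0 n0) mul0r.
  have uVx := vunitV ux; have x0 := vunit_neq0 ux; rewrite uVx.
  have E : 1 - m / x = x^-1 * (x - m) by field.
  have [um|um] := boolP (vunit (x - m)); first by rewrite E psiM.
  rewrite (psi0 um) mulr0 E psi0 //; apply: contra um => um.
  by rewrite -[x - m](mulVKf x0); apply: vunitM.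
have psi_inv1 : res_invariant (fun y => psi (1 - m * y)).
  move=> x y Ox Oy xy; apply: psi_inv.
  - by apply: integralB; [exact: integral_elt1 | exact: integral_eltM].
  - by apply: integralB; [exact: integral_elt1 | exact: integral_eltM].
  - have -> : 1 - m * x - (1 - m * y) = (- m) * (x - y) by ring.
    by apply: valgeMl; rewrite ?integralN.
have H_inv : res_invariant H.
  move=> x y Ox Oy xy; rewrite /H; have -> : vunit y = vunit x.
    by apply/idP/idP => /vunit_cong; apply=> //; apply: valge_sym.
  by case: ifP => // _; apply: psi_inv1.
under eq_bigr => i _ do rewrite (HE _ (res_int i)).
rewrite -(res_sum_inv H_inv).
transitivity (\sum_(i : R) psi (1 - m * res_elt i) - 1).
  rewrite -[X in _ - X](@res_sum_nonunit k 1) -sumrB; apply: eq_bigr => i _.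
  rewrite /H; case: ifP => ui; first by rewrite subr0.
  have Oi := res_int i; have i1 : valge 1 (res_elt i).
    by have := vunitP Oi; rewrite ui.
  rewrite (psi_inv1 _ 0) ?integral_elt0 //; last by rewrite subr0.
  by rewrite mulr0 subr0 psi1 subrr.
suff -> : \sum_(i : R) psi (1 - m * res_elt i) = 0 by rewrite sub0r.
have [um|m1] := orP (vunitP Om); last first.
  rewrite -[RHS](res_sum_const 1); apply: eq_bigr => i _; rewrite -[RHS]psi1.
  have Oi := res_int i; apply: psi_inv.
  - by apply: integralB; [exact: integral_elt1 | exact: integral_eltM].
  - exact: integral_elt1.
  - by rewrite addrAC subrr sub0r valgeN; apply: valgeMr.
have uNm : vunit (- m) by rewrite vunitN.
rewrite -[RHS](psi_sum0 uu pu) (res_sum_shift integral_elt1 psi_inv).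
have psi_inv2 : res_invariant (fun y => psi (y + 1)).
  move=> x y Ox Oy xy; apply: psi_inv.
  - exact: integralD Ox (integral_elt1).
  - exact: integralD Oy (integral_elt1).
  - by rewrite opprD addrACA subrr addr0.
rewrite [RHS](res_sum_scale uNm psi_inv2); apply: eq_bigr => i _.
by rewrite mulNr addrC.
Qed.

(** Pairing the given relations with the inverse character isolates the sum of
    the coefficients, through the sums of [psi_jacobi]; when the character is
    trivial, adding up the relations does. *)
Lemma character_combination (c : R -> k) (c0 e : k) : e != 0 ->
  (forall i, c0 + e * \sum_j c j * psi (res_elt i - res_elt j) = 0) ->
  \sum_j c j = 0.
Proof.
move=> e0 cE; have [triv|/existsNP[u /not_implyP[uu /eqP pu]]] :=
  pselect (forall u, vunit u -> psi u = 1).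
- have : \sum_(i : R) (c0 + e * \sum_j c j * psi (res_elt i - res_elt j)) = 0.
    by rewrite big1 // => i _; apply: cE.
  rewrite big_split /= res_sum_const add0r -mulr_sumr exchange_big /=.
  under eq_bigr => j _ do rewrite -mulr_sumr (psi_shift (res_int j)) psi_sum1 // mulrN1.
  by rewrite sumrN mulrN => /eqP; rewrite oppr_eq0 mulf_eq0 (negPf e0) => /eqP.
- have : \sum_(i : R) psi (uinv (res_elt i)) *
      (c0 + e * \sum_j c j * psi (res_elt i - res_elt j)) = 0.
    by rewrite big1 // => i _; rewrite cE mulr0.
  under eq_bigr => i _ do rewrite mulrDr mulrCA mulr_sumr.
  rewrite big_split /= -mulr_suml -(res_sum_inv psi_inv) (psi_sum0 uu pu) mul0r add0r.
  rewrite -mulr_sumr exchange_big /=.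
  under eq_bigr => j _.
    under eq_bigr => i _ do rewrite mulrCA.
    rewrite -mulr_sumr (psi_jacobi uu pu (res_int j)) mulrN1; over.
  by rewrite sumrN mulrN => /eqP; rewrite oppr_eq0 mulf_eq0 (negPf e0) => /eqP.
Qed.

End CharacterSums.

(** * Powers of units *)

Section Powers.
Context {p : nat} (p_prime : prime p) {F : localField p}.
Local Notation O := (@integral_elt p F).
Implicit Types x u : F.

Lemma integralX x n : O x -> O (x ^+ n).
Proof.
move=> Ox; elim: n => [|n IH]; first exact: integral_elt1.
by rewrite exprS; apply: integral_eltM.
Qed.

Lemma vunitX u n : vunit u -> vunit (u ^+ n).
Proof.
move=> uu; elim: n => [|n IH]; first exact: vunit1.
by rewrite exprS; apply: vunitM.
Qed.

Lemma valgeX_sub1 m u n : 0 <= m -> valge m (u - 1) -> valge m (u ^+ n - 1).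
Proof.
move=> m0 um; have Ou : O u.
  by rewrite -(subrK 1 u); apply: integralD (valge_int m0 um) integral_elt1.
rewrite subrX1; apply: valgeMr => //; apply: integral_elt_sum => i.
exact: integralX.
Qed.

Lemma valge_expp m u : 1 <= m -> valge m (u - 1) -> valge (m + 1) (u ^+ p - 1).
Proof.
move=> m1 um; rewrite subrX1; apply: valgeM => //.
have -> : \sum_(i < p) u ^+ i = \sum_(i < p) (u ^+ i - 1) + p%:R.
  by rewrite sumrB sumr_const card_ord subrK.
apply: valgeD; last exact: residue_pchar.
elim/big_ind: _ => [|*|i _]; [exact: valge0 | exact: valgeD |].
by apply: valgeX_sub1 => //; apply: valge_le um.
Qed.

Lemma valge_exppn e u : valge 1 (u - 1) -> valge (e.+1)%:Z (u ^+ (p ^ e) - 1).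
Proof.
move=> u1; elim: e => [|e IH]; first by rewrite expn0 expr1.
by rewrite expnSr exprM -addn1 PoszD; apply: valge_expp.
Qed.

Context (varpi : F) (varpi_unif : uniformizer varpi).

(** Two powers of [u] are congruent, by the pigeonhole principle. *)
Lemma unit_finite_order m u : vunit u ->
  exists2 n, (0 < n)%N & valge (m%:Z) (u ^+ n - 1).
Proof.
move=> uu; have [l lP] := finite_approx varpi_unif m.
pose f (i : 'I_(size l).+1) : 'I_(size l).+1 :=
  inord (find (fun y => valge m (u ^+ i - y)) l).
have hasf (i : 'I_(size l).+1) : has (fun y => valge m (u ^+ i - y)) l.
  have [y yl uy] := lP (u ^+ i) (vunit_int (vunitX i uu)).
  by apply/hasP; exists y.
have fE i : f i = find (fun y => valge m (u ^+ i - y)) l :> nat.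
  by rewrite inordK // ltnS find_size.
have [i [j [ij fij]]] : exists i, exists j, i != j /\ f i = f j.
  apply: contrapT => nij; have inj : injective f.
    by move=> i j fij; apply/eqP; apply: contraT => ij; case: nij; exists i, j.
  have := inj_card_bij inj (leqnn _) => -[g _ gK].
  have lt := hasf (g ord_max); rewrite has_find -fE gK /= ltnn in lt.
  by [].
wlog lij : i j ij fij / (i < j)%N.
  move=> H; case: (ltngtP i j) => [||/val_inj e]; first exact: H.
    by apply: H => //; rewrite eq_sym.
  by rewrite e eqxx in ij.
exists (j - i)%N; first by rewrite subn_gt0.
pose y := nth 0 l (f i).
have yi : valge m (u ^+ i - y) by rewrite /y fE; apply: (nth_find 0 (hasf i)).
have yj : valge m (u ^+ j - y) by rewrite /y fij fE; apply: (nth_find 0 (hasf j)).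
apply: (valgeVM (vunitX i uu)).
rewrite mulrBr mulr1 -exprD subnKC //; last exact: ltnW.
exact: valge_trans yj (valge_sym yi).
Qed.

End Powers.

(** * Unipotent invariants of a half-tree *)

Section Invariants.
Context {p : nat} (p_prime : prime p) {F : localField p}.
Context (varpi : F) (varpi_unif : uniformizer varpi).
Context {k : closedFieldType} (k_pchar : p \in [pchar k]).
Context {V : lmodType k} (pi : rep (GL2 F) V) (pi_smooth : smooth pi).
Context (pi_central : has_central_character pi).
Local Notation G := (GL2 F).
Local Notation O := (@integral_elt p F).
Local Notation al := (mx22 varpi 0 0 1).
Local Notation Pi := (mx22 0 1 varpi 0).
Local Notation child := (child varpi).
Let v0 : varpi != 0 := varpi_neq0 varpi_unif.

Lemma pchar_exp_eq1 (c : k) e : c ^+ (p ^ e) = 1 -> c = 1.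
Proof.
move=> ce; have : (c - 1) ^+ (p ^ e) == 0.
  have pn : [pchar k].-nat (p ^ e)%N by rewrite pnatX pnatE // k_pchar.
  by rewrite exprDn_pchar // exprNn_pchar // expr1n ce subrr.
by rewrite expf_eq0 subr_eq0 => /andP[_ /eqP].
Qed.

Lemma dg_cong m u v : valge m (u - 1) -> valge m (v - 1) -> u != 0 -> v != 0 ->
  cong m (dg u v : G).
Proof.
by move=> um vm u0 v0'; apply/cong_mx22; [nz | split; rewrite ?valge0].
Qed.

(** The scalar has p-power order, and 1 is the only root of unity of p-power
    order in characteristic p. *)
Lemma pro_p_scalar u v y c : valge 1 (u - 1) -> valge 1 (v - 1) -> y != 0 ->
  pi (dg u v) y = c *: y -> c = 1.
Proof.
move=> u1 v1 y0 yc; have [n _ nP] := smooth_cong pi_smooth y.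
have unit1 (x : F) : valge 1 (x - 1) -> x != 0.
  by move=> x1; apply/vunit_neq0/(vunit_cong vunit1).
have u0 := unit1 _ u1; have v0' := unit1 _ v1.
have pw j : pi (dg (u ^+ j) (v ^+ j)) y = c ^+ j *: y.
  elim: j => [|j IH]; first by rewrite !expr0 mx22_1 rep1 scale1r.
  by rewrite !exprS -dgM ?expf_neq0 // repM IH rhoZ yc scalerA mulrC.
apply: (@pchar_exp_eq1 _ n); apply/eqP; rewrite -subr_eq0.
have : (c ^+ (p ^ n) - 1) *: y == 0.
  rewrite scalerBl scale1r -pw nP ?subrr //.
  by apply: dg_cong; rewrite ?expf_neq0 //; apply: (@valge_le _ _ n n.+1%:Z);
    rewrite ?lez_nat //; apply: valge_exppn.
by rewrite scaler_eq0 (negPf y0) orbF.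
Qed.

Definition Nfixed x := forall b, O b -> pi (n_ b) x = x.

Lemma Nfixed_subspace : subspace [set x | Nfixed x].
Proof.
split=> [b Ob|a x y Nx Ny b Ob]; first by rewrite rho0.
by rewrite (rep_linear pi) Nx // Ny.
Qed.

Lemma Nfixed_dg u v x : vunit u -> vunit v -> Nfixed x -> Nfixed (pi (dg u v) x).
Proof.
move=> uu uv Nx b Ob; have u0 := vunit_neq0 uu; have v0' := vunit_neq0 uv.
have -> : b = u / v * (v / u * b) by field; rewrite u0 v0'.
rewrite -repM -dg_up // repM Nx //; apply: integral_eltM => //.
by apply: integral_eltM; apply/vunit_int => //; apply: vunitV.
Qed.

(** Congruent elements [b] define the same coset of the upper unipotents over
    O. *)
Lemma up_al_invariant x : Nfixed x -> res_invariant (fun b => pi (n_ b * al)%g x).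
Proof.
move=> Nx b b' Ob Ob' bb'.
have -> : b = b' + varpi * ((b - b') / varpi) by field.
by rewrite -upM -mulgA -(al_up varpi_unif) mulgA [in LHS]repM Nx //; apply: valge1_div.
Qed.

(** The operator U of the theory of modular forms: it pushes a vector one step
    down the half-tree. *)
Definition hecke x := \sum_i pi (child i) x.

Lemma hecke_linear : linear hecke.
Proof.
move=> a x y; rewrite /hecke scaler_sumr -big_split; apply: eq_bigr => i _ /=.
by rewrite (rep_linear pi).
Qed.

Lemma hecke_Nfixed x : Nfixed x -> Nfixed (hecke x).
Proof.
move=> Nx b Ob; rewrite /hecke rho_sum.
rewrite [RHS](res_sum_shift Ob (up_al_invariant Nx)); apply: eq_bigr => i _.
by rewrite -repM /child mulgA upM addrC.
Qed.

Lemma hecke_dg u x : vunit u -> Nfixed x ->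
  pi (dg u 1) (hecke x) = hecke (pi (dg u 1) x).
Proof.
move=> uu Nx; have u0 := vunit_neq0 uu; rewrite /hecke rho_sum.
rewrite [RHS](res_sum_scale uu (up_al_invariant (Nfixed_dg uu vunit1 Nx))).
apply: eq_bigr => i _; rewrite -!repM /child mulgA dg_up ?oner_neq0 // divr1.
by rewrite -mulgA (dg_al varpi_unif) ?oner_neq0 // mulgA.
Qed.

Lemma hecke_halfspan W x : halfspan pi W x -> halfspan pi W (hecke x).
Proof.
by move=> Px; apply: sub_sum => [|i _]; [exact: halfspan_subspace | exact: halfspan_child].
Qed.

Definition T1fixed x := forall u v, valge 1 (u - 1) -> valge 1 (v - 1) ->
  pi (dg u v) x = x.

Definition lw_fixed (m : int) x := forall c, valge m c -> pi (lw c) x = x.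

(** Conjugation by [al] contracts the lower unipotents, so each application of
    the operator gains one level of invariance. *)
Lemma hecke_lw (m : int) x : 1 <= m -> Nfixed x -> T1fixed x -> lw_fixed (m + 1) x ->
  lw_fixed m (hecke x).
Proof.
move=> m1 Nx Tx Lx c cm; rewrite /hecke rho_sum; apply: eq_bigr => i _.
have c1 : valge 1 c := valge_le m1 cm.
set r := res_elt i; have Or : O r := res_int i.
have cr : valge 1 (c * r) by apply: valgeMr.
have uu := vunit1D cr; have t0 := vunit_neq0 uu.
have OV := vunit_int (vunitV uu).
have t1 : valge 1 (1 + c * r - 1) by rewrite addrAC subrr add0r.
rewrite -repM /child -/r (lw_up_al varpi_unif) // repM [pi (dg _ _ * _)%g x]repM Lx; last first.
  by apply: valgeMr => //; rewrite mulrC; apply: valge_mul_varpi.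
rewrite Tx //; last first.
  have -> : (1 + c * r)^-1 - 1 = - (1 + c * r)^-1 * (c * r) by field.
  by apply: valgeMl; rewrite ?integralN.
apply: up_al_invariant => //; first exact: integral_eltM.
have -> : r / (1 + c * r) - r = - (r / (1 + c * r)) * (c * r) by field.
by apply: valgeMl; rewrite ?integralN //; apply: integral_eltM.
Qed.

(** Eigenvectors of the Iwahori subgroup that are fixed by its pro-p radical.
    *)
Definition Ieig x := [/\ Nfixed x, lw_fixed 1 x, T1fixed x
  & forall u v, vunit u -> vunit v -> exists c, pi (dg u v) x = c *: x].

Lemma dg_split u v : u != 0 -> v != 0 -> dg u v = (dg (u / v) 1%R * dg v v)%g :> G.
Proof.
by move=> u0 v0'; rewrite dgM ?oner_neq0 ?mulf_neq0 ?invr_eq0 // mul1r divfK.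
Qed.

Lemma central_scalar z : z != 0 -> exists c, forall x, pi (dg z z) x = c *: x.
Proof.
move=> z0; have [chi chiP] := pi_central; exists (chi (dg z z)) => x.
by apply: chiP; apply: center_scalar.
Qed.

Lemma torus_eig_T1fixed x :
  (forall u v, vunit u -> vunit v -> exists c, pi (dg u v) x = c *: x) -> T1fixed x.
Proof.
move=> ex u v u1 v1; have [->|x0] := eqVneq x 0; first by rewrite rho0.
have uu := vunit_cong vunit1 u1; have uv := vunit_cong vunit1 v1.
have [c xc] := ex _ _ uu uv.
by rewrite xc (pro_p_scalar u1 v1 x0 xc) scale1r.
Qed.

Lemma hecke_torus_eig x : Nfixed x ->
  (forall u v, vunit u -> vunit v -> exists c, pi (dg u v) x = c *: x) ->
  forall u v, vunit u -> vunit v -> exists c, pi (dg u v) (hecke x) = c *: hecke x.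
Proof.
move=> Nx ex u v uu uv; have u0 := vunit_neq0 uu; have v0' := vunit_neq0 uv.
have uuv : vunit (u / v) by apply: vunitM => //; apply: vunitV.
have [c xc] := ex _ _ uuv vunit1; have [d dP] := central_scalar v0'.
exists (c * d); rewrite dg_split // repM dP rhoZ hecke_dg // xc.
by rewrite (linZ hecke_linear) scalerA mulrC.
Qed.

Lemma hecke_Ieig x : Ieig x -> Ieig (hecke x).
Proof.
move=> [Nx Lx Tx ex]; have eh := hecke_torus_eig Nx ex.
split=> //; [exact: hecke_Nfixed | | exact: torus_eig_T1fixed].
by apply: hecke_lw => // c c2; apply: Lx; apply: valge_le c2.
Qed.

Variables (W : set V) (W_KZ : subrep pi KZ W) (eW : edge_closed varpi pi W).
Let Ws : subspace W := W_KZ.1.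
Local Notation J := (halfspan pi W).
Local Notation L := (layer varpi pi W).
Let Ls n : subspace (L n) := layer_subspace varpi pi n Ws.
Let Js : subspace J := halfspan_subspace pi W.

(** Compare with the components of the given element of the layer: the
    differences add up to an element of [W], hence lie in D_1(W) by
    [branch_components]. *)
Lemma layer_components n (y : residue -> V) : (forall i, J (y i)) ->
  L n.+1 (\sum_i pi (child i) (y i)) -> forall i, L n (y i).
Proof.
move=> Jy [w Ww [_ [z Lz <-] E]] i.
suff /eW Wd : D1 varpi pi W (y i - z i).
  rewrite -(subrK (z i) (y i)); apply: (subD (Ls n)); last exact: Lz.
  exact: layer_base Wd.
apply: (branch_components varpi_unif W_KZ (f := fun i => y i - z i)) => [j|].
  by apply: subB => //; apply: layer_halfspan (Lz j).
under eq_bigr => j _ do rewrite rhoB.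
by rewrite sumrB -E addrK.
Qed.

(** The two half-trees meet in D_1(W) only, which is contained in the layer.
    *)
Lemma half_cut n x : J x -> addS (L n) (opp_halfspan varpi pi W) x -> L n x.
Proof.
move=> Jx [l Ll [m Mm E]]; rewrite -E; apply: subD => //.
have Wm : W m.
  apply: eW; split=> //; have -> : m = x - l by rewrite -E addrC addKr.
  by apply: subB => //; apply: layer_halfspan Ll.
exact: layer_base.
Qed.

(** The operator increases the depth by exactly one. A vector outside [W]
    therefore has linearly independent iterates. *)
Lemma hecke_layer n x : J x -> L n.+1 (hecke x) -> L n x.
Proof.
by move=> Jx Lh; have := layer_components (y := fun=> x) (fun=> Jx) Lh (res_class 0).
Qed.

Lemma layer_hecke n x : L n x -> L n.+1 (hecke x).
Proof. by move=> Lx; apply: sub_sum => // i _; apply: layer_child. Qed.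

Lemma iter_hecke_halfspan j x : J x -> J (iter j hecke x).
Proof. by move=> Jx; elim: j => //= j; apply: hecke_halfspan. Qed.

Lemma iter_hecke_Nfixed j x : Nfixed x -> Nfixed (iter j hecke x).
Proof. by move=> Nx; elim: j => //= j; apply: hecke_Nfixed. Qed.

Lemma iter_hecke_layer j n x : J x -> L (j + n) (iter j hecke x) -> L n x.
Proof.
move=> Jx; elim: j => // j IH; rewrite addSn => Lj; apply: IH.
by apply: hecke_layer => //; apply: iter_hecke_halfspan.
Qed.

Lemma iter_hecke_dg j u x : vunit u -> Nfixed x ->
  pi (dg u 1) (iter j hecke x) = iter j hecke (pi (dg u 1) x).
Proof.
move=> uu Nx; elim: j => //= j <-; apply: hecke_dg => //.
exact: iter_hecke_Nfixed.
Qed.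

Lemma J_dg u x : vunit u -> J x -> J (pi (dg u 1) x).
Proof. by move=> uu; apply: halfspan_Pplus; apply: Pplus_dg. Qed.

(** * Iwahori eigenvectors *)

Section EigenvectorSearch.
Variables (y : V) (Jy : J y) (Ny : Nfixed y) (nWy : ~ W y).

Let Y := lspan [set iter j hecke (pi (dg u 1) y) | j in [set: nat] & u in [set u | vunit u]].
Let Ys : subspace Y := lspan_subspace _.

Local Lemma Y_min S : subspace S ->
  (forall j u, vunit u -> S (iter j hecke (pi (dg u 1) y))) -> Y `<=` S.
Proof. by move=> Ss H; apply: lspan_min => // _ [j _ [u uu <-]]; apply: H. Qed.

Local Lemma Y_JN : Y `<=` J `&` [set x | Nfixed x].
Proof.
apply: Y_min; first exact/subspaceI/Nfixed_subspace.
move=> j u uu; split; first by apply/iter_hecke_halfspan/J_dg.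
by apply: iter_hecke_Nfixed; apply: Nfixed_dg => //; apply: vunit1.
Qed.

Local Lemma Y_dg u x : vunit u -> Y x -> Y (pi (dg u 1) x).
Proof.
move=> uu; suff : Y `<=` [set x | Y (pi (dg u 1) x)] by apply.
apply: Y_min; first exact: preim_rep_subspace.
move=> j v uv /=; have u0 := vunit_neq0 uu; have v0' := vunit_neq0 uv.
rewrite iter_hecke_dg //; last by apply: Nfixed_dg => //; apply: vunit1.
rewrite -repM dgM ?oner_neq0 // mulr1; apply: lspan_inc; exists j => //.
by exists (u * v) => //; apply: vunitM.
Qed.

(** Otherwise [Y] would be contained in some layer, but the iterates of [y]
    leave every layer. *)
Local Lemma Y_infinite : ~ fin_dim Y.
Proof.
move=> fdY; have [n YL] : exists n, Y `<=` L n.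
  apply: (directed_sub Ls) => // [n|x /Y_JN[]]; first exact: layer_incr.
  by rewrite (halfspan_layer varpi_unif W_KZ).
apply: nWy; apply: (@iter_hecke_layer n 0 y Jy); rewrite addn0; apply: YL.
rewrite -[y](rep1 pi) -mx22_1; apply: lspan_inc; exists n => //; exists 1 => //.
exact: vunit1.
Qed.

(** The torus over O commutes with the operator, so it acts on [Y] through the
    finite quotient through which it acts on [y]. *)
Local Lemma Y_cong : exists2 m : nat, (0 < m)%N &
  forall u x, vunit u -> valge m (u - 1) -> Y x -> pi (dg u 1) x = x.
Proof.
have [m m0 mP] := smooth_cong pi_smooth y; exists m => //.
move=> u x uu um; have u0 := vunit_neq0 uu.
suff : Y `<=` [set x | pi (dg u 1) x = x] by apply.
apply: Y_min.
  by split=> /= [|a x1 x2 e1 e2]; rewrite ?rho0 // (rep_linear pi) e1 e2.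
move=> j v uv /=; have v0' := vunit_neq0 uv.
rewrite iter_hecke_dg //; last by apply: Nfixed_dg => //; apply: vunit1.
rewrite -repM dgM ?oner_neq0 // mulrC -dgM ?oner_neq0 // repM mP //.
by apply: dg_cong; rewrite ?oner_neq0 ?subrr ?valge0.
Qed.

(** Eigenspaces exist at each step, since an operator of finite order on an
    infinite-dimensional space has an infinite-dimensional eigenspace. *)
Local Lemma Y_eigen (l : seq F) : (forall u, u \in l -> vunit u) ->
  exists Y' : set V, [/\ subspace Y', Y' `<=` Y, ~ fin_dim Y',
    (forall u x, vunit u -> Y' x -> Y' (pi (dg u 1) x)) &
    forall u, u \in l -> exists c, forall x, Y' x -> pi (dg u 1) x = c *: x].
Proof.
elim: l => [|u l IH] lu.
  by exists Y; split=> //; [exact: Y_infinite | exact: Y_dg].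
have [|Y' [Y's Y'Y Y'inf Y'dg Y'eig]] := IH.
  by move=> v vl; apply: lu; rewrite inE vl orbT.
have uu : vunit u by apply: lu; rewrite mem_head.
have u0 := vunit_neq0 uu.
have [m _ mP] := Y_cong.
have [N N0 uN] := unit_finite_order varpi_unif m uu.
have [cs csE] := closed_field_poly_normal ('X^N - 1 : {poly k}).
rewrite -[X in _ - X]polyC1 lead_coefXnsubC // scale1r polyC1 in csE.
pose Z c := Y' `&` [set x | pi (dg u 1) x = c *: x].
have Zs c : subspace (Z c).
  apply: subspaceI => //; split=> /= [|a x1 x2 e1 e2]; first by rewrite rho0 scaler0.
  by rewrite (rep_linear pi) e1 e2 scalerDr !scalerA mulrC.
have [c Zc] : exists c, ~ fin_dim (Z c).
  apply: contrapT => nc; apply: Y'inf.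
  apply: (fin_dim_eigen (rep_linear pi (dg u 1)) N0 csE) => //.
  - by move=> x; apply: Y'dg.
  - move=> x Y'x; have -> : iter N (pi (dg u 1)) x = pi (dg (u ^+ N) 1) x.
      elim: {N0 uN csE} N => [|N IHN] /=; first by rewrite expr0 mx22_1 rep1.
      by rewrite IHN -repM dgM ?expf_neq0 ?oner_neq0 // mulr1 exprS.
    by apply: mP => //; [exact: vunitX | exact: Y'Y].
  - by move=> c _; apply: contrapT => fdc; apply: nc; exists c.
exists (Z c); split=> //; first by move=> x [/Y'Y].
  move=> v x uv [Y'x xc]; have v0' := vunit_neq0 uv; split; first exact: Y'dg.
  by rewrite /= -repM dgM ?oner_neq0 // mulrC -dgM ?oner_neq0 // repM xc rhoZ.
move=> v; rewrite inE => /orP[/eqP->|/Y'eig[d dP]]; first by exists c => x [].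
by exists d => x [/dP].
Qed.

(** An infinite-dimensional space of simultaneous eigenvectors is not
    contained in [W]. Iterating the operator makes an eigenvector invariant
    under all lower unipotents of level one. *)
Lemma exists_Ieig : fin_dim W -> exists a r, [/\ Ieig a, L r.+1 a & ~ L r a].
Proof.
move=> fdW; have [m m0 mP] := Y_cong.
have [l lP] := finite_approx varpi_unif m.
have [|Y' [Y's Y'Y Y'inf Y'dg Y'eig]] := @Y_eigen [seq u <- l | vunit u].
  by move=> u; rewrite mem_filter => /andP[].
have [z Y'z nWz] : exists2 z, Y' z & ~ W z.
  apply: contrapT => nz; apply: Y'inf; apply: (fin_dim_sub Y's _ fdW) => x Y'x.
  by apply: contrapT => nWx; apply: nz; exists x.
have [Jz Nz] := Y_JN (Y'Y _ Y'z).
have ez u v : vunit u -> vunit v -> exists c, pi (dg u v) z = c *: z.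
  move=> uu uv; have u0 := vunit_neq0 uu; have v0' := vunit_neq0 uv.
  have [d dP] := central_scalar v0'.
  have ux : vunit (u / v) by apply: vunitM => //; apply: vunitV.
  set x := u / v in ux *; have x0 := vunit_neq0 ux.
  have [t tl xt] := lP _ (vunit_int ux).
  have ut : vunit t.
    by apply: (vunit_cong ux); apply: valge_sym; apply: valge_le xt; rewrite lez_nat.
  have t0 := vunit_neq0 ut.
  have [|c cP] := Y'eig t; first by rewrite mem_filter ut.
  exists (c * d); rewrite dg_split // -/x repM dP rhoZ.
  have -> : dg x 1 = (dg t 1%R * dg (x / t) 1%R)%g :> G.
    by rewrite dgM ?oner_neq0 ?mulf_neq0 ?invr_eq0 // mulr1 mulrC divfK.
  have E1 : pi (dg (x / t) 1) z = z.
    apply: mP; [by apply: vunitM => //; apply: vunitV | | exact: Y'Y].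
    have -> : x / t - 1 = t^-1 * (x - t) by field.
    by apply: valgeMl => //; apply/vunit_int/vunitV.
  by rewrite repM E1 cP // scalerA mulrC.
have [n _ nP] := smooth_cong pi_smooth z.
have lz : lw_fixed n.+1%:Z z.
  move=> c cn; apply: nP; apply/cong_mx22; [nz | split; rewrite ?subrr ?valge0 //].
  by apply: valge_le cn; rewrite lez_nat.
have step j : (j <= n)%N -> lw_fixed (n - j).+1%:Z (iter j hecke z) /\
    forall u v, vunit u -> vunit v ->
      exists c, pi (dg u v) (iter j hecke z) = c *: iter j hecke z.
  elim: j => [|j IH] jn /=; first by rewrite subn0.
  have [Lj ej] := IH (ltnW jn); have Nj := iter_hecke_Nfixed j Nz; split.
    apply: hecke_lw => //; first exact: torus_eig_T1fixed.
    have -> : (n - j.+1).+1%:Z + 1 = (n - j).+1%:Z by lia.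
    exact: Lj.
  exact: hecke_torus_eig.
have [r [Lr nLr]] : exists r, L r.+1 z /\ ~ L r z.
  have exn : exists n, `[< L n z >].
    by move: Jz; rewrite (halfspan_layer varpi_unif W_KZ) => -[j _ Lj]; exists j; apply/asboolP.
  case: (ex_minnP exn) => -[|r] /asboolP Lr rmin; first by case: nWz.
  by exists r; split=> // /asboolP/rmin; rewrite ltnn.
exists (iter n hecke z), (n + r)%N; split.
- have [Ln en] := step n (leqnn n); rewrite subnn in Ln.
  by split=> //; [exact: iter_hecke_Nfixed | exact: torus_eig_T1fixed].
- rewrite -addnS; elim: n {nP lz step} => [|n IH] //=.
  exact: layer_hecke.
- by move=> /(iter_hecke_layer Jz).
Qed.

End EigenvectorSearch.

(** * The subrepresentation generated by a Hecke translate *)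

Section Contradiction.
Variables (a : V) (r : nat) (Ia : Ieig a) (La : L r.+1 a) (nLa : ~ L r a).
Let b := hecke a.
Let fN x := pi (n_ x * al)%g a.
Let Na : Nfixed a. Proof. by case: Ia. Qed.
Let lwa : lw_fixed 1 a. Proof. by case: Ia. Qed.
Let Ta : T1fixed a. Proof. by case: Ia. Qed.
Let fN_inv : res_invariant fN := up_al_invariant Na.
(* Depth in the half-tree, regardless of what happens on the other side. *)
Local Notation T n := (addS (L n) (opp_halfspan varpi pi W)).
Local Notation B n := (ball varpi pi W n).
Let Ms : subspace (opp_halfspan varpi pi W) := opp_halfspan_subspace varpi pi W.
Let Ts n : subspace (T n) := addS_subspace (Ls n) Ms.
Let Bs n : subspace (B n) := ball_subspace varpi W_KZ n.

Local Lemma a_neq0 : a != 0.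
Proof. by apply/eqP => a0; apply: nLa; rewrite a0; apply: sub0. Qed.

Local Lemma Ja : J a. Proof. exact: layer_halfspan La. Qed.

Lemma Ieig_Iwahori z A B' C D : Ieig z -> O A -> O B' -> O C -> O D ->
  vunit (A * D - B' * C) -> valge 1 C -> exists s, pi (mx22 A B' C D) z = s *: z.
Proof.
move=> [Nz Lz _ ez] OA OB OC OD ut C1; have t0 := vunit_neq0 ut.
have uD : vunit D.
  have : vunit (D * A).
    have -> : D * A = (A * D - B' * C) + B' * C by ring.
    by apply: (vunit_cong ut); rewrite addrC addKr; apply: valgeMl.
  exact: vunit_dvd.
have D0 := vunit_neq0 uD; have OV := vunit_int (vunitV uD).
rewrite Iwahori_factor // !repM Lz; last by apply: valgeMr.
have [|s ->] := ez ((A * D - B' * C) / D) D _ uD.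
  by apply: vunitM => //; apply: vunitV.
by exists s; rewrite rhoZ Nz //; apply: integral_eltM.
Qed.

Let chi u v : k := xget 0 [set c | pi (dg u v) a = c *: a].

Local Lemma chiP u v : vunit u -> vunit v -> pi (dg u v) a = chi u v *: a.
Proof.
move=> uu uv; have [_ _ _ /(_ u v uu uv) ex] := Ia.
exact: (@xgetPex _ 0 [set c | pi (dg u v) a = c *: a]).
Qed.

Local Lemma scale_inj c d : c *: a = d *: a -> c = d.
Proof.
move=> /eqP; rewrite -subr_eq0 -scalerBl scaler_eq0 (negPf a_neq0) orbF subr_eq0.
by move/eqP.
Qed.

Local Lemma chiM u v u' v' : vunit u -> vunit v -> vunit u' -> vunit v' ->
  chi (u * u') (v * v') = chi u v * chi u' v'.
Proof.
move=> uu uv uu' uv'; apply: scale_inj; rewrite -chiP ?vunitM //.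
rewrite -dgM ?vunit_neq0 // repM (chiP uu' uv') rhoZ (chiP uu uv) scalerA.
by rewrite mulrC.
Qed.

Local Lemma chi_T1 u v : valge 1 (u - 1) -> valge 1 (v - 1) -> chi u v = 1.
Proof.
move=> u1 v1; apply: scale_inj; rewrite scale1r -chiP ?Ta //; exact: vunit_cong vunit1 _.
Qed.

(** The character of the coroot, extended by 0. *)
Let psi x : k := if vunit x then chi x x^-1 else 0.
Let e : k := chi (-1) 1.

Local Lemma psi0 x : ~~ vunit x -> psi x = 0.
Proof. by rewrite /psi => /negPf ->. Qed.

Local Lemma psi1 : psi 1 = 1.
Proof. by rewrite /psi vunit1 invr1 chi_T1 // subrr valge0. Qed.

Local Lemma psiM x y : vunit x -> vunit y -> psi (x * y) = psi x * psi y.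
Proof.
by move=> ux uy; rewrite /psi vunitM // ux uy invfM chiM //; apply: vunitV.
Qed.

Local Lemma psi_inv : res_invariant psi.
Proof.
move=> x y Ox Oy xy; have yx := valge_sym xy.
have uE : vunit x = vunit y by apply/idP/idP => /vunit_cong; apply.
have [uy|uy] := boolP (vunit y); last by rewrite !psi0 // uE.
have y0 := vunit_neq0 uy; have uV := vunitV uy.
have xyy : valge 1 (x / y - 1).
  have -> : x / y - 1 = y^-1 * (x - y) by field.
  by apply: valgeMl => //; apply: vunit_int.
have u1 := vunit_cong vunit1 xyy; have u0 := vunit_neq0 u1.
have -> : x = x / y * y by field.
rewrite psiM // {1}/psi u1 chi_T1 ?mul1r // valge_sym //.
have -> : 1 - (x / y)^-1 = (x / y)^-1 * (x / y - 1).
  by rewrite mulrBr mulVf // mulr1.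
by apply: valgeMl => //; apply/vunit_int/vunitV.
Qed.

Local Lemma e_neq0 : e != 0.
Proof.
have u1 : vunit (-1 : F) by rewrite vunitN vunit1.
have ee : e * e = 1.
  rewrite /e -chiM ?vunit1 // mulrNN !mulr1 chi_T1 // ?subrr ?valge0 //.
by apply: contra_eqN ee => /eqP ->; rewrite mul0r eq_sym oner_neq0.
Qed.

(** [ww] permutes the nonzero classes by inversion, and exchanges the branch
    of the class 0 with the branch through [Pi]. *)
Local Lemma ww_b : pi ww b =
  \sum_i (e * psi (res_elt i)) *: fN (res_elt i) + pi Pi a.
Proof.
pose h y := (e * psi y) *: fN y.
have h_inv : res_invariant h.
  by move=> x y Ox Oy xy; rewrite /h (psi_inv Ox Oy xy) (fN_inv Ox Oy xy).
rewrite (res_sum_inv h_inv) -[X in _ + X](@res_sum_nonunit p F V) -big_split.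
rewrite /b /hecke rho_sum; apply: eq_bigr => i _ /=; rewrite -repM /child.
set x := res_elt i; have Ox : O x := res_int i.
case: ifP => ux; last first.
  have x1 : valge 1 x by have := vunitP Ox; rewrite ux.
  have -> : pi (ww * (n_ x * al))%g a = pi Pi a.
    have -> : x = varpi * (x / varpi) by field.
    rewrite -(al_up varpi_unif) mulgA (wwal varpi_unif) repM Na //.
    exact: valge1_div.
  by rewrite /h /uinv ux psi0 ?mulr0 ?scale0r ?add0r // /vunit eqxx.
have x0 := vunit_neq0 ux; have uV := vunitV ux.
rewrite (ww_up_al varpi_unif x0) repM [pi (dg _ _ * _)%g a]repM lwa; last first.
  by apply: valgeMr (vunit_int uV); apply: valge_varpi.
rewrite chiP ?vunitN // rhoZ addr0 /h /uinv ux; congr (_ *: _).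
rewrite /psi uV invrK /e -chiM ?vunit1 ?vunitN ?vunit1 //.
by rewrite mulN1r mul1r.
Qed.

Local Notation R := (@residue p F).
Let term (c0 : k) (c : R -> k) :=
  c0 *: b + \sum_j c j *: pi (n_ (res_elt j) * ww)%g b.

Local Lemma up_ww_b m : O m -> pi (n_ m * ww)%g b =
  \sum_i (e * psi (res_elt i - m)) *: fN (res_elt i) + pi Pi a.
Proof.
move=> Om; rewrite repM ww_b rhoD rho_sum; congr (_ + _); last first.
  rewrite -repM (up_Pi varpi_unif) repM lwa //.
  by apply: valgeMr => //; apply: valge_varpi.
pose h x := (e * psi (x - m)) *: fN x.
have h_inv : res_invariant h.
  move=> x y Ox Oy xy; rewrite /h (fN_inv Ox Oy xy); congr (_ * _ *: _).
  by apply: psi_inv; [exact: integralB | exact: integralB | rewrite opprB addrA subrK].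
rewrite [RHS](res_sum_shift Om h_inv); apply: eq_bigr => i _.
by rewrite /h addrK rhoZ /fN -repM mulgA upM addrC.
Qed.

Local Lemma term_expand c0 c : term c0 c =
  \sum_i (c0 + e * \sum_j c j * psi (res_elt i - res_elt j)) *: fN (res_elt i)
  + (\sum_j c j) *: pi Pi a.
Proof.
rewrite /term.
have -> : \sum_j c j *: pi (n_ (res_elt j) * ww)%g b = \sum_j \sum_i
   (e * (c j * psi (res_elt i - res_elt j))) *: fN (res_elt i) + (\sum_j c j) *: pi Pi a.
  rewrite scaler_suml -big_split; apply: eq_bigr => j _ /=.
  rewrite (up_ww_b (res_int j)) scalerDr scaler_sumr; congr (_ + _).
  by apply: eq_bigr => i _; rewrite scalerA mulrCA.
rewrite addrA exchange_big /b /hecke scaler_sumr -big_split; congr (_ + _).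
apply: eq_bigr => i _ /=; rewrite scalerDl mulr_sumr scaler_suml.
by [].
Qed.

(** The cosets of the Iwahori subgroup in K are represented by 1 and the [n_ m
    * ww], and that subgroup acts on [b] by scalars. *)
Local Lemma genKZ_term t : gen pi KZ [set b] t -> exists c0 c, t = term c0 c.
Proof.
have Ib : Ieig b by apply: hecke_Ieig.
suff : gen pi KZ [set b] `<=` [set t | exists c0 c, t = term c0 c] by apply.
apply: gen_min.
  split.
    exists 0, (fun=> 0); rewrite /term scale0r add0r big1 // => j _.
    by rewrite scale0r.
  move=> s _ _ [c0 [c ->]] [d0 [d ->]]; exists (s * c0 + d0), (fun j => s * c j + d j).
  rewrite /term scalerDr scalerDl scalerA addrACA; congr (_ + _).
  rewrite scaler_sumr -big_split; apply: eq_bigr => j _ /=.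
  by rewrite scalerA scalerDl.
move=> g _ /KZP[z [A [B' [C [D [z0 [OA OB] [OC OD] ut ->]]]]]] ->.
have t0 := vunit_neq0 ut; have [d dP] := central_scalar z0.
have -> : mx22 (z * A) (z * B') (z * C) (z * D) = (dg z z * mx22 A B' C D)%g :> G.
  by rewrite mx22M //; [congr mx22; ring | nz].
rewrite repM dP; have [uC|C1] := orP (vunitP OC); last first.
  have [s ->] := Ieig_Iwahori Ib OA OB OC OD ut C1; exists (d * s), (fun=> 0).
  by rewrite /term scalerA big1 ?addr0 // => j _; rewrite scale0r.
have C0 := vunit_neq0 uC; have OV := vunit_int (vunitV uC).
have OAC : O (A / C) by apply: integral_eltM.
pose j := res_class (A / C); set m := res_elt j; have Om : O m := res_int j.
rewrite (Bruhat_factor m t0) mulgA repM.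
have [s ->] : exists s, pi (mx22 C D (A - m * C) (B' - m * D)) b = s *: b.
  apply: Ieig_Iwahori => //.
  - by apply: integralB => //; apply: integral_eltM.
  - by apply: integralB => //; apply: integral_eltM.
  - have -> : C * (B' - m * D) - D * (A - m * C) = - (A * D - B' * C) by ring.
    by rewrite vunitN.
  - have -> : A - m * C = (A / C - m) * C by field.
    by apply: valgeMr => //; apply: res_classP.
exists 0, (fun i => if i == j then d * s else 0).
rewrite /term scale0r add0r (bigD1 j) //= eqxx big1 ?addr0; last first.
  by move=> i /negPf ->; rewrite scale0r.
by rewrite rhoZ scalerA.
Qed.

(** The components along distinct children are independent, so the
    coefficients along them vanish. The sums of characters then force the
    coefficient along the branch through [Pi] to vanish too. *)
Local Lemma genKZ_zero t : gen pi KZ [set b] t -> T r.+1 t -> t = 0.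
Proof.
move=> /genKZ_term[c0 [c ->]]; rewrite term_expand.
set g := fun i => c0 + e * \sum_j c j * psi (res_elt i - res_elt j).
have MPa : opp_halfspan varpi pi W (pi Pi a) by exists a => //; apply: Ja.
move=> Tt; have Tg : T r.+1 (\sum_i g i *: fN (res_elt i)).
  apply: (sub_addr (Ts _) _ Tt); apply: (addSr (Ls _)).
  exact: subZ.
have gE : \sum_i g i *: fN (res_elt i) = \sum_i pi (child i) (g i *: a).
  by apply: eq_bigr => i _; rewrite rhoZ.
have Jg i : J (g i *: a) by apply: subZ => //; apply: Ja.
have g0 i : g i = 0.
  apply/eqP; apply: contraT => gi; case: nLa.
  rewrite -[a]scale1r -(mulVf gi) -scalerA; apply: subZ => //.
  apply: (layer_components (y := fun i => g i *: a)) => //.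
  rewrite -gE; apply: half_cut => //; rewrite gE.
  by apply: sub_sum => // j _; apply: halfspan_child.
rewrite big1 => [|i _]; last by rewrite -/(g i) g0 scale0r.
rewrite (character_combination p_prime k_pchar psi0 psi1 psi_inv psiM e_neq0 g0).
by rewrite scale0r addr0.
Qed.

Let LL := gen pi KZ [set b].
Let LLK : subrep pi KZ LL := gen_subrep pi [set b] (@KZ_subgroup p F).

(** In contrast with [layer], only the vertices at distance exactly [d]
    contribute. *)
Fixpoint sphere d : set V := if d is d'.+1 then branch varpi pi (sphere d') else LL.

Local Lemma LL_ball : LL `<=` B r.+2.
Proof.
apply: gen_min => // g _ Kg ->; apply: ball_KZ => //.
exact/(layer_ball W_KZ)/layer_hecke.
Qed.

Local Lemma sphere_ball d : sphere d `<=` B (r.+2 + d).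
Proof.
elim: d => [|d IH]; first by rewrite addn0; apply: LL_ball.
by rewrite addnS; apply: branch_min => // i x /IH; apply: ball_child.
Qed.

Local Lemma sphere_subspace d : subspace (sphere d).
Proof. by elim: d => [|d IH]; [exact: LLK.1 | exact: branch_subspace]. Qed.

Local Lemma layerLL_ball d : layer varpi pi LL d `<=` B (r.+2 + d).
Proof.
elim: d => [|d IH]; first by rewrite addn0; apply: LL_ball.
apply: addS_min => //; first by move=> x /LL_ball; apply: ball_le => //; lia.
by rewrite addnS; apply: branch_min => // i x /IH; apply: ball_child.
Qed.

Local Lemma layerLL_sphere d :
  layer varpi pi LL d.+1 `<=` addS (layer varpi pi LL d) (sphere d.+1).
Proof.
elim: d => [|d IH] //.
have Lss := layer_subspace varpi pi d.+1 LLK.1.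
have Ss := sphere_subspace d.+2.
have As : subspace (addS (layer varpi pi LL d.+1) (sphere d.+2)) by apply: addS_subspace.
apply: addS_min => //.
  by move=> x LLx; apply: addSl => //; apply: layer_base LLx; apply: LLK.1.
apply: branch_min => // i x /IH[y Ly [z Sz <-]]; rewrite rhoD.
exists (pi (child i) y); first by apply: layer_child => //; apply: LLK.1.
by exists (pi (child i) z) => //; apply: (@branch_single _ _ _ _ _ pi (sphere d.+1));
   first exact: sphere_subspace.
Qed.

Local Lemma T_le m n : (m <= n)%N -> T m `<=` T n.
Proof.
move=> mn _ [x Lx [y My <-]]; exists x; last by exists y.
exact: (layer_le Ws mn Lx).
Qed.

Local Lemma ball_T n : B n `<=` T n.
Proof.
move=> x /(ball_half varpi_unif W_KZ)[y Ly [->|[z Lz ->]]].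
  by exists y => //; exists 0; rewrite ?addr0 //; apply: sub0.
exists y => //; exists (pi Pi z) => //; exists z => //; exact: layer_halfspan Lz.
Qed.

Local Lemma Pi_ball_T n x : B n.+1 x -> T n (pi Pi x).
Proof.
rewrite (ball_halves varpi_unif W_KZ) => -[y Ly [_ [z Lz <-] <-]].
rewrite rhoD (rho_Pi2 varpi_unif) addrC.
exists (pi (dg varpi varpi) z); first exact: layer_scalar.
by exists (pi Pi y) => //; exists y => //; apply: layer_halfspan Ly.
Qed.

Local Lemma PiV_ball_T n x : B n.+1 (pi Pi x) -> T n x.
Proof.
move=> Bx; have -> : x = pi Pi (pi (dg varpi^-1 varpi^-1) (pi Pi x)).
  by rewrite -[pi (dg _ _) _]repM -(PiV varpi_unif) repVK.
apply: Pi_ball_T; apply: ball_KZ => //; apply: scalar_KZ; by rewrite invr_eq0.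
Qed.

(** Components along the branches inherit the bound on the depth, until
    [genKZ_zero] applies at the vertices of the sphere. *)
Local Lemma sphere_zero d f : sphere d f -> T (r.+1 + d) f -> f = 0.
Proof.
elim: d f => [|d IH] f; first by rewrite addn0; apply: genKZ_zero.
move=> [g Sg <-]; rewrite addnS => Tg.
have /choice[j jP] i : exists jj : V * V, [/\ L (r.+1 + d).+1 jj.1, L (r.+1 + d) jj.2
    & g i = jj.1 + pi Pi jj.2].
  have := sphere_ball (Sg i); rewrite -[r.+2]addn1 -addnA add1n addnS.
  rewrite (ball_halves varpi_unif W_KZ) => -[y Ly [_ [z Lz <-] E]].
  by exists (y, z).
suff Tgi i : T (r.+1 + d) (g i).
  by rewrite big1 // => i _; rewrite (IH _ (Sg i) (Tgi i)) rho0.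
have [_ Lj2 ->] := jP i.
exists (j i).1; last by exists (pi Pi (j i).2) => //; exists (j i).2 => //; apply: layer_halfspan Lj2.
apply: (layer_components (y := fun i => (j i).1)).
  by move=> l; have [Lj1 _ _] := jP l; apply: layer_halfspan Lj1.
apply: half_cut.
  by apply: sub_sum => // l _; apply: (halfspan_child varpi_unif); have [Lj1 _ _] := jP l; apply: layer_halfspan Lj1.
have -> : \sum_l pi (child l) (j l).1 = \sum_l pi (child l) (g l)
    - \sum_l pi (child l) (pi Pi (j l).2).
  rewrite -sumrB; apply: eq_bigr => l _; have [_ _ ->] := jP l.
  by rewrite rhoD addrK.
apply: subB => //; apply: sub_sum => // l _; have [_ L2 _] := jP l.
apply: (@T_le (r.+1 + d)) => //; apply: ball_T.
rewrite repM (rho_al_Pi varpi_unif).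
apply: ball_KZ; [exact: W_KZ | by apply/up_KZ/res_int |].
apply: ball_KZ; [exact: W_KZ | exact: ww_KZ |].
by apply: layer_ball => //; apply: layer_scalar.
Qed.

(** The part of [f] on the largest sphere that contributes to it determines
    its depth. *)
Local Lemma order_exists f : halfspan pi LL f -> f != 0 ->
  exists d, B (r.+2 + d) f /\ ~ T (r.+1 + d) f.
Proof.
rewrite (halfspan_layer varpi_unif LLK) => -[n _ Ln] f0.
have exn : exists n, `[< layer varpi pi LL n f >] by exists n; apply/asboolP.
case: (ex_minnP exn) => d /asboolP Ld dmin; exists d; split; first exact: layerLL_ball.
case: d Ld dmin => [|d] Ld dmin Tf.
  by move: f0; rewrite (genKZ_zero Ld) ?eqxx // -[r.+1]addn0.
have [u Lu [s Ss uE]] := layerLL_sphere Ld.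
have Tu : T (r.+1 + d.+1) u.
  by rewrite addnS -addSn; apply/ball_T/layerLL_ball.
have s0 : s = 0.
  by apply: sphere_zero Ss _; rewrite -uE in Tf; apply: sub_addl Tu Tf.
have /dmin : `[< layer varpi pi LL d f >] by apply/asboolP; rewrite -uE s0 addr0.
by rewrite ltnn.
Qed.

(** A nonzero element of the subrepresentation is a sum over the two
    half-trees, and is at least as deep as [b] on the side where its support
    reaches farther; but [a] is less deep than [b]. *)
Lemma hecke_not_gen : ~ gen pi [set: G] [set b] a.
Proof.
move=> ga; have : gen pi [set: G] LL a.
  by apply: gen_mono ga; apply: gen_self KZ1.
rewrite (gen_halves varpi_unif LLK) => -[f Pf [_ [f' Pf' <-] E]].
have Ba : B r.+1 a by apply: layer_ball.
have Taa d : T (r.+1 + d) a by apply: (T_le (leq_addr _ _)); apply: ball_T.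
(* The part on one side cannot be deeper than the part on the other one:
   [case1] for the half-tree of the origin, [case2] for the opposite one. *)
have case1 d : B (r.+2 + d) f -> ~ T (r.+1 + d) f -> ~ T (r.+1 + d) (pi Pi f').
  by move=> _ nT TPf; apply: nT; apply: (sub_addr (Ts _) TPf); rewrite E.
have case2 d : ~ T (r.+1 + d) f' -> ~ B (r.+1 + d) f.
  move=> nT Bf; apply: nT; apply: (@T_le (r + d)); first by rewrite addSn.
  apply: PiV_ball_T; rewrite -addSn; apply: (sub_addl (Bs _) Bf); rewrite E.
  by apply: (ball_le _ Ba); apply: leq_addr.
have [f'0|/(order_exists Pf')[d' [Bf' nTf']]] := eqVneq f' 0.
  have [f0|/(order_exists Pf)[d [Bf /(case1 d Bf)]]] := eqVneq f 0.
    by have := a_neq0; rewrite -E f0 f'0 rho0 addr0 eqxx.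
  by apply; rewrite f'0 rho0; apply: sub0.
have [f0|/(order_exists Pf)[d [Bf nTf]]] := eqVneq f 0.
  by apply: (case2 _ nTf'); rewrite f0; apply: sub0.
have [dd'|d'd] := ltnP d d'.
  by apply: (case2 _ nTf'); apply: (ball_le _ Bf); lia.
apply: (case1 _ Bf nTf); apply: (@T_le (r.+1 + d')); first by lia.
by apply: Pi_ball_T; rewrite -addSn.
Qed.

End Contradiction.

(** Otherwise an Iwahori eigenvector [a] lies outside [W], and [hecke a]
    generates a nonzero subrepresentation that does not contain [a]. *)
Lemma Nfixed_halfspan_sub : irreducible pi -> fin_dim W ->
  forall x, J x -> Nfixed x -> W x.
Proof.
move=> irr fdW x Jx Nx; apply: contrapT => nWx.
have [a [r [Ia La nLa]]] := exists_Ieig Jx Nx nWx fdW.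
apply: (hecke_not_gen Ia La nLa).
rewrite (@irreducible_gen _ _ _ _ pi [set hecke a] (hecke a) irr) //.
apply/eqP => h0; apply: nLa; apply: hecke_layer; first exact: layer_halfspan La.
by rewrite h0; apply: sub0.
Qed.

End Invariants.

(** * Admissibility *)

Section Admissibility.
Context {p : nat} (p_prime : prime p) {F : localField p}.
Context (varpi : F) (varpi_unif : uniformizer varpi).
Context {k : closedFieldType} (k_pchar : p \in [pchar k]).
Context {V : lmodType k} (pi : rep (GL2 F) V) (pi_smooth : smooth pi).
Local Notation G := (GL2 F).
Local Notation O := (@integral_elt p F).
Local Notation Pi := (mx22 0 1 varpi 0).
Let v0 : varpi != 0 := varpi_neq0 varpi_unif.

Lemma smooth_cong_fin_dim (S : set V) : fin_dim S ->
  exists2 n : nat, (0 < n)%N & forall g x, cong n g -> S x -> pi g x = x.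
Proof.
move=> /fin_dimP[s ->]; suff [n n0 nP] : exists2 n : nat, (0 < n)%N &
    forall g x, cong n g -> x \in s -> pi g x = x.
  exists n => // g x cg; suff : sp s `<=` [set x | pi g x = x] by apply.
  apply: sp_min => [|y ys]; last exact: nP.
  by split=> /= [|a y z e1 e2]; rewrite ?rho0 // (rep_linear pi) e1 e2.
elim: s => [|y s [n n0 nP]]; first by exists 1%N.
have [m m0 mP] := smooth_cong pi_smooth y.
exists (maxn n m) => [|g x cg]; first by rewrite leq_max n0.
rewrite inE => /orP[/eqP->|xs].
  by apply: mP; apply: cong_le cg; rewrite lez_nat leq_maxr.
by apply: nP => //; apply: cong_le cg; rewrite lez_nat leq_maxl.
Qed.

Variables (W : set V) (W_KZ : subrep pi KZ W) (eW : edge_closed varpi pi W).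
Context (fdW : fin_dim W).
Local Notation J := (halfspan pi W).
Let Js : subspace J := halfspan_subspace pi W.

Definition halfspan_fixed (m : nat) : set V :=
  [set x | J x /\ forall b, valge m b -> pi (n_ b) x = x].

Lemma halfspan_fixed_subspace m : subspace (halfspan_fixed m).
Proof.
apply: subspaceI => //; split=> [b bm|a x y ex ey b bm]; first by rewrite rho0.
by rewrite (rep_linear pi) ex // ey.
Qed.

Lemma valge_pX m : valge m%:Z ((p ^ m)%:R : F).
Proof.
elim: m => [|m IH]; first by rewrite expn0 /valge valn1 lexx orbT.
by rewrite expnS natrM -add1n PoszD; apply: valgeM => //; apply: residue_pchar.
Qed.

Lemma unipotent_prod e :
  'X^(p ^ e) - 1 = \prod_(c <- nseq (p ^ e) 1) ('X - c%:P) :> {poly k}.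
Proof.
rewrite big_nseq iter_mulr_1 polyC1.
have pn : [pchar {poly k}].-nat (p ^ e)%N.
  by rewrite pnatX pnatE // (rmorph_pchar (@polyC k)).
by rewrite exprDn_pchar // exprNn_pchar // expr1n.
Qed.

(** A p-group acting in characteristic p on a space with finite-dimensional
    invariants acts on a finite-dimensional space: each unipotent element has
    1 as its only eigenvalue. *)
Lemma halfspan_fixed_fin_dim m :
  (forall x, J x -> (forall b, O b -> pi (n_ b) x = x) -> W x) -> fin_dim (halfspan_fixed m).
Proof.
move=> JW; have [l lP] := finite_approx varpi_unif m.
pose Z (l : seq F) := halfspan_fixed m `&` [set x | forall b, b \in l -> pi (n_ b) x = x].
have Zs l' : subspace (Z l').
  apply: subspaceI; first exact: halfspan_fixed_subspace.
  split=> [b bl|a x y ex ey b bl]; first by rewrite rho0.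
  by rewrite (rep_linear pi) ex // ey.
have Zfull : fin_dim (Z [seq b <- l | O b]).
  apply: (fin_dim_sub (Zs _) _ fdW) => x [[Jx xm] xl]; apply: JW => // b Ob.
  have [c cl bc] := lP _ Ob.
  have -> : b = c + (b - c) by rewrite addrC subrK.
  rewrite -upM repM xm //; apply: xl; rewrite mem_filter cl andbT.
  by rewrite -(subKr b c); apply: integralB => //; apply: valge_int bc.
have lO : forall b, b \in [seq b <- l | O b] -> O b.
  by move=> b; rewrite mem_filter => /andP[].
suff : fin_dim (Z [::]).
  by apply: fin_dim_sub; [exact: halfspan_fixed_subspace | move=> x Px; split].
elim: {l lP}[seq b <- l | O b] Zfull lO => // b l IH Zbl lO.
apply: IH; last by move=> c cl; apply: lO; rewrite inE cl orbT.
have Ob : O b by apply: lO; rewrite mem_head.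
apply: (fin_dim_eigen (rep_linear pi (n_ b)) _ (unipotent_prod m)) => //.
- by rewrite expn_gt0 prime_gt0.
- move=> x [[Jx xm] xl]; split; first split.
  + by apply: halfspan_Pplus Jx; apply: Pplus_up.
  + by move=> c cm; rewrite -repM upM addrC -upM repM xm.
  + by move=> c cl; rewrite -repM upM addrC -upM repM xl.
- move=> x [[Jx xm] xl].
  have -> j : iter j (pi (n_ b)) x = pi (n_ (j%:R * b)) x.
    elim: j => [|j IHj] /=; first by rewrite mul0r up0 rep1.
    by rewrite IHj -repM upM -natr1 mulrDl mul1r addrC.
  by apply: xm; apply: valgeMr => //; apply: valge_pX.
- move=> c /nseqP[-> _]; apply: fin_dim_sub Zbl.
    by apply: subspaceI => //; split=> /= [|a x y e1 e2];
       rewrite ?rho0 ?scale1r // (rep_linear pi) e1 e2 !scale1r.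
  move=> x [[Px xl] /= xb]; split=> // d; rewrite inE => /orP[/eqP->|/xl//].
  by rewrite xb scale1r.
Qed.

Lemma opp_halfspan_up b x : O b -> opp_halfspan varpi pi W x -> opp_halfspan varpi pi W (pi (n_ b) x).
Proof.
move=> Ob [y Py <-]; rewrite -repM (up_Pi varpi_unif) repM.
exists (pi (lw (varpi * b)) y) => //; apply: (halfspan_lw W_KZ) => //.
by apply: valgeMr => //; apply: valge_varpi.
Qed.

Lemma opp_halfspan_dg u x : vunit u -> opp_halfspan varpi pi W x -> opp_halfspan varpi pi W (pi (dg u 1) x).
Proof.
move=> uu [y Py <-]; have u0 := vunit_neq0 uu.
rewrite -repM (dg_Pi varpi_unif) ?oner_neq0 // repM; eexists; last reflexivity.
have -> : dg 1 u = (dg u u * dg u^-1 1%R)%g :> G.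
  by rewrite dgM ?oner_neq0 ?invr_eq0 // divff // mulr1.
rewrite repM; apply: (halfspan_scalar varpi_unif W_KZ) => //.
by apply: halfspan_Pplus Py; apply/Pplus_dg/vunitV.
Qed.

(** The defect of invariance of the component on a half-tree is a cocycle with
    values in D_1(W), on which a congruence subgroup acts trivially. There it
    is a homomorphism, trivial on commutators, and the commutators of the
    torus with the unipotents exhaust a congruence subgroup of the unipotents.
    *)
Lemma halves_invariants m : exists M, forall x y : V, J x -> opp_halfspan varpi pi W y ->
  (forall h, cong (m%:Z) h -> pi h (x + y) = x + y) -> halfspan_fixed M x.
Proof.
have [n n0 nP] := smooth_cong_fin_dim fdW.
pose q := maxn m n; exists (q + q)%N => x y Jx My xy.
have q1 : (1 : int) <= q%:Z by rewrite lez_nat leq_max n0 orbT.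
have cm (h : G) : cong q h -> cong m h by apply: cong_le; rewrite lez_nat leq_maxl.
have cn (h : G) : cong q h -> cong n h by apply: cong_le; rewrite lez_nat leq_maxr.
have cocycle h : cong q h -> J (pi h x) -> opp_halfspan varpi pi W (pi h y) ->
    W (pi h x - x).
  move=> ch Jh Mh; apply: eW; split; first exact: subB.
  have -> : pi h x - x = y - pi h y.
    have := xy _ (cm _ ch); rewrite rhoD => /eqP.
    by rewrite -subr_eq0 opprD addrACA addr_eq0 opprB => /eqP.
  by apply: subB => //; apply: opp_halfspan_subspace.
(* [b'] is [(u - 1) * b] with both factors of valuation at least [q], and
   [n_ b'] is the commutator of the torus element [u] with [n_ b]. *)
split=> // b' b'M; pose u := 1 + varpi ^+ q; pose b := b' / varpi ^+ q.
have X0 : varpi ^+ q != 0 by rewrite expf_neq0.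
have Xq : valge q (varpi ^+ q).
  elim: (q) => [|j IH]; first by rewrite expr0 /valge valn1 lexx orbT.
  by rewrite exprS -addn1 PoszD; apply: valge_mul_varpi.
have bq : valge q b.
  have [z Oz zE] := valge_varpiX varpi_unif b'M.
  have -> : b = varpi ^+ q * z by rewrite /b zE exprD; field.
  exact: valgeMr.
have Ob : O b by apply: (valge_int _ bq); rewrite lez_nat.
have u1 : valge q (u - 1) by rewrite /u addrC addKr.
have uu : vunit u by apply: vunit_cong vunit1 _; apply: valge_le u1.
have u0 := vunit_neq0 uu.
have ct : cong q (dg u 1 : G).
  by apply/cong_mx22; [nz | split; rewrite ?subrr ?valge0].
have cup c : valge q c -> cong q (n_ c : G).
  by move=> qc; apply/cong_mx22; [nz | split; rewrite ?subrr ?valge0].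
have Wt : W (pi (dg u 1) x - x).
  by apply: cocycle => //; [apply: halfspan_Pplus Jx; apply: Pplus_dg | exact: opp_halfspan_dg].
have Wn : W (pi (n_ b) x - x).
  by apply: cocycle; [exact: cup | apply: halfspan_Pplus Jx; apply: Pplus_up | exact: opp_halfspan_up].
set z := pi (n_ b) (pi (dg u 1) x).
have zE : z = x + ((pi (n_ b) x - x) + (pi (dg u 1) x - x)).
  rewrite /z -{1}(subrK x (pi (dg u 1) x)) rhoD (nP _ _ (cn _ (cup _ bq)) Wt).
  by rewrite [RHS]addrA [x + _]addrC subrK addrC.
have zE' : pi (dg u 1) (pi (n_ b) x) = z.
  rewrite -{1}(subrK x (pi (n_ b) x)) rhoD (nP _ _ (cn _ ct) Wn) zE.
  by rewrite [RHS]addrCA [x + _]addrC subrK.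
have Ws := W_KZ.1.
have b'E : b' = (u - 1) * b by rewrite /u /b; field.
have b'q : valge q b' by rewrite b'E; apply: valgeMl => //; apply: valge_int u1; rewrite lez_nat.
have fixz : pi (n_ b') z = z.
  rewrite /z -[pi (n_ b') _]repM upM -[in RHS]/z -zE' -!repM.
  by rewrite dg_up ?oner_neq0 // divr1 b'E mulrBl mul1r subrK.
move: fixz; rewrite zE rhoD (nP (n_ b') (_ + _)); first exact: addIr.
  exact/cn/cup.
exact: subD.
Qed.

Lemma cong_conj_Pi m h : cong (m + 1) h -> cong m (Pi * h * Pi^-1)%g.
Proof.
have [a [b [c [d [t0 ->]]]]] := mx22P h => /(cong_mx22 _ t0)[a1 b1 c1 d1].
have -> : (Pi * mx22 a b c d * Pi^-1 = mx22 d (c / varpi) (varpi * b) a)%g.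
  have t1 : d * a - c / varpi * (varpi * b) != 0.
    by have -> : d * a - c / varpi * (varpi * b) = a * d - b * c by field.
  by apply: (mulIg Pi); rewrite mulgVK !mx22M //; [congr mx22; field | nz | nz].
apply/cong_mx22.
  by have -> : d * a - c / varpi * (varpi * b) = a * d - b * c by field.
have mm : m <= m + 1 by lia.
split; [exact: valge_le mm d1 | exact: valge_div_varpi | | exact: valge_le mm a1].
by apply: valgeMl; [exact: varpi_int | exact: valge_le mm b1].
Qed.

Lemma invariants_subspace H (S : set V) : subspace S -> subspace (invariants pi H S).
Proof.
move=> Ss; split; first by split=> [|g _]; [exact: sub0 | rewrite rho0].
move=> a x y [Sx ex] [Sy ey]; split; first exact: Ss.2.
by move=> g Hg; rewrite (rep_linear pi) ex // ey.
Qed.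

(** The parts of an invariant vector on the two half-trees are fixed by
    unipotents of a level that depends only on the open subgroup. *)
Lemma edge_closed_admissible : gen pi [set: G] W = [set: V] ->
  (forall x, J x -> (forall b, O b -> pi (n_ b) x = x) -> W x) -> admissible pi.
Proof.
move=> Wgen JW; split=> // H [H1 _ _] oH.
have [m _ mH] := open_cong oH H1.
have [M MP] := halves_invariants m; have [N NP] := halves_invariants m.+1.
apply: (fin_dim_sub (@invariants_subspace H _ (@subspaceT _ _)) _
  (fin_dimD (halfspan_fixed_fin_dim M JW)
     (fin_dim_im (rep_linear pi Pi) (halfspan_fixed_fin_dim N JW)))).
move=> x [_ xH]; have : gen pi [set: G] W x by rewrite Wgen.
rewrite (gen_halves varpi_unif W_KZ) => -[y Jy [_ [z Jz <-] xE]].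
have xm h : cong m h -> pi h x = x by move=> /mH; apply: xH.
exists y.
  apply: (MP _ (pi Pi z)) => //; first by exists z.
  by move=> h ch; rewrite xE xm.
exists (pi Pi z) => //; exists z => //.
apply: (NP _ (pi (Pi^-1)%g y)) => //.
  apply/(opp_halfspan_PiV varpi pi W); rewrite (PiV varpi_unif) -repM.
  have -> : (dg varpi^-1 varpi^-1 * Pi * (dg varpi^-1 varpi^-1 * Pi) =
      dg varpi^-1 varpi^-1 :> G)%g.
    rewrite -mulgA [(Pi * (_ * _))%g]mulgA -(center_scalar _ Pi) ?invr_eq0 //.
    by rewrite -mulgA (Pi2 varpi_unif) [(dg varpi^-1 _ * dg varpi _)%g]dgM ?invr_eq0 //
      mulVf // mx22_1 mulg1.
  by apply: (halfspan_scalar varpi_unif W_KZ); rewrite ?invr_eq0.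
move=> h ch; have -> : z + pi (Pi^-1)%g y = pi (Pi^-1)%g x.
  by rewrite -xE rhoD repK addrC.
have E : (h * Pi^-1 = Pi^-1 * (Pi * h * Pi^-1))%g by rewrite !mulgA mulVg mul1g.
by rewrite -repM E repM xm //; apply: cong_conj_Pi; rewrite -PoszD addn1.
Qed.

End Admissibility.

(** * The equivalences *)

Theorem mainTheorem3 (p : nat) (p_prime : prime p)
    (F : localField p) (varpi : F) (varpi_unif : uniformizer varpi)
    (k : closedFieldType) (k_pchar : p \in [pchar k])
    (V : lmodType k) (pi : rep (GL2 F) V)
    (pi_smooth : smooth pi) (pi_irr : irreducible pi)
    (pi_central : has_central_character pi) :
  (exists sigma : set V, irreducible_subrep pi KZ sigma) /\
  forall sigma : set V, irreducible_subrep pi KZ sigma ->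
    [/\ fin_dim (D1 varpi pi sigma) <-> admits_finite_presentation pi,
        admits_finite_presentation pi <-> admits_standard_presentation varpi pi
      & [\/ fin_dim (D1 varpi pi sigma), admits_finite_presentation pi
          | admits_standard_presentation varpi pi] ->
        admissible pi /\ fin_dim (invariants pi unipO (Iplus pi sigma))].
Proof.
split; first exact: (exists_irreducible_KZ varpi_unif pi_smooth pi_central).
move=> sigma sigma_irr; have [SK S0 _] := sigma_irr.
have fdS := irreducible_KZ_fin_dim varpi_unif pi_smooth pi_central sigma_irr.
have [x Sx x0] := nonzero_elt SK.1 S0.
have Sgen := irreducible_gen pi_irr Sx x0.
have i_W : fin_dim (D1 varpi pi sigma) -> exists W, [/\ presentations pi W,
    edge_closed varpi pi W & sigma `<=` W].
  move=> fdD.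
  have [n nP] : exists n, D1 varpi pi sigma `<=` ball varpi pi sigma n.
    apply: directed_sub fdD _ => [n|n|y _]; first exact: ball_subspace.
      exact: ball_incr.
    by rewrite -(gen_ball varpi_unif SK) Sgen.
  have SB : sigma `<=` ball varpi pi sigma n.+1 by apply: (@ball_le _ _ _ _ _ _ _ 0).
  exists (ball varpi pi sigma n.+1); split=> //.
    split; [exact: ball_subrep | exact: ball_fin_dim |].
    exact: (irreducible_gen pi_irr (SB _ Sx) x0).
  by apply: ball_edge_closed => // y /nP; apply: ball_incr.
have i_iii : fin_dim (D1 varpi pi sigma) -> admits_standard_presentation varpi pi.
  move=> /i_W[W [[WK fdW Wgen] eW _]]; exists W => //.
  exact: edge_closed_standard.
have iii_ii : admits_standard_presentation varpi pi -> admits_finite_presentation pi.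
  move=> [W [WK fdW Wgen] relE]; exists W => //; rewrite relE.
  exact: standard_relations_fin_gen.
have ii_i : admits_finite_presentation pi -> fin_dim (D1 varpi pi sigma).
  move=> [W [WK fdW Wgen] relfg].
  exact: (fin_pres_fin_dim_D1 varpi_unif pi_smooth WK fdW Wgen relfg fdS).
split; [by split; auto | by split; auto |].
move=> fin; have /i_W[W [[WK fdW Wgen] eW SW]] : fin_dim (D1 varpi pi sigma).
  by case: fin; auto.
have JW := Nfixed_halfspan_sub p_prime varpi_unif k_pchar pi_smooth pi_central WK eW pi_irr fdW.
split; first exact: (edge_closed_admissible p_prime varpi_unif k_pchar pi_smooth WK eW fdW Wgen JW).
apply: (fin_dim_sub _ _ fdW).
  by apply: invariants_subspace; apply: gen_subspace.
move=> y [Py yN]; apply: JW; first by apply: gen_mono Py.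
by move=> b Ob; apply: yN; exists b.
Qed.
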